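(* Let $n$ be a positive integer and let $D_n$ be the dihedral group of order $2n$. (1) Let $K$ be a field with $\operatorname{char}K\neq 2$. Then $\operatorname{ed}_K(D_n)=1$ if and only if both of the following conditions hold: (i) $n$ is an odd integer; and (ii) $\zeta_n+\zeta_n^{-1}\in K$ in case $\operatorname{char}K\nmid n$, while $n=p$ in case $\operatorname{char}K=p>0$ with $p\mid n$. (2) Let $K$ be a field with $\operatorname{char}K=2$. If $n$ is odd, then $\operatorname{ed}_K(D_n)=1$ if and only if $\zeta_n+\zeta_n^{-1}\in K$. If $n$ is even, then $\operatorname{ed}_K(D_n)=1$ if and only if $n=2$ and $|K|\ge 4$.
   Context: $D_n=\langle\sigma,\tau:\sigma^n=\tau^2=1,\ \tau\sigma\tau^{-1}=\sigma^{-1}\rangle$. $\zeta_n$ denotes a primitive $n$-th root of unity (in an algebraic closure of $K$). $\operatorname{char}K\nmid n$ means either $\operatorname{char}K=0$, or $\operatorname{char}K=p>0$ with $p\nmid n$. All fields are assumed to contain the ground field $K$. Let $L/L_0$ be a finite separable extension of fields containing $K$. For an intermediate field $K\subset E_0\subset L_0$, one says that $L/L_0$ is defined over $E_0$ if there is a field $E$ with $E_0\subset E\subset L$, $[E:E_0]=[L:L_0]$ and $L=EL_0$. The essential dimension $\operatorname{ed}_K(L/L_0)$ is the minimum of $\operatorname{trdeg}_K E_0$ (transcendence degree over $K$), where $E_0$ runs over all such fields over which $L/L_0$ is defined. For a finite group $G$, define $\operatorname{ed}_K(G)=\operatorname{ed}_K(K(V)/K(V)^G)$, where $G\to GL(V)$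 is a faithful finite-dimensional representation over $K$, $K(V)=K(x_1,\ldots,x_n)$ is the rational function field in a basis $x_1,\ldots,x_n$ of the dual space of $V$ with the induced $G$-action, and $K(V)^G$ is the fixed field; this does not depend on the choice of the faithful representation. *)

(* Defs.v *)
From HB Require Import structures.
From mathcomp Require Import all_boot all_order all_algebra.
From mathcomp Require Import all_fingroup all_solvable all_field all_character.
From mathcomp Require Import mpoly.

Set Implicit Arguments.
Unset Strict Implicit.
Unset Printing Implicit Defensive.

Import GRing.Theory.
Local Open Scope ring_scope.

Section FieldExtensions.

(* Fields containing K and contained in a fixed L are predicates on L; in a
   field, [divring_closed] says exactly "is a subfield". *)
Variables (K L : fieldType) (iota : {rmorphism K -> L}).

Definition lin_indep_over (E0 : {pred L}) (d : nat) (b : 'I_d -> L) : Prop :=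
  forall c : 'I_d -> L, (forall i, c i \in E0) ->
    \sum_(i < d) c i * b i = 0 -> forall i, c i = 0.

Definition spans_over (E0 E : {pred L}) (d : nat) (b : 'I_d -> L) : Prop :=
  forall x, x \in E ->
    exists2 c : 'I_d -> L, forall i, c i \in E0 & x = \sum_(i < d) c i * b i.

(* [E : E0] = d *)
Definition ext_degree (E0 E : {pred L}) (d : nat) : Prop :=
  exists b : 'I_d -> L,
    [/\ forall i, b i \in E, lin_indep_over E0 b & spans_over E0 E b].

(* L = E L0 *)
Definition compositum_full (E L0 : {pred L}) : Prop :=
  forall F : {pred L}, divring_closed F ->
    {subset E <= F} -> {subset L0 <= F} -> forall x, x \in F.

Definition alg_indep (d : nat) (t : 'I_d -> L) : Prop :=
  forall p : {mpoly K[d]}, mmap iota t p = 0 -> p = 0.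

(* trdeg_K E0 = d, as the largest size of a K-algebraically independent
   family in E0; no d qualifies when the transcendence degree is infinite. *)
Definition has_trdeg (E0 : {pred L}) (d : nat) : Prop :=
  (exists2 t : 'I_d -> L, forall i, t i \in E0 & alg_indep t) /\
  (forall (k : nat) (t : 'I_k -> L),
     (forall i, t i \in E0) -> alg_indep t -> (k <= d)%N).

Definition intermediate_field (L0 E0 : {pred L}) : Prop :=
  [/\ divring_closed E0, forall a : K, iota a \in E0 & {subset E0 <= L0}].

(* L/L0 is defined over E0 *)
Definition defined_over (L0 E0 : {pred L}) : Prop :=
  intermediate_field L0 E0 /\
  exists E : {pred L},
    [/\ divring_closed E, {subset E0 <= E},
        exists d, ext_degree E0 E d /\ ext_degree L0 predT d
      & compositum_full E L0].

(* ed_K(L/L0) = d *)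
Definition is_essdim (L0 : {pred L}) (d : nat) : Prop :=
  (exists2 E0 : {pred L}, defined_over L0 E0 & has_trdeg E0 d) /\
  (forall (E0 : {pred L}) (e : nat),
     defined_over L0 E0 -> has_trdeg E0 e -> (d <= e)%N).

End FieldExtensions.

Section RationalFunctions.

Variables (K : fieldType) (m : nat).

(* K(V) for V = 'rV[K]_m, with 'X_i the i-th coordinate function on V *)
Definition ratfun : fieldType := {fraction {mpoly K[m]}}.

Definition ratfunC : {rmorphism K -> ratfun} :=
  @FracField.tofrac {mpoly K[m]} \o @mpolyC m K.

(* f |-> (v |-> f (v *m A)) *)
Definition lin_subst (A : 'M[K]_m) (f : {mpoly K[m]}) : {mpoly K[m]} :=
  comp_mpoly [tuple \sum_(i < m) A i j *: 'X_i | j < m] f.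

(* On K(V), f / h |-> lin_subst A f / lin_subst A h; for invertible A this
   does not depend on the representative chosen by [repr]. *)
Definition ratfun_subst (A : 'M[K]_m) (x : ratfun) : ratfun :=
  let r : {ratio {mpoly K[m]}} := generic_quotient.repr x in
  FracField.tofrac (lin_subst A \n_r) / FracField.tofrac (lin_subst A \d_r).

End RationalFunctions.

Section GroupEssentialDimension.

(* A matrix representation acts on rows from the right, so that
   (g, f) |-> (v |-> f (v *m rG g)) is a left action of G on K(V). *)
Variables (K : fieldType) (gT : finGroupType) (G : {group gT}) (m : nat).
Variable rG : mx_representation K G m.

(* K(V)^G *)
Definition ratfun_fixed : {pred ratfun K m} :=
  [pred x | [forall g in G, ratfun_subst (rG g) x == x]].

(* ed_K(K(V)/K(V)^G) = d; this is ed_K(G) = d as soon as rG is faithful,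
   whichever faithful rG is used. *)
Definition is_essdim_group (d : nat) : Prop :=
  is_essdim (ratfunC K m) ratfun_fixed d.

End GroupEssentialDimension.

(* The presentation is spelled out because 'D_(n.*2) is only meant for n > 1. *)
Definition is_dihedral (n : nat) (gT : finGroupType) (G : {group gT}) : Prop :=
  (G \isog Grp (s : t : s ^+ n, t ^+ 2, t * s * t^-1 = s^-1))%g.

(* zeta_n + zeta_n^-1 \in K.  For z, w primitive n-th roots of unity w = z^a,
   and w + w^-1 is an integer polynomial in z + z^-1, so the choice of the
   root is immaterial. *)
Definition zeta_sum_in (K Kbar : fieldType) (j : {rmorphism K -> Kbar})
    (n : nat) : Prop :=
  exists2 z : Kbar, n.-primitive_root z & exists c : K, j c = z + z^-1.

Definition char_ndvd (K : fieldType) (n : nat) : Prop :=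
  forall p, p \in [pchar K] -> ~~ (p %| n)%N.

(* Main.v *)
Require Import Defs.
From HB Require Import structures.
From mathcomp Require Import all_boot all_order all_algebra.
From mathcomp Require Import all_fingroup all_solvable all_field all_character.
From mathcomp Require Import mpoly.
From mathcomp Require Import ring.
From Stdlib Require Import ClassicalEpsilon.

Set Implicit Arguments.
Unset Strict Implicit.
Unset Printing Implicit Defensive.

Import GRing.Theory.
Local Open Scope ring_scope.

(** Let G be the dihedral group, L = K(V) and L0 its field of invariants.

    A field of definition of transcendence degree zero does not exist, because K
    is algebraically closed in K(V) ([ratfun_alg_closed]), so essential dimension
    one means that there is a field of definition of transcendence degree one.

    Suppose that L/L0 is defined over such a field E0, with L = E L0.  For t
    transcendental in E0, the field E is algebraic over K(t), t is invariant, and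
    each g <> 1 moves an element of E ([essdim1_moved]).  Finitely many of these
    elements generate with t a G-stable field of transcendence degree one.  The
    restriction to a curve X_i = x^(N^i) with N large embeds it in K(x), by
    Lueroth's theorem it is generated by one element over K, and G acts on this
    generator by Moebius transformations ([mobius_model]).  So G embeds in
    PGL_2(K).  An element of order n prime to the characteristic in PGL_2(K) is
    the class of a matrix A with eigenvalues u and v such that u/v is a primitive
    n-th root of unity, and u/v + v/u = tr(A)^2/det(A) - 2 is in K
    ([mobius_action_zeta]).  An element whose order is a multiple of the
    characteristic p has order p ([mobius_action_pchar]); this forces n = p, and
    n = 2 when n is even in characteristic two.  Over the field with two elements
    PGL_2 has no Klein four-group ([mobius_action_klein]).

    The embedding in PGL_2(K) does not exclude even n in characteristic other than
    two.  There G contains a Klein four-group, which acts on V by diagonal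
    matrices with entries 1 and -1 in a suitable basis.  The sign by which such a
    matrix multiplies an eigenvector in K(V) is the parity of part of the exponent
    of its leading monomial.  Elements algebraic over the same K(t) have
    proportional leading exponents, and this is incompatible with the signs that
    occur ([no_klein_trdeg1]).

    Conversely let rho be a representation of G on K^2 in which only the identity
    acts as a scalar.  Averaging over G produces vectors of L^2 that G transforms
    through rho.  For a suitable one of them, the quotient z of its coordinates has
    a free orbit, and G acts on z by Moebius transformations
    ([equivariant_point]).  Then K(z) is G-stable, and the powers of z form a basis
    of K(z) over its invariants and a basis of L over L0 ([artin_defined_over]), so
    L/L0 is defined over the invariants of K(z) ([equivariant_defined_over]).  For
    n odd, rho sends s to the companion matrix of X^2 - c X + 1, where c is the sum
    of a primitive n-th root of unity and its inverse, or 2 when n is the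
    characteristic.  For n = 2 in characteristic two, unipotent matrices do, as
    soon as K has a Klein four-group as additive subgroup. *)

(** * Linear substitutions on rational functions *)

(** Subfields are boolean predicates, so the fields defined below by an
    undecidable condition need the truth value of a proposition. *)
Definition asb (P : Prop) : bool :=
  if excluded_middle_informative P then true else false.

Lemma asbP (P : Prop) : reflect P (asb P).
Proof. by rewrite /asb; case: excluded_middle_informative => h; constructor. Qed.

Notation tofrac := (@FracField.tofrac _).

Section FracLift.
Variables (A : idomainType) (L : fieldType).

Lemma frac_repr (x : {fraction A}) (r := generic_quotient.repr x : {ratio A}) :
  x = tofrac \n_r / tofrac \d_r.
Proof.
apply: (canRL (mulfK _)); first by rewrite tofrac_eq0 denom_ratioP.
rewrite -[x](generic_quotient.reprK) -/r; unlock FracField.tofrac.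
rewrite -[LHS]FracField.pi_mul; apply/generic_quotient.eqmodP => /=.
by rewrite /FracField.equivf /FracField.mulf /= !numden_Ratio ?mulr1 ?oner_neq0 ?denom_ratioP // mulrC.
Qed.

Lemma fracP (x : {fraction A}) :
  exists p q : A, q != 0 /\ x = tofrac p / tofrac q.
Proof.
exists \n_(generic_quotient.repr x : {ratio A}).
exists \d_(generic_quotient.repr x : {ratio A}).
by split; [exact: denom_ratioP | exact: frac_repr].
Qed.

Lemma frac_eq (p q p' q' : A) : q != 0 -> q' != 0 ->
  (tofrac p / tofrac q == tofrac p' / tofrac q') = (p * q' == p' * q).
Proof.
by move=> q0 q'0; rewrite eqr_div ?tofrac_eq0 // -!rmorphM /= tofrac_eq.
Qed.

(** Working with the representative picked by [generic_quotient.repr] makes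
    [ratfun_subst] a convertible instance of the extension of an injective
    morphism to fractions. *)
Variable f : {rmorphism A -> L}.
Hypothesis f_inj : injective f.

Definition frac_lift_fun (x : {fraction A}) : L :=
  let r : {ratio A} := generic_quotient.repr x in f \n_r / f \d_r.

Let f_neq0 q : q != 0 -> f q != 0.
Proof. by move=> q0; rewrite -(rmorph0 f) (inj_eq f_inj). Qed.

Lemma frac_lift_fun_div p q : q != 0 ->
  frac_lift_fun (tofrac p / tofrac q) = f p / f q.
Proof.
move=> q0; rewrite /frac_lift_fun.
have /eqP := frac_repr (tofrac p / tofrac q); rewrite frac_eq ?denom_ratioP // => /eqP e.
by apply/eqP; rewrite eqr_div ?f_neq0 ?denom_ratioP // -!rmorphM e.
Qed.

Lemma frac_lift_zmod : zmod_morphism frac_lift_fun.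
Proof.
move=> x y; have [p [q [q0 ->]]] := fracP x; have [r [s [s0 ->]]] := fracP y.
rewrite -mulNr addf_div ?tofrac_eq0 // -!rmorphM /= -rmorphN /= -rmorphM -rmorphD /=.
rewrite !frac_lift_fun_div ?mulf_neq0 // -mulNr addf_div ?f_neq0 //.
by rewrite rmorphD !rmorphM rmorphN.
Qed.

Lemma frac_lift_monoid : monoid_morphism frac_lift_fun.
Proof.
split=> [|x y].
  have := @frac_lift_fun_div 1 1 (oner_neq0 _).
  by rewrite !rmorph1 divr1 => ->; rewrite divr1.
have [p [q [q0 ->]]] := fracP x; have [r [s [s0 ->]]] := fracP y.
rewrite mulf_div -!rmorphM /= !frac_lift_fun_div ?mulf_neq0 //.
by rewrite mulf_div !rmorphM.
Qed.

Definition frac_lift : {rmorphism {fraction A} -> L} :=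
  HB.pack frac_lift_fun
    (GRing.isZmodMorphism.Build _ _ frac_lift_fun frac_lift_zmod)
    (GRing.isMonoidMorphism.Build _ _ frac_lift_fun frac_lift_monoid).

Lemma frac_lift_div p q : q != 0 ->
  frac_lift (tofrac p / tofrac q) = f p / f q.
Proof. exact: frac_lift_fun_div. Qed.

Lemma frac_lift_tofrac p : frac_lift (tofrac p) = f p.
Proof.
by have := frac_lift_div p (oner_neq0 A); rewrite !rmorph1 !divr1.
Qed.

End FracLift.

Lemma mpoly_rmorph_eq (K S : comNzRingType) m (f g : {rmorphism {mpoly K[m]} -> S}) :
  (forall c, f c%:MP = g c%:MP) -> (forall i, f 'X_i = g 'X_i) -> f =1 g.
Proof.
move=> eC eX p; rewrite [p]mpolyE !rmorph_sum /=; apply: eq_bigr => u _.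
rewrite -mul_mpolyC !rmorphM eC mpolyXE_id !rmorph_prod; congr (_ * _).
by apply: eq_bigr => i _; rewrite !rmorphXn eX.
Qed.

Section LinSubst.
Variables (K : fieldType) (m : nat).
Implicit Types A B : 'M[K]_m.

HB.instance Definition _ A := GRing.RMorphism.copy (@lin_subst K m A)
  (comp_mpoly [tuple \sum_(i < m) A i j *: 'X_i | j < m]).

Lemma lin_substX A j : lin_subst A 'X_j = \sum_(i < m) A i j *: 'X_i.
Proof. by rewrite /lin_subst comp_mpolyXU -tnth_nth tnth_mktuple. Qed.

Lemma lin_substC A c : lin_subst A c%:MP = c%:MP.
Proof. exact: comp_mpolyC. Qed.

Lemma lin_substZ A c p : lin_subst A (c *: p) = c *: lin_subst A p.
Proof. by rewrite -!mul_mpolyC rmorphM /= lin_substC. Qed.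

Lemma lin_substM A B p : lin_subst A (lin_subst B p) = lin_subst (A *m B) p.
Proof.
apply: (mpoly_rmorph_eq (f := lin_subst A \o lin_subst B)) => [c|j] /=.
  by rewrite !lin_substC.
rewrite !lin_substX rmorph_sum /=.
under eq_bigr do rewrite lin_substZ lin_substX scaler_sumr.
rewrite exchange_big /=; apply: eq_bigr => k _; rewrite mxE scaler_suml.
by apply: eq_bigr => i _; rewrite scalerA mulrC.
Qed.

Lemma lin_subst1 (p : {mpoly K[m]}) : lin_subst 1%:M p = p.
Proof.
apply: (mpoly_rmorph_eq (f := lin_subst (1%:M : 'M[K]_m)) (g := idfun) _ _ p) => [c|j] /=.
  exact: lin_substC.
rewrite lin_substX (bigD1 j) //= mxE eqxx scale1r big1 ?addr0 // => i ne.
by rewrite mxE (negPf ne) scale0r.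
Qed.

Lemma lin_substK A : A \in unitmx -> cancel (lin_subst A) (lin_subst (invmx A)).
Proof. by move=> uA p; rewrite lin_substM mulVmx // lin_subst1. Qed.

Section Unit.
Variables (A : 'M[K]_m) (uA : A \in unitmx).
Let f : {rmorphism {mpoly K[m]} -> ratfun K m} := tofrac \o lin_subst A.
Let f_inj : injective f.
Proof.
move=> p q /eqP; rewrite /= tofrac_eq => /eqP.
exact: (can_inj (lin_substK uA)).
Qed.

Definition ratfun_aut : {rmorphism ratfun K m -> ratfun K m} := frac_lift f_inj.

Lemma ratfun_autE x : ratfun_aut x = ratfun_subst A x. Proof. by []. Qed.

Lemma ratfun_subst_div p q : q != 0 -> ratfun_subst A (tofrac p / tofrac q) =
  tofrac (lin_subst A p) / tofrac (lin_subst A q).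
Proof. by move=> q0; rewrite -ratfun_autE /ratfun_aut frac_lift_div. Qed.

Lemma ratfun_subst_tofrac p :
  ratfun_subst A (tofrac p) = tofrac (lin_subst A p).
Proof. by rewrite -ratfun_autE /ratfun_aut frac_lift_tofrac. Qed.

Lemma lin_subst_neq0 p : p != 0 -> lin_subst A p != 0.
Proof. by rewrite -{2}(rmorph0 (lin_subst A)) (can_eq (lin_substK uA)). Qed.
End Unit.

Lemma ratfun_substM A B x : A \in unitmx -> B \in unitmx ->
  ratfun_subst A (ratfun_subst B x) = ratfun_subst (A *m B) x.
Proof.
move=> uA uB; have [p [q [q0 ->]]] := fracP x.
have uAB : A *m B \in unitmx by rewrite unitmx_mul uA.
rewrite (ratfun_subst_div uB _ q0) (ratfun_subst_div uAB _ q0).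
by rewrite (ratfun_subst_div uA _ (lin_subst_neq0 uB q0)) !lin_substM.
Qed.

Lemma ratfun_subst1 (x : ratfun K m) : ratfun_subst 1%:M x = x.
Proof.
have [p [q [q0 ->]]] := fracP x.
by rewrite ratfun_subst_div ?unitmx1 // !lin_subst1.
Qed.

Lemma ratfun_substC A c : A \in unitmx ->
  ratfun_subst A (ratfunC K m c) = ratfunC K m c.
Proof. by move=> uA; rewrite ratfun_subst_tofrac //= lin_substC. Qed.

End LinSubst.

Section RepAction.
Variables (K : fieldType) (gT : finGroupType) (G : {group gT}) (m : nat).
Variable rG : mx_representation K G m.

Let safe (g : gT) : 'M[K]_m := if g \in G then rG g else 1%:M.
Let safe_unit g : safe g \in unitmx.
Proof. by rewrite /safe; case: ifP => [/repr_mx_unit //|_]; rewrite unitmx1. Qed.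

(** Outside G the action is trivial, so that it is a field morphism for every
    element of the ambient type. *)
Definition ratfun_act (g : gT) : {rmorphism ratfun K m -> ratfun K m} :=
  ratfun_aut (safe_unit g).

Lemma ratfun_actE g x : g \in G -> ratfun_act g x = ratfun_subst (rG g) x.
Proof. by move=> gG; rewrite /ratfun_act ratfun_autE /safe gG. Qed.

Lemma ratfun_act1 x : ratfun_act 1%g x = x.
Proof. by rewrite ratfun_actE // repr_mx1 ratfun_subst1. Qed.

Lemma ratfun_actM g h x : g \in G -> h \in G ->
  ratfun_act (g * h)%g x = ratfun_act g (ratfun_act h x).
Proof.
move=> gG hG; rewrite (ratfun_actE _ gG) (ratfun_actE _ hG) (ratfun_actE _ (groupM gG hG)).
by rewrite (ratfun_substM _ (repr_mx_unit rG gG) (repr_mx_unit rG hG)) repr_mxM.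
Qed.

Lemma ratfun_actC g c : ratfun_act g (ratfunC K m c) = ratfunC K m c.
Proof. by rewrite /ratfun_act ratfun_autE ratfun_substC. Qed.

Lemma ratfun_fixedP x :
  reflect (forall g, g \in G -> ratfun_act g x = x) (x \in ratfun_fixed rG).
Proof.
apply: (iffP idP) => [|h].
  by rewrite inE => /forall_inP h g gG; rewrite ratfun_actE //; apply/eqP/h.
by rewrite inE; apply/forall_inP => g gG; rewrite -ratfun_actE // h.
Qed.

End RepAction.

(** * Leading exponents of rational functions *)

Arguments ratfunC : simpl never.

Section Valuation.
Variables (K : fieldType) (m : nat).
Notation L := (ratfun K m).
Implicit Types (p q : {mpoly K[m]}) (x y : L).

Lemma mpoly_sum_neq0 (I : finType) (P : pred I) (F : I -> {mpoly K[m]}) i0 :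
  P i0 -> (forall i, P i -> F i != 0) ->
  (forall i k, P i -> P k -> mlead (F i) = mlead (F k) -> i = k) ->
  \sum_(i | P i) F i != 0.
Proof.
move=> Pi0 F0 Finj.
case: (Order.TotalTheory.arg_maxP (fun i => mlead (F i)) Pi0) => i Pi imax.
apply/eqP => /(congr1 (mcoeff (mlead (F i)))).
rewrite mcoeff0 (bigD1 i) //= mcoeffD raddf_sum /= big1 => [|k /andP[Pk ki]].
  by rewrite addr0 => /eqP; rewrite mleadc_eq0 (negPf (F0 i Pi)).
apply: mcoeff_gt_mlead; rewrite Order.POrderTheory.lt_neqAle; apply/andP; split.
  by apply: contra ki => /eqP e; rewrite (Finj _ _ Pk Pi e).
exact: imax.
Qed.

Definition mon_exp p : 'rV[int]_m := \row_i ((mlead p i)%:Z).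

(** The exponent of the leading monomial, extended to fractions: a valuation
    of K(V) with values in the group Z^m of integer vectors, trivial on K. *)
Definition lead_val x : 'rV[int]_m :=
  mon_exp \n_(generic_quotient.repr x : {ratio {mpoly K[m]}}) -
  mon_exp \d_(generic_quotient.repr x : {ratio {mpoly K[m]}}).

Lemma mon_expM p q : p != 0 -> q != 0 -> mon_exp (p * q) = mon_exp p + mon_exp q.
Proof. by move=> p0 q0; apply/rowP => i; rewrite !mxE mleadM // mnmDE. Qed.

Lemma mon_exp_inj p q : mon_exp p = mon_exp q -> mlead p = mlead q.
Proof.
by move=> /rowP e; apply/mnmP => i; have := e i; rewrite !mxE => -[].
Qed.

Lemma lead_val_div p q : p != 0 -> q != 0 ->
  lead_val (tofrac p / tofrac q) = mon_exp p - mon_exp q.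
Proof.
move=> p0 q0; rewrite /lead_val; set x := _ / _.
have d0 := denom_ratioP (generic_quotient.repr x : {ratio {mpoly K[m]}}).
have /eqP := frac_repr x; rewrite {1}/x frac_eq // => /eqP e.
set n := \n_ _ in e *; set d := \d_ _ in e d0 *.
have n0 : n != 0 by apply: contra_neq (mulf_neq0 p0 d0); rewrite e => ->; rewrite mul0r.
by apply/eqP; rewrite subr_eq addrAC eq_sym subr_eq -!mon_expM // e.
Qed.

Lemma lead_valM x y : x != 0 -> y != 0 ->
  lead_val (x * y) = lead_val x + lead_val y.
Proof.
have [p [q [q0 ->]]] := fracP x; have [r [s [s0 ->]]] := fracP y.
rewrite !mulf_eq0 !invr_eq0 !tofrac_eq0 (negPf q0) (negPf s0) !orbF => p0 r0.
rewrite mulf_div -!rmorphM /= !lead_val_div ?mulf_neq0 // !mon_expM //.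
by rewrite opprD addrACA.
Qed.

Lemma lead_valC c : c != 0 -> lead_val (ratfunC K m c) = 0.
Proof.
move=> c0; have := @lead_val_div c%:MP 1 _ (oner_neq0 _).
rewrite rmorph1 divr1 => -> /=; last by rewrite mpolyC_eq0.
by apply/rowP => i; rewrite !mxE mlead1 mleadC subrr.
Qed.

Lemma lead_val1 : lead_val 1 = 0.
Proof. by rewrite -(lead_valC (oner_neq0 K)) rmorph1. Qed.

Lemma lead_valX x n : x != 0 -> lead_val (x ^+ n) = lead_val x *+ n.
Proof.
move=> x0; elim: n => [|n IH]; first by rewrite lead_val1.
by rewrite exprS lead_valM ?expf_neq0 // IH mulrS.
Qed.

(** The valuation axiom in the form used below: over a common denominator this
    is the fact that the largest leading monomial of the sum cannot cancel. *)
Lemma ratfun_sum_neq0 (I : finType) (P : pred I) (F : I -> L) i0 :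
  P i0 -> (forall i, P i -> F i != 0) ->
  (forall i k, P i -> P k -> lead_val (F i) = lead_val (F k) -> i = k) ->
  \sum_(i | P i) F i != 0.
Proof.
move=> Pi0 F0 Finj.
pose N i := \n_(generic_quotient.repr (F i) : {ratio {mpoly K[m]}}).
pose D i := \d_(generic_quotient.repr (F i) : {ratio {mpoly K[m]}}).
have D0 i : D i != 0 by apply: denom_ratioP.
have FE i : F i = tofrac (N i) / tofrac (D i) by apply: frac_repr.
have N0 i : P i -> N i != 0.
  by move=> /F0; rewrite FE; apply: contra_neq => ->; rewrite rmorph0 mul0r.
pose Q := \prod_i D i; pose G i := N i * \prod_(k | k != i) D k.
have Q0 : Q != 0 by apply/prodf_neq0.
have P0 i : \prod_(k | k != i) D k != 0 by apply/prodf_neq0.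
have GE i : F i * tofrac Q = tofrac (G i).
  rewrite FE /Q (bigD1 i) //= rmorphM /= mulrA divfK ?tofrac_eq0 //.
  by rewrite -rmorphM.
suff: \sum_(i | P i) G i != 0.
  rewrite -tofrac_eq0 rmorph_sum /=; apply: contra_neq => s0.
  under eq_bigr do rewrite -GE.
  by rewrite -mulr_suml s0 mul0r.
apply: (mpoly_sum_neq0 Pi0) => [i Pi|i k Pi Pk e].
  by rewrite mulf_neq0 ?N0.
apply: Finj => //; apply: (addIr (mon_exp Q)).
have vE j : P j -> lead_val (F j) + mon_exp Q = mon_exp (G j).
  move=> Pj; rewrite FE lead_val_div ?N0 // /Q (bigD1 j) //=.
  by rewrite mon_expM // addrA subrK /G mon_expM ?N0.
by rewrite !vE // /mon_exp e.
Qed.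

Lemma mulrIn_row (v : 'rV[int]_m) i k : v != 0 -> v *+ i = v *+ k -> i = k.
Proof.
move=> v0 e; have [j vj] : exists j, v 0 j != 0.
  apply/existsP; apply: contraR v0; rewrite negb_exists => /forallP h.
  by apply/eqP/rowP => j; rewrite mxE; apply/eqP; rewrite -[_ == _]negbK h.
by move/rowP/(_ j): e; rewrite !mulmxnE => /(Num.Theory.mulrIn vj).
Qed.

(** If [lead_val x] is nonzero, the powers of [x] have distinct leading
    exponents and admit no linear relation over K. *)
Lemma lead_val_algebraic x : x != 0 -> algebraicOver (ratfunC K m) x ->
  lead_val x = 0.
Proof.
move=> x0 [p p0]; rewrite /root horner_coef size_map_poly.
(* the embedding is generalized to keep it from unfolding to fractions *)
move: (ratfunC K m) lead_valC => iC lead_valiC rx.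
apply/eqP/negPn/negP => v0; move/negP: rx; apply.
rewrite (bigID (fun i : 'I_(size p) => p`_i != 0)) /=.
rewrite [X in _ + X]big1 => [|i]; last first.
  by rewrite negbK coef_map => /eqP ->; rewrite raddf0 mul0r.
rewrite addr0; have sp : ((size p).-1 < size p)%N.
  by rewrite prednK // size_poly_gt0.
apply/negP; apply: (@ratfun_sum_neq0 _ _ _ (Ordinal sp)) => [|i pi|i k pi pk].
- by rewrite /= -lead_coefE lead_coef_eq0.
- rewrite coef_map; apply: mulf_neq0; last exact: expf_neq0.
  by rewrite fmorph_eq0.
rewrite !coef_map !lead_valM ?lead_valiC ?fmorph_eq0 ?(expf_neq0 _ x0) ?pi ?pk // !add0r.
by rewrite !lead_valX // => e; apply/val_inj/(mulrIn_row v0 e).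
Qed.

(** An algebraic p/q has equal leading monomials in p and q.  Subtracting the
    ratio of the leading coefficients lowers the numerator, and the difference,
    still algebraic, has to vanish. *)
Lemma ratfun_alg_closed x : algebraicOver (ratfunC K m) x ->
  exists c, x = ratfunC K m c.
Proof.
have [->|x0] := eqVneq x 0; first by exists 0; rewrite rmorph0.
move=> ax; have v0 := lead_val_algebraic x0 ax.
have [p [q [q0 xE]]] := fracP x.
have p0 : p != 0 by move: x0; rewrite xE; apply: contra_neq => ->; rewrite rmorph0 mul0r.
have epq : mlead p = mlead q.
  by apply/mon_exp_inj/eqP; rewrite -subr_eq0 -lead_val_div // -xE v0.
pose c := p@_(mlead p) / q@_(mlead q); exists c; apply/eqP; rewrite -subr_eq0.
apply/negPn/negP => y0.
have yE : x - ratfunC K m c = tofrac (p - c *: q) / tofrac q.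
  have cE : ratfunC K m c = tofrac c%:MP by [].
  by rewrite cE rmorphB mulrBl -xE -mul_mpolyC [X in _ - X / _]rmorphM mulfK ?tofrac_eq0.
have ay : algebraicOver (ratfunC K m) (x - ratfunC K m c).
  exact: (algebraic_sub ax (algebraic_id _ c)).
have r0 : p - c *: q != 0.
  by move: y0; rewrite yE; apply: contra_neq => ->; rewrite rmorph0 mul0r.
have := lead_val_algebraic y0 ay; rewrite yE lead_val_div // => /eqP.
rewrite subr_eq0 => /eqP/mon_exp_inj e.
have := mleadc_eq0 (p - c *: q); rewrite (negPf r0) => /negP; apply.
by rewrite e mcoeffB mcoeffZ /c divfK ?mleadc_eq0 // epq subrr.
Qed.

End Valuation.

(** * Algebraic dependence on one element *)

Lemma map_poly_inj_eq0 (A B : nzRingType) (f : {rmorphism A -> B}) (p : {poly A}) :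
  injective f -> (map_poly f p == 0) = (p == 0).
Proof. by move=> fi; rewrite -!size_poly_eq0 size_map_inj_poly ?rmorph0. Qed.

Lemma tofrac_inj (A : idomainType) : injective (@FracField.tofrac A).
Proof. by move=> p q /eqP; rewrite tofrac_eq => /eqP. Qed.

Lemma poly_clear_denom (A : idomainType) (P : {poly {fraction A}}) :
  exists2 d : A, d != 0 & exists Q : {poly A}, map_poly tofrac Q = tofrac d *: P.
Proof.
elim/poly_ind: P => [|P c [d d0 [Q QE]]].
  by exists 1; rewrite ?oner_neq0 //; exists 0; rewrite rmorph0 scaler0.
have [p [q [q0 ->]]] := fracP c.
exists (d * q); first by rewrite mulf_neq0.
exists (q%:P * Q * 'X + (d * p)%:P).
rewrite rmorphD 2!rmorphM /= map_polyX !map_polyC /= QE scalerDr; congr (_ + _).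
  by rewrite mul_polyC scalerA -scalerAl -rmorphM /= [q * d]mulrC.
rewrite -mul_polyC -polyCM; congr (_%:P).
by rewrite !rmorphM /= mulrACA divff ?tofrac_eq0 // mulr1.
Qed.

Section FunctionField.
Variables (K L : fieldType) (iota : {rmorphism K -> L}).
Implicit Types (t a b x : L).

(** Polynomial functions of [t] over K; [ev t] embeds K[X] as K[t] when [t] is
    transcendental. *)
Definition ev t : {rmorphism {poly K} -> L} := horner_eval t \o map_poly iota.

Definition transc t : Prop := ~ algebraicOver iota t.

Lemma evE t p : ev t p = (map_poly iota p).[t]. Proof. by []. Qed.
Lemma evC t c : ev t c%:P = iota c. Proof. by rewrite evE map_polyC hornerC. Qed.
Lemma evX t : ev t 'X = t. Proof. by rewrite evE map_polyX hornerX. Qed.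

Lemma transc_ev_neq0 t p : transc t -> p != 0 -> ev t p != 0.
Proof. by move=> ht p0; apply/negP => r; apply: ht; exists p. Qed.

Lemma transc_inj t : transc t -> injective (ev t).
Proof.
move=> ht p q e; apply/eqP; rewrite -subr_eq0; apply/negPn/negP => h.
by have := transc_ev_neq0 ht h; rewrite rmorphB e subrr eqxx.
Qed.

(** Algebraicity over K(t), with the denominators of the equation cleared.  The
    equation is then a polynomial in two variables, which makes the exchange
    property a mere swap of variables. *)
Definition alg_over t x : Prop :=
  exists2 P : {poly {poly K}}, P != 0 & (map_poly (ev t) P).[x] = 0.

(** Through the embedding of K(X) as K(t), the closure properties reduce to
    those of the elements algebraic over a field. *)
Lemma alg_overP t x (ht : transc t) :
  alg_over t x <-> algebraicOver (frac_lift (transc_inj ht)) x.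
Proof.
have comp Q : map_poly (frac_lift (transc_inj ht)) (map_poly tofrac Q) =
              map_poly (ev t) Q.
  by rewrite -map_poly_comp; apply: eq_map_poly => p; apply: (frac_lift_tofrac (transc_inj ht)).
split=> [[P P0 Px]|[P P0 Px]].
  exists (map_poly tofrac P).
    by rewrite map_poly_inj_eq0 //; apply: tofrac_inj.
  by rewrite /root comp Px.
have [d d0 [Q QE]] := poly_clear_denom P.
exists Q.
  rewrite -(map_poly_inj_eq0 _ (@tofrac_inj _)) QE scaler_eq0 negb_or P0.
  by rewrite tofrac_eq0 d0.
by rewrite -comp QE linearZ /= hornerZ (rootP Px) mulr0.
Qed.

Lemma alg_overD t x y : transc t -> alg_over t x -> alg_over t y -> alg_over t (x + y).
Proof. by move=> ht /(alg_overP _ ht) hx /(alg_overP _ ht) hy; apply/(alg_overP _ ht)/algebraic_add. Qed.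
Lemma alg_overN t x : transc t -> alg_over t x -> alg_over t (- x).
Proof. by move=> ht /(alg_overP _ ht) hx; apply/(alg_overP _ ht)/algebraic_opp. Qed.
Lemma alg_overB t x y : transc t -> alg_over t x -> alg_over t y -> alg_over t (x - y).
Proof. by move=> ht /(alg_overP _ ht) hx /(alg_overP _ ht) hy; apply/(alg_overP _ ht)/algebraic_sub. Qed.
Lemma alg_overM t x y : transc t -> alg_over t x -> alg_over t y -> alg_over t (x * y).
Proof. by move=> ht /(alg_overP _ ht) hx /(alg_overP _ ht) hy; apply/(alg_overP _ ht)/algebraic_mul. Qed.
Lemma alg_overV t x : transc t -> alg_over t x -> alg_over t x^-1.
Proof. by move=> ht /(alg_overP _ ht) hx; apply/(alg_overP _ ht)/algebraic_inv. Qed.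

Lemma alg_over_ev t p : alg_over t (ev t p).
Proof.
exists ('X - p%:P); first by rewrite polyXsubC_eq0.
by rewrite rmorphB /= map_polyX map_polyC hornerXsubC subrr.
Qed.
Lemma alg_overC t c : alg_over t (iota c).
Proof. by rewrite -(evC t); apply: alg_over_ev. Qed.
Lemma alg_over_id t : alg_over t t.
Proof. by rewrite -{2}(evX t); apply: alg_over_ev. Qed.

Lemma alg_over_root t x (p : {poly L}) : transc t -> p != 0 -> root p x ->
  (forall i, alg_over t p`_i) -> alg_over t x.
Proof.
move=> ht p0 rx hp; apply/(alg_overP _ ht)/integral_algebraic.
apply: (integral_root p0 rx); apply/integral_poly => i.
by apply/integral_algebraic/(alg_overP _ ht).
Qed.

Lemma alg_over_trans a t x : transc a -> transc t ->
  alg_over a t -> alg_over t x -> alg_over a x.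
Proof.
move=> ha ht hat [P P0 Px]; apply: (alg_over_root (p := map_poly (ev t) P)) => //.
- by rewrite map_poly_inj_eq0 //; apply: transc_inj.
- exact/rootP.
move=> i; rewrite coef_map -[X in alg_over a X]/((map_poly iota P`_i).[t]) horner_coef.
elim/big_rec: _ => [|k y _ hy]; first by rewrite -(rmorph0 iota); apply: alg_overC.
apply: alg_overD => //; apply: alg_overM => //.
  by rewrite coef_map; apply: alg_overC.
elim: (val k) => [|n IH]; first by rewrite expr0 -(rmorph1 iota); apply: alg_overC.
by rewrite exprS; apply: alg_overM.
Qed.

Lemma ev_swapXY (P : {poly {poly K}}) a b :
  (map_poly (ev a) (swapXY P)).[b] = (map_poly (ev b) P).[a].
Proof.
have E (Q : {poly {poly K}}) u v : (map_poly (ev u) Q).[v] =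
    (map_poly (map_poly iota) Q).[v%:P].[u].
  have -> : map_poly (ev u) Q = map_poly (horner_eval u) (map_poly (map_poly iota) Q).
    by rewrite -map_poly_comp.
  have {1}-> : v = horner_eval u v%:P by rewrite /horner_eval hornerC.
  by rewrite horner_map.
by rewrite !E -swapXY_map horner2_swapXY.
Qed.

Lemma alg_over_exchange t a : transc a -> alg_over t a -> alg_over a t.
Proof.
move=> ha [P P0 Pa]; exists (swapXY P); first by rewrite swapXY_eq0.
by rewrite ev_swapXY.
Qed.

End FunctionField.

(** * Transcendence degrees zero and one *)

Section Trdeg.
Variables (K L : fieldType) (iota : {rmorphism K -> L}).

Definition poly_mvar d (i : 'I_d) : {rmorphism {poly K} -> {mpoly K[d]}} :=
  horner_eval 'X_i \o map_poly (@mpolyC d K).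

Lemma mmap_poly_mvar d (S : comNzRingType) (f : {rmorphism K -> S})
  (h : 'I_d -> S) i q : mmap f h (poly_mvar i q) = (map_poly f q).[h i].
Proof.
rewrite /poly_mvar /= /horner_eval -(horner_map (mmap f h)) /= mmapX mmap1U.
by rewrite -map_poly_comp; congr (_.[_]); apply: eq_map_poly => c /=; rewrite mmapC.
Qed.

Lemma alg_indep1 (t : L) : transc iota t <-> alg_indep iota (fun _ : 'I_1 => t).
Proof.
split=> [ht p p0|ht [p p0 rp]].
  have E : poly_mvar ord0 (mmap polyC (fun _ : 'I_1 => 'X) p) = p.
    apply: (mpoly_rmorph_eq (f := poly_mvar ord0 \o mmap polyC (fun _ : 'I_1 => 'X))
      (g := idfun)) => [c|i] /=; rewrite /poly_mvar /= /horner_eval.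
      by rewrite mmapC map_polyC hornerC.
    by rewrite mmapX mmap1U map_polyX hornerX [i]ord1.
  rewrite -E; suff -> : mmap polyC (fun _ : 'I_1 => 'X) p = 0 by rewrite rmorph0.
  apply: (transc_inj ht); rewrite rmorph0 -p0 -{2}E mmap_poly_mvar.
  exact: evE.
have := ht (poly_mvar ord0 p); rewrite mmap_poly_mvar => /(_ (rootP rp)) h.
move/eqP: p0; apply.
have : mmap polyC (fun _ : 'I_1 => 'X) (poly_mvar ord0 p) = p.
  rewrite mmap_poly_mvar; exact: comp_polyXr.
by rewrite h raddf0.
Qed.

Definition poly2_mvar d (i k : 'I_d) : {rmorphism {poly {poly K}} -> {mpoly K[d]}} :=
  horner_eval 'X_k \o map_poly (poly_mvar i).

Lemma poly_mvarC d (i : 'I_d) c : poly_mvar i c%:P = c%:MP.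
Proof. by rewrite /poly_mvar /= /horner_eval map_polyC hornerC. Qed.
Lemma poly_mvarX d (i : 'I_d) : poly_mvar i 'X = 'X_i.
Proof. by rewrite /poly_mvar /= /horner_eval map_polyX hornerX. Qed.
Lemma poly2_mvarC d (i k : 'I_d) q : poly2_mvar i k q%:P = poly_mvar i q.
Proof.
rewrite -[LHS]/((map_poly (poly_mvar i) q%:P).['X_k]).
by rewrite map_polyC hornerC.
Qed.
Lemma poly2_mvarX d (i k : 'I_d) : poly2_mvar i k 'X = 'X_k.
Proof.
rewrite -[LHS]/((map_poly (poly_mvar i) 'X).['X_k]).
by rewrite map_polyX hornerX.
Qed.

Lemma mmap_poly2_mvar d (i k : 'I_d) (h : 'I_d -> L) P :
  mmap iota h (poly2_mvar i k P) = (map_poly (ev iota (h i)) P).[h k].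
Proof.
rewrite /poly2_mvar /= /horner_eval -(horner_map (mmap iota h)) /= mmapX mmap1U.
rewrite -map_poly_comp; congr (_.[_]); apply: eq_map_poly => c.
exact: mmap_poly_mvar.
Qed.

Lemma poly2_mvar_neq0 d (i k : 'I_d) P : i != k -> P != 0 -> poly2_mvar i k P != 0.
Proof.
move=> ik; apply: contra_neq => e0.
pose f : K -> {poly {poly K}} := fun c => c%:P%:P.
pose h (j : 'I_d) : {poly {poly K}} := if j == i then 'X%:P else 'X.
have <- : mmap (polyC \o polyC) h (poly2_mvar i k P) = P.
  rewrite /poly2_mvar /= /horner_eval -(horner_map (mmap (polyC \o polyC) h)).
  rewrite /= mmapX mmap1U -map_poly_comp {2}/h eq_sym (negPf ik).
  rewrite (eq_map_poly (g := polyC)); first exact: comp_polyXr.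
  move=> q; rewrite [LHS]mmap_poly_mvar /h eqxx map_poly_comp.
  by rewrite horner_map; congr (_%:P); apply: comp_polyXr.
by rewrite e0 raddf0.
Qed.

Lemma has_trdeg0_alg (E0 : {pred L}) : has_trdeg iota E0 0 ->
  forall x, x \in E0 -> algebraicOver iota x.
Proof.
move=> [_ h] x xE; case: (excluded_middle_informative (algebraicOver iota x)) => // nx.
by have := h 1%N (fun=> x) (fun=> xE); rewrite ltn0 => /(_ ((alg_indep1 x).1 nx)).
Qed.

Lemma has_trdeg1_alg (E0 : {pred L}) : has_trdeg iota E0 1 ->
  exists2 t, t \in E0 & transc iota t /\ forall x, x \in E0 -> alg_over iota t x.
Proof.
move=> [[t tE ti] hmax]; exists (t ord0); first exact: tE.
have tt : transc iota (t ord0).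
  apply/alg_indep1 => p p0; apply: ti; rewrite -p0.
  by apply: eq_bigr => u _; congr (_ * _); apply: eq_bigr => i _; rewrite ord1.
split=> // x xE.
case: (excluded_middle_informative (alg_over iota (t ord0) x)) => // nx.
pose y (i : 'I_2) := if i == ord0 then t ord0 else x.
suff yi : alg_indep iota y.
  suff : (2 <= 1)%N by [].
  by apply: (hmax 2%N y _ yi) => i; rewrite /y; case: ifP.
move=> p p0; apply/eqP/negPn/negP => pn0; apply: nx.
pose h (j : 'I_2) : {poly {poly K}} := if j == ord0 then 'X%:P else 'X.
exists (mmap (polyC \o polyC) h p).
  apply: contra_neq pn0 => e0.
  have <- : poly2_mvar ord0 ord_max (mmap (polyC \o polyC) h p) = p.
    apply: (mpoly_rmorph_eq (f := poly2_mvar ord0 ord_max \o mmap (polyC \o polyC) h)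
      (g := idfun)) => [c|i].
      change (poly2_mvar (ord0 : 'I_2) ord_max (mmap (polyC \o polyC) h c%:MP) = c%:MP).
      by rewrite mmapC poly2_mvarC poly_mvarC.
    change (poly2_mvar (ord0 : 'I_2) ord_max (mmap (polyC \o polyC) h 'X_i) = 'X_i).
    rewrite mmapX mmap1U /h; case: (unliftP ord0 i) => [j|] ->.
      have -> : lift ord0 j = ord_max by rewrite ord1; apply/val_inj.
      by rewrite poly2_mvarX.
    by rewrite eqxx poly2_mvarC poly_mvarX.
  by rewrite e0 raddf0.
rewrite -p0.
apply: (mpoly_rmorph_eq (f := horner_eval x \o map_poly (ev iota (t ord0)) \o mmap (polyC \o polyC) h)
  (g := mmap iota y)) => [c|i].
  change ((map_poly (ev iota (t ord0)) (mmap (polyC \o polyC) h c%:MP)).[x] = mmap iota y c%:MP).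
  by rewrite !mmapC /= (map_polyC _ c%:P) hornerC; apply: evC.
change ((map_poly (ev iota (t ord0)) (mmap (polyC \o polyC) h 'X_i)).[x] = mmap iota y 'X_i).
rewrite !mmapX !mmap1U /h /y; case: eqP => _.
  by rewrite map_polyC hornerC; apply: evX.
by rewrite map_polyX hornerX.
Qed.

Lemma has_trdeg1_intro (E0 : {pred L}) t : t \in E0 -> transc iota t ->
  (forall a b, a \in E0 -> b \in E0 -> alg_over iota a b) -> has_trdeg iota E0 1.
Proof.
move=> tE tt h; split; first by exists (fun=> t) => //; apply/alg_indep1.
move=> k y yE yi; rewrite leqNgt; apply/negP => k1.
pose i0 : 'I_k := Ordinal (ltnW k1); pose i1 : 'I_k := Ordinal k1.
have [P P0 Py] := h _ _ (yE i0) (yE i1).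
have : poly2_mvar i0 i1 P != 0 by apply: poly2_mvar_neq0.
by rewrite (yi (poly2_mvar i0 i1 P)) ?eqxx // mmap_poly2_mvar.
Qed.

End Trdeg.

(** * What a field of definition gives *)

(** A finite extension of a field of algebraic elements is algebraic: an element
    is an eigenvalue of the matrix of multiplication by it, whose characteristic
    polynomial has algebraic coefficients.  The matrix takes its entries in a
    boolean predicate, not in a field type, hence the detour by coefficients. *)
Section AlgCharPoly.
Variables (F L : fieldType) (phi : {rmorphism F -> L}).
Local Notation alg := (algebraicOver phi).

Let algP (p : {poly L}) := forall i, alg p`_i.

Let alg0 : alg 0.
Proof. exact: algebraic0. Qed.

Let alg_sum (I : Type) (r : seq I) (P : pred I) (f : I -> L) :
  (forall i, P i -> alg (f i)) -> alg (\sum_(i <- r | P i) f i).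
Proof. by move=> h; apply: big_ind => // x y; apply: algebraic_add. Qed.

Let algPM p q : algP p -> algP q -> algP (p * q).
Proof. by move=> hp hq i; rewrite coefM; apply: alg_sum => k _; apply: algebraic_mul. Qed.

Let algPC c : alg c -> algP c%:P.
Proof. by move=> hc i; rewrite coefC; case: ifP. Qed.

Lemma algebraic_char_poly n (C : 'M[L]_n) :
  (forall i k, alg (C i k)) -> forall i, alg (char_poly C)`_i.
Proof.
move=> hC; rewrite /char_poly /determinant.
have a1 : alg 1 by exact: algebraic1.
have aN1 : algP (- 1) by rewrite -polyCN; apply/algPC/algebraic_opp.
have P1 : algP 1 by apply: algPC.
elim/big_ind: _ => [i|p q hp hq i|s _]; first by rewrite coef0.
  by rewrite coefD; exact: algebraic_add.
apply: algPM; first by case: odd_perm; rewrite ?expr0 ?expr1.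
elim/big_ind: _ => // i _.
rewrite /char_poly_mx !mxE => k; rewrite coefB; apply: algebraic_sub => //.
  by rewrite coefMn coefX; case: (_ == _); case: (_ == _).
by apply: algPC.
Qed.

Lemma ext_degree_algebraic (E0 E : {pred L}) d : divring_closed E ->
  (forall x, x \in E0 -> alg x) -> ext_degree E0 E d ->
  forall e, e \in E -> alg e.
Proof.
move=> hE h0 [b [bE bfree bspan]] e eE.
have EM x y : x \in E -> y \in E -> x * y \in E.
  case: hE => E1 _ Ediv xE yE; rewrite -[y]invrK; apply: (Ediv _ _) => //.
  by rewrite -div1r; apply: (Ediv _ _).
have cP i := bspan _ (EM _ _ eE (bE i)).
have c_ex i : {c : 'I_d -> L | (forall k, c k \in E0) /\ e * b i = \sum_k c k * b k}.
  by apply: constructive_indefinite_description; have [c ? ?] := cP i; exists c.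
pose C := \matrix_(k, i) (sval (c_ex i) k).
have Cb : (\row_k b k) *m C = e *: (\row_k b k).
  apply/rowP => i; rewrite !mxE (svalP (c_ex i)).2; apply: eq_bigr => k _.
  by rewrite !mxE mulrC.
have d_gt0 : (\row_k b k) != 0.
  apply/eqP => b0; have [c _] := bspan 1 (let: And3 E1 _ _ := hE in E1).
  rewrite big1 => [/eqP|k _]; first by rewrite oner_eq0.
  by have /rowP/(_ k) := b0; rewrite !mxE => ->; rewrite mulr0.
have re : root (char_poly C) e.
  by rewrite -eigenvalue_root_char; apply/eigenvalueP; exists (\row_k b k).
apply/integral_algebraic; apply: (integral_root _ re).
  by rewrite monic_neq0 ?char_poly_monic.
apply/integral_poly => l; apply/integral_algebraic; apply: algebraic_char_poly => i k; rewrite mxE; apply: h0.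
by have [] := svalP (c_ex k).
Qed.

End AlgCharPoly.

Section Lower.
Variables (K L : fieldType) (iota : {rmorphism K -> L}).
Variables (gT : finGroupType) (G : {group gT}) (act : gT -> {rmorphism L -> L}).
Variable (L0 : {pred L}).
Hypothesis L0P : forall x, x \in L0 <-> forall g, g \in G -> act g x = x.

(** The elements fixed by [g] form a field containing [L0]; if it contained [E]
    as well it would be everything. *)
Lemma act_moved (E : {pred L}) g x : g \in G -> compositum_full E L0 ->
  act g x != x -> exists2 e, e \in E & act g e != e.
Proof.
move=> gG hE gx; case: (excluded_middle_informative (exists2 e, e \in E & act g e != e)) => // nE.
case/negP: gx; apply: (hE [pred y | act g y == y]).
- split; rewrite ?inE ?rmorph1 // => u v; rewrite !inE => /eqP eu /eqP ev.
    by rewrite rmorphB eu ev.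
  by rewrite fmorph_div eu ev.
- by move=> e eE; rewrite inE; apply/negPn/negP => h; apply: nE; exists e.
by move=> y /L0P h; rewrite inE h.
Qed.

(** All that is used of a field of definition of transcendence degree one.  It
    holds because the field E with L = E L0 is algebraic over E0, hence over
    K(t). *)
Lemma essdim1_moved (E0 : {pred L}) : defined_over iota L0 E0 -> has_trdeg iota E0 1 ->
  exists t, [/\ transc iota t, t \in L0 &
    forall g x, g \in G -> act g x != x -> exists2 e, alg_over iota t e & act g e != e].
Proof.
move=> [[hE0 KE0 E0L0] [E [hE E0E [d [dE _]] full]]] /has_trdeg1_alg [t tE0 [tt h0]].
exists t; split=> // [|g x gG gx]; first exact: E0L0.
have [e eE ge] := act_moved gG full gx; exists e => //.
apply/(alg_overP _ tt); apply: (ext_degree_algebraic hE _ dE) => // y yE0.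
exact/(alg_overP _ tt)/h0.
Qed.

(** Transcendence degree zero would make E algebraic over K, hence contained in
    K and fixed by the group. *)
Lemma defined_over_trdeg_gt0 (E0 : {pred L}) g x :
  (forall x, algebraicOver iota x -> exists c, x = iota c) ->
  (forall g c, g \in G -> act g (iota c) = iota c) ->
  g \in G -> act g x != x ->
  defined_over iota L0 E0 -> ~ has_trdeg iota E0 0.
Proof.
move=> Kcl actC gG gx [[hE0 KE0 E0L0] [E [hE E0E [d [dE _]] full]]] /has_trdeg0_alg h0.
have [e eE /negP] := act_moved gG full gx; apply.
by have [c ->] := Kcl e (ext_degree_algebraic hE h0 dE eE); rewrite actC.
Qed.
End Lower.

(** * Klein four-groups away from characteristic two *)

Section Dependence.
Variables (K L : fieldType) (iC : {rmorphism K -> L}) (m : nat) (v : L -> 'rV[int]_m).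
Hypothesis vM : forall x y, x != 0 -> y != 0 -> v (x * y) = v x + v y.
Hypothesis vC : forall c, c != 0 -> v (iC c) = 0.
Hypothesis vX : forall x n, x != 0 -> v (x ^+ n) = v x *+ n.
Hypothesis v_sum : forall (I : finType) (P : pred I) (F : I -> L) i0,
  P i0 -> (forall i, P i -> F i != 0) ->
  (forall i k, P i -> P k -> v (F i) = v (F k) -> i = k) ->
  \sum_(i | P i) F i != 0.

(** In a polynomial relation between [a] and [b] two distinct monomials must have
    the same value, for otherwise the terms do not cancel; this makes the values
    of [a] and [b] proportional. *)
Lemma alg_over_val (a b : L) : a != 0 -> b != 0 -> alg_over iC a b ->
  exists k l : int, ((k != 0) || (l != 0)) /\ v a *~ k = v b *~ l.
Proof.
move=> a0 b0 [P P0 Pab].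
case: (excluded_middle_informative (exists k l : int, ((k != 0) || (l != 0)) /\
  v a *~ k = v b *~ l)) => // nkl.
pose N := sizeY P; pose I := ('I_(size P) * 'I_N)%type.
pose F (u : I) : L := iC P`_(u.1)`_(u.2) * (a ^+ u.2 * b ^+ u.1).
have sumE : \sum_(u : I) F u = 0.
  apply: etrans Pab; rewrite (@horner_coef_wide _ (size P)) ?size_poly //.
  rewrite (eq_bigr (fun u => F (u.1, u.2))) => [|[] //].
  apply: etrans (esym (pair_bigA _ (fun i j => F (i, j)))) _.
  apply: eq_bigr => i _; rewrite coef_map.
  rewrite -[X in _ = X * _]/((map_poly iC P`_i).[a]).
  rewrite (@horner_coef_wide _ N); last first.
    by rewrite size_map_poly max_size_coefXY.
  rewrite mulr_suml; apply: eq_bigr => j _.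
  by rewrite /F coef_map mulrA.
pose S (u : I) := P`_(u.1)`_(u.2) != 0.
have [u0 Su0] : exists u, S u.
  have sP : ((size P).-1 < size P)%N by rewrite prednK // size_poly_gt0.
  have sN : ((size (lead_coef P)).-1 < N)%N.
    apply: leq_trans (max_size_lead_coefXY P).
    by rewrite prednK // size_poly_gt0 lead_coef_eq0.
  exists (Ordinal sP, Ordinal sN); rewrite /S /=.
  by rewrite -[P`_(size P).-1]/(lead_coef P) -lead_coefE !lead_coef_eq0.
have /negP[] : \sum_(u | S u) F u != 0.
  have F0 u : S u -> F u != 0.
    move=> Su; apply: mulf_neq0; first by rewrite fmorph_eq0.
    by apply: mulf_neq0; apply: expf_neq0.
  apply: (v_sum Su0 F0) => -[i j] [i' j'] Su Su'.
  have vF u : S u -> v (F u) = v a *+ u.2 + v b *+ u.1.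
    move=> Su1; have ab0 : a ^+ u.2 * b ^+ u.1 != 0.
      by apply: mulf_neq0; apply: expf_neq0.
    rewrite vM ?fmorph_eq0 // vC // add0r vM ?expf_neq0 //.
    by rewrite !vX.
  rewrite !vF //= => e; apply/eqP/negPn/negP => ne; apply: nkl.
  exists (j%:Z - j'%:Z), (i'%:Z - i%:Z); split.
    apply: contraR ne; rewrite negb_or !negbK !subr_eq0.
    by move=> /andP[/eqP[ej] /eqP[ei]]; rewrite xpair_eqE -!val_eqE /= ej ei !eqxx.
  rewrite !mulrzBr -!pmulrn; apply/eqP; rewrite subr_eq addrAC eq_sym subr_eq.
  by rewrite addrC e.
move: sumE; rewrite (bigID S) /= [X in _ + X]big1 ?addr0 => [->|u].
  exact: eqxx.
rewrite negbK => /eqP e; by rewrite /F e rmorph0 mul0r.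
Qed.

End Dependence.

Section SignVectors.
Variables (L : fieldType) (Q : L -> Prop).
Hypotheses (QD : forall x y, Q x -> Q y -> Q (x + y))
           (QN : forall x, Q x -> Q (- x)).

(** From [e] moved by [s] one gets [a0 = e - s e] with [s a0 = - a0]; then
    [a0 + t a0] is a common eigenvector, or [a0] is one when this sum is zero. *)
Lemma sign_vector (s t : {rmorphism L -> L}) e :
  (forall x, s (s x) = x) -> (forall x, t (t x) = x) ->
  (forall x, s (t x) = t (s x)) ->
  (forall x, Q x -> Q (s x)) -> (forall x, Q x -> Q (t x)) ->
  Q e -> s e != e ->
  exists2 a, Q a /\ a != 0 & s a = - a /\ exists d : bool, t a = (-1) ^+ d * a.
Proof.
move=> ss tt st Qs Qt Qe se; pose a0 := e - s e.
have a00 : a0 != 0 by rewrite subr_eq0 eq_sym.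
have Qa0 : Q a0 by apply/QD/QN/Qs.
have sa0 : s a0 = - a0 by rewrite rmorphB ss opprB.
have [p0|p0] := eqVneq (a0 + t a0) 0; last first.
  exists (a0 + t a0); first by split=> //; apply/QD/Qt.
  split; first by rewrite [LHS]rmorphD st sa0 (rmorphN t) [RHS]opprD.
  by exists false; rewrite expr0 mul1r [LHS]rmorphD tt [LHS]addrC.
exists a0 => //; split=> //; exists true; rewrite expr1 mulN1r.
by apply/eqP; rewrite -subr_eq0 opprK addrC p0.
Qed.

End SignVectors.

Section DiagSubst.
Variables (K : fieldType) (m : nat).
Hypothesis char2 : (2%:R : K) != 0.
Variable (delta : 'I_m -> bool).

Let D : 'M[K]_m := diag_mx (\row_i (-1) ^+ delta i).

(** Changing the signs of the variables selected by [delta] multiplies a monomial of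
    exponent v by -1 to this parity. *)
Definition parity (v : 'rV[int]_m) : 'F_2 := \sum_i (delta i)%:R * (v 0 i)%:~R.

Lemma rowMz (v : 'rV[int]_m) k i : (v *~ k) 0 i = v 0 i * k.
Proof.
rewrite -mulrzz.
by case: k => k; rewrite ?NegzE ?mulrNz ?mxE -!pmulrn mulmxnE.
Qed.

Lemma parityMz v k : parity (v *~ k) = k%:~R * parity v.
Proof.
rewrite mulr_sumr; apply: eq_bigr => i _; rewrite mulrCA; congr (_ * _).
rewrite -intrM; congr (_%:~R).
by rewrite rowMz mulrC.
Qed.

Lemma lin_subst_diag_coef (p : {mpoly K[m]}) u :
  (lin_subst D p)@_u = (-1) ^+ (\sum_i delta i * u i)%N * p@_u.
Proof.
have DX w : lin_subst D 'X_[w] = (-1) ^+ (\sum_i delta i * w i)%N *: 'X_[w].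
  rewrite [in LHS]mpolyXE_id rmorph_prod /= [in RHS]mpolyXE_id.
  rewrite -mul_mpolyC expr_sum rmorph_prod -big_split /=; apply: eq_bigr => i _.
  rewrite rmorphXn /= lin_substX (bigD1 i) //= big1 => [|j ji]; last first.
    by rewrite !mxE (negPf ji) mulr0n scale0r.
  by rewrite addr0 !mxE eqxx mulr1n -mul_mpolyC exprMn -rmorphXn /= exprM.
rewrite [p]mpolyE rmorph_sum /= !raddf_sum mulr_sumr; apply: eq_bigr => w _ /=.
rewrite lin_substZ DX !mcoeffZ mcoeffX /=; case: eqP => [->|]; last by rewrite !mulr0.
by rewrite !mulr1 mulrC.
Qed.

Lemma lin_subst_diag_lead p : p != 0 -> (mlead (lin_subst D p) <= mlead p)%O.
Proof.
move=> p0; apply: msupp_le_mlead.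
have : lin_subst D p != 0.
  have := mleadc_eq0 p; rewrite (negPf p0) => /negbT; apply: contra_neq => e0.
  have := lin_subst_diag_coef p (mlead p); rewrite e0 mcoeff0 => /esym/eqP.
  by rewrite mulf_eq0 signr_eq0 => /eqP.
move/mlead_supp; rewrite !mcoeff_msupp lin_subst_diag_coef mulf_eq0.
by rewrite signr_eq0.
Qed.

Lemma diag_unit : D \in unitmx.
Proof.
rewrite unitmxE det_diag unitfE; apply/prodf_neq0 => i _.
by rewrite mxE signr_eq0.
Qed.

Lemma odd_F2 n : (n%:R : 'F_2) = (odd n)%:R.
Proof. by apply/val_inj; rewrite /= !val_Fp_nat // modn2; case: odd. Qed.

Lemma sign_F2 a b : (-1) ^+ a = (-1) ^+ b :> K -> (a%:R : 'F_2) = b%:R.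
Proof.
rewrite -(signr_odd _ a) -(signr_odd _ b) odd_F2 (odd_F2 b).
have N1 : (1 == -1 :> K) = false.
  by apply/negbTE; rewrite -subr_eq0 opprK -mulr2n.
by case: (odd a); case: (odd b); rewrite ?expr0 ?expr1 // => /eqP; rewrite ?N1 // eq_sym N1.
Qed.

(** Comparing leading coefficients in [D(p) q = e p D(q)]: the substitution keeps
    leading monomials, and multiplies their coefficients by the signs given by
    the parity of the exponents. *)
Lemma parity_eigenvector x (e : bool) : x != 0 ->
  ratfun_subst D x = (-1) ^+ e * x -> parity (lead_val x) = e%:R.
Proof.
have [p [q [q0 ->]]] := fracP x => x0.
have p0 : p != 0 by apply: contra_neq x0 => ->; rewrite rmorph0 mul0r.
have uD := diag_unit.
rewrite ratfun_subst_div // mulrA => /eqP.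
rewrite -(rmorph1 tofrac) -rmorphN -rmorphXn -rmorphM /= frac_eq ?lin_subst_neq0 //.
move/eqP/(congr1 (mcoeff (mlead p + mlead q)%MM)).
have le_ref (u : 'X_{1..m}) : (u <= u)%O by apply: Order.POrderTheory.lexx.
rewrite mleadcMW ?lin_subst_diag_lead // lin_subst_diag_coef.
rewrite -[_ * p * _]mulrA (_ : (-1) ^+ e = ((-1) ^+ e)%:MP); last first.
  by rewrite rmorphXn rmorphN rmorph1.
rewrite mul_mpolyC mcoeffZ mleadcMW ?lin_subst_diag_lead // lin_subst_diag_coef.
set cp := p@_ _; set cq := q@_ _ => e1.
have /sign_F2 : (-1) ^+ (\sum_i delta i * mlead p i)%N =
   (-1) ^+ (e + \sum_i delta i * mlead q i)%N :> K.
  have c0 : cp * cq != 0 by rewrite mulf_neq0 // mleadc_eq0.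
  by apply: (mulIf c0); rewrite mulrA e1 exprD -mulrA [cp * _]mulrCA.
rewrite natrD => e2; apply: (addIr ((\sum_i delta i * mlead q i)%N)%:R).
rewrite -e2 lead_val_div // !natr_sum -big_split; apply: eq_bigr => i _ /=.
by rewrite !mxE rmorphB mulrBr !natrM subrK.
Qed.

End DiagSubst.

Lemma alg_over_map (K L L' : fieldType) (iK : {rmorphism K -> L}) (iK' : {rmorphism K -> L'})
    (f : {rmorphism L -> L'}) t x : (forall c, f (iK c) = iK' c) ->
  alg_over iK t x -> alg_over iK' (f t) (f x).
Proof.
move=> fC [P P0 Px]; exists P => //.
have evf q : ev iK' (f t) q = f (ev iK t q).
  rewrite !evE -horner_map -map_poly_comp; congr (_.[_]).
  by apply: eq_map_poly => c; rewrite /= fC.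
rewrite (eq_map_poly evf) (map_poly_comp f) horner_map Px; exact: rmorph0.
Qed.

Section Klein.
Variables (K : fieldType) (m : nat).
Notation L := (ratfun K m).
Notation iC := (ratfunC K m).
Hypothesis char2 : (2%:R : K) != 0.

Lemma diagonalizable_involution (A : 'M[K]_m) : A *m A = 1%:M -> diagonalizable A.
Proof.
case: m A => [|m'] A AA.
  by exists 1%:M; rewrite ?unitmx1 //; apply/is_diag_mxP => -[].
apply/diagonalizableP; exists [:: 1; -1].
  by rewrite /= inE andbT -subr_eq0 opprK -mulr2n.
have -> : \prod_(x <- [:: 1; -1]) ('X - x%:P) = 'X^2 - 1 :> {poly K}.
  by rewrite big_cons big_seq1 polyCN polyC1 opprK -subr_sqr expr1n.
apply: mxminpoly_min; rewrite rmorphB rmorphXn rmorph1 /= horner_mx_X.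
by rewrite expr2 -[A * A]/(A *m A) AA subrr.
Qed.

Lemma sign_diag (P A : 'M[K]_m) d : P \in unitmx -> A *m A = 1%:M ->
  P *m A = diag_mx d *m P ->
  exists delta : 'I_m -> bool, diag_mx d = diag_mx (\row_i (-1) ^+ delta i).
Proof.
move=> uP AA PA; exists (fun i => d 0 i == -1); congr diag_mx; apply/rowP => i.
rewrite mxE.
have dd : diag_mx d *m diag_mx d = 1%:M.
  apply: (can_inj (mulmxK uP)); rewrite -mulmxA -PA mulmxA -PA -mulmxA AA.
  by rewrite mulmx1 mul1mx.
move/matrixP/(_ i i)/eqP: dd; rewrite mulmx_diag !mxE eqxx mulr1n -expr2 sqrf_eq1.
by rewrite orbC; case: (d 0 i =P -1) => [-> _|_ /eqP ->]; rewrite ?expr1 ?expr0.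
Qed.

(** After a simultaneous diagonalization, the two signs of an eigenvector are
    parities of its leading exponent.  Algebraic dependence makes the exponents
    of [a] and [b] proportional, with coprime factors [k] and [l], so modulo two
    the sign vectors of [a] and [b] satisfy a nontrivial linear relation; two
    distinct nonzero vectors of F_2^2 do not. *)
Lemma klein_not_dependent (A B : 'M[K]_m) (a b : L) (a1 a2 b1 b2 : bool) :
  A *m A = 1%:M -> B *m B = 1%:M -> A *m B = B *m A -> a != 0 -> b != 0 ->
  ratfun_subst A a = (-1) ^+ a1 * a -> ratfun_subst B a = (-1) ^+ a2 * a ->
  ratfun_subst A b = (-1) ^+ b1 * b -> ratfun_subst B b = (-1) ^+ b2 * b ->
  a1 || a2 -> b1 || b2 -> (a1, a2) != (b1, b2) -> ~ alg_over iC a b.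
Proof.
move=> AA BB AB a0 b0 Aa Ba Ab Bb ha hb hab dep.
have /codiagonalizableP [P uP /allP PD] : {in [:: A; B] &, forall A B, comm_mx A B} /\
    {in [:: A; B], forall A, diagonalizable A}.
  split=> [X Y|X]; rewrite !inE.
    by move=> /orP[/eqP->|/eqP->] /orP[/eqP->|/eqP->].
  by move=> /orP[/eqP->|/eqP->]; apply: diagonalizable_involution.
have uA : A \in unitmx by case/mulmx1_unit: AA.
have uB : B \in unitmx by case/mulmx1_unit: BB.
have /diagonalizable_forPex [dA /(simmxP uP) PA] := PD A (mem_head _ _).
have BAB : B \in [:: A; B] by rewrite !inE eqxx orbT.
have /diagonalizable_forPex [dB /(simmxP uP) PB] := PD B BAB.
have [eA DA] := sign_diag uP AA PA; have [eB DB] := sign_diag uP BB PB.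
pose f := ratfun_aut uP.
have fC c : f (iC c) = iC c by exact: ratfun_substC.
have sgn X d e x : X \in unitmx -> P *m X = diag_mx d *m P -> diag_mx d \in unitmx ->
    ratfun_subst X x = (-1) ^+ e * x -> ratfun_subst (diag_mx d) (f x) = (-1) ^+ e * f x.
  move=> uX PX ud Xx; rewrite -[f x]/(ratfun_subst P x) ratfun_substM // -PX.
  rewrite -ratfun_substM // Xx -[LHS]/(f _) rmorphM rmorphXn rmorphN rmorph1 //.
have par X d (eX : 'I_m -> bool) (e : bool) x : X \in unitmx -> P *m X = diag_mx d *m P ->
    diag_mx d = diag_mx (\row_i (-1) ^+ eX i) -> x != 0 ->
    ratfun_subst X x = (-1) ^+ e * x -> parity eX (lead_val (f x)) = e%:R.
  move=> uX PX dE x0 Xx.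
  have fx0 : f x != 0 by rewrite fmorph_eq0.
  have ud : diag_mx d \in unitmx by rewrite dE; apply: diag_unit.
  by apply: (parity_eigenvector char2 fx0); rewrite -dE; apply: (sgn X d e x uX PX ud Xx).
have vAa := par _ _ _ _ _ uA PA DA a0 Aa.
have vBa := par _ _ _ _ _ uB PB DB a0 Ba.
have vAb := par _ _ _ _ _ uA PA DA b0 Ab.
have vBb := par _ _ _ _ _ uB PB DB b0 Bb.
have fa0 : f a != 0 by rewrite fmorph_eq0.
have fb0 : f b != 0 by rewrite fmorph_eq0.
have [k0 [l0 [kl0 e0]]] := alg_over_val (@lead_valM K m) (@lead_valC K m)
  (@lead_valX K m) (@ratfun_sum_neq0 K m) fa0 fb0 (alg_over_map fC dep).
pose g := gcdz k0 l0.
have g0 : g != 0 by rewrite gcdz_eq0 negb_and.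
have [/dvdzP[k kE] /dvdzP[l lE]] := (dvdz_gcdl k0 l0, dvdz_gcdr k0 l0).
have [u [w uw1]] : exists u, exists w, u * k + w * l = 1.
  have [u [w uw]] := Bezoutz k0 l0; exists u, w; apply: (mulIf g0).
  by rewrite mulrDl mul1r -!mulrA -[k * g]kE -[l * g]lE uw.
have e : lead_val (f a) *~ k = lead_val (f b) *~ l.
  apply/rowP => i; apply: (mulIf g0); rewrite !rowMz -!mulrA -[k * g]kE -[l * g]lE.
  by move/rowP/(_ i): e0; rewrite !rowMz.
have eA1 : k%:~R * (a1%:R : 'F_2) = l%:~R * b1%:R.
  rewrite -vAa -vAb -(parityMz eA (lead_val (f a)) k) -(parityMz eA (lead_val (f b)) l).
  exact: congr1 e.
have eB1 : k%:~R * (a2%:R : 'F_2) = l%:~R * b2%:R.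
  rewrite -vBa -vBb -(parityMz eB (lead_val (f a)) k) -(parityMz eB (lead_val (f b)) l).
  exact: congr1 e.
have : (u%:~R * k%:~R + w%:~R * l%:~R : 'F_2) = 1.
  by rewrite -!intrM -intrD uw1.
have F2 (x : 'F_2) : x = 0 \/ x = 1.
  by case: x => [[|[|x]] hx] //; [left|right]; apply/val_inj.
move: eA1 eB1 ha hb hab.
case: (F2 k%:~R) => ->; case: (F2 l%:~R) => ->;
by case: a1 {Aa vAa}; case: a2 {Ba vBa}; case: b1 {Ab vAb}; case: b2 {Bb vBb};
  rewrite /= ?mul0r ?mulr0 ?mul1r ?addr0 // => /eqP; rewrite // => _ /eqP.
Qed.

(** Each of the three involutions moves an element algebraic over K(t), and turns
    it into a common eigenvector with sign -1 for that involution.  Among these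
    eigenvectors two have distinct sign vectors, and they are dependent because
    both are algebraic over K(t). *)
Lemma no_klein_trdeg1 (A B : 'M[K]_m) (t : L) :
  A *m A = 1%:M -> B *m B = 1%:M -> A *m B = B *m A -> transc iC t ->
  ratfun_subst A t = t -> ratfun_subst B t = t ->
  (exists2 e, alg_over iC t e & ratfun_subst A e != e) ->
  (exists2 e, alg_over iC t e & ratfun_subst B e != e) ->
  (exists2 e, alg_over iC t e & ratfun_subst (A *m B) e != e) -> False.
Proof.
move=> AA BB AB tt At Bt [e1 Q1 m1] [e2 Q2 m2] [e3 Q3 m3].
have uA : A \in unitmx by case/mulmx1_unit: AA.
have uB : B \in unitmx by case/mulmx1_unit: BB.
have uAB : A *m B \in unitmx by rewrite unitmx_mul uA.
pose f := ratfun_aut uA; pose h := ratfun_aut uB; pose fh := ratfun_aut uAB.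
have ff x : f (f x) = x by rewrite [LHS]ratfun_substM // AA ratfun_subst1.
have hh x : h (h x) = x by rewrite [LHS]ratfun_substM // BB ratfun_subst1.
have fhE x : fh x = f (h x) by rewrite [RHS]ratfun_substM.
have hf x : f (h x) = h (f x).
  apply: etrans (ratfun_substM x uA uB) _; rewrite AB; exact: esym (ratfun_substM x uB uA).
have Qf x : alg_over iC t x -> alg_over iC t (f x).
  by move=> Qx; rewrite -{1}At; apply: (alg_over_map (f := f)) Qx => c; apply: ratfun_substC.
have Qh x : alg_over iC t x -> alg_over iC t (h x).
  by move=> Qx; rewrite -{1}Bt; apply: (alg_over_map (f := h)) Qx => c; apply: ratfun_substC.
have Qfh x : alg_over iC t x -> alg_over iC t (fh x).
  by move=> Qx; rewrite fhE; apply/Qf/Qh.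
have QD x y := @alg_overD _ _ _ t x y tt.
have QN x := @alg_overN _ _ _ t x tt.
have dep a b (a1 a2 b1 b2 : bool) : alg_over iC t a -> alg_over iC t b ->
    a != 0 -> b != 0 ->
    f a = (-1) ^+ a1 * a -> h a = (-1) ^+ a2 * a ->
    f b = (-1) ^+ b1 * b -> h b = (-1) ^+ b2 * b ->
    a1 || a2 -> b1 || b2 -> (a1, a2) != (b1, b2) -> False.
  move=> Qa Qb a0 b0 fa ha fb hb a12 b12 ab.
  have L2 : (2%:R : L) != 0 by rewrite -(rmorph_nat iC) fmorph_eq0.
  have aN : a <> - a.
    by move/eqP; rewrite -subr_eq0 opprK -mulr2n -mulr_natl mulf_eq0 (negPf L2) (negPf a0).
  have ta : transc iC a.
    move=> /ratfun_alg_closed [c ac]; apply: aN.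
    case: a1 fa a12 {ab} => fa a12.
      have fa' : f a = a by rewrite ac; apply: ratfun_substC.
      by rewrite -{1}fa' fa expr1 mulN1r.
    case: a2 ha a12 => [ha _|_]; last by rewrite orbF.
    have ha' : h a = a by rewrite ac; apply: ratfun_substC.
    by rewrite -{1}ha' ha expr1 mulN1r.
  apply: (klein_not_dependent AA BB AB a0 b0 fa ha fb hb a12 b12 ab).
  apply: (alg_over_trans ta tt _ Qb); exact: alg_over_exchange.
have [a [Qa a0] [fa [d1 ha]]] := sign_vector QD QN ff hh hf Qf Qh Q1 m1.
have fN x : f x = - x -> f x = (-1) ^+ true * x by rewrite expr1 mulN1r.
have hN x : h x = - x -> h x = (-1) ^+ true * x by rewrite expr1 mulN1r.
have [b [Qb b0] [hb [d2 fb]]] := sign_vector QD QN hh ff (fun x => esym (hf x)) Qh Qf Q2 m2.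
have fhfh x : fh (fh x) = x by rewrite (fhE (fh x)) (fhE x) -(hf (h x)) (ff (h (h x))) (hh x).
have fhh x : fh (h x) = h (fh x).
  exact: etrans (fhE (h x)) (etrans (hf (h x)) (congr1 h (esym (fhE x)))).
have [c [Qc c0] [fhc [d3 hc]]] := sign_vector QD QN fhfh hh fhh Qfh Qh Q3 m3.
have fc : f c = (-1) ^+ (~~ d3) * c.
  rewrite -{1}(hh c) -fhE hc rmorphMsign fhc.
  by case: d3 {hc}; rewrite ?expr0 ?expr1 ?mulrN ?mulN1r ?mul1r ?opprK.
case: d1 ha => ha; last first.
  by apply: (dep a b _ _ _ _ Qa Qb a0 b0 (fN _ fa) ha fb (hN _ hb)); case: (d2).
case: d2 fb => fb; last first.
  by apply: (dep a b _ _ _ _ Qa Qb a0 b0 (fN _ fa) ha fb (hN _ hb)).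
by apply: (dep a c _ _ _ _ Qa Qc a0 c0 (fN _ fa) ha fc hc); case: (d3).
Qed.

End Klein.

(** * Gauss's lemma over K[x] *)

Section Gauss.
Variable K : fieldType.
Implicit Types (c e : {poly K}) (f g h : {poly {poly K}}).

Definition primitive f := forall e, (forall i, e %| f`_i) -> size e = 1%N.

Lemma coef_dvdP e h : (forall i, e %| h`_i) -> exists h1, h = e%:P * h1.
Proof.
move=> eh; exists (map_poly (fun a => a %/ e) h); apply/polyP => i.
by rewrite coefCM coef_map_id0 ?div0p // mulrC divpK.
Qed.

(** A nonconstant divisor of least degree is prime. *)
Lemma prime_divisor c : (1 < size c)%N -> exists2 r : {poly K}, r %| c /\ (1 < size r)%N &
  forall a b, r %| a * b -> (r %| a) || (r %| b).
Proof.
move=> c1; have ex : exists n, asb (exists2 r, r %| c & (1 < size r)%N /\ size r = n).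
  by exists (size c); apply/asbP; exists c.
case: (ex_minnP ex) => n /asbP[r rc [r1 rn]] nmin; exists r => // a b rab.
have g_r : gcdp r a %| r by apply: dvdp_gcdl.
have r0 : r != 0 by rewrite -size_poly_gt0 ltnW.
have [cop|ncop] := boolP (coprimep r a).
  by rewrite -(Gauss_dvdpr b cop) rab orbT.
have g1 : (1 < size (gcdp r a))%N.
  move: ncop; rewrite /coprimep; case: ltngtP => // h _.
  by move: h; rewrite ltnS leqn0 size_poly_eq0 gcdp_eq0 (negPf r0).
have : (n <= size (gcdp r a))%N.
  by apply: nmin; apply/asbP; exists (gcdp r a); rewrite ?(dvdp_trans g_r).
rewrite -rn => le; have : gcdp r a %= r.
  by rewrite -dvdp_size_eqp // eqn_leq dvdp_leq.
by rewrite /eqp => /andP[_ h]; rewrite (dvdp_trans h (dvdp_gcdr _ _)).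
Qed.

(** If [r] divided neither factor, take the first coefficient of each that it
    does not divide: their product is a coefficient of [f * h] up to multiples of
    [r]. *)
Lemma prime_dvd_coef r f h : (forall a b, r %| a * b -> (r %| a) || (r %| b)) ->
  (forall i, r %| (f * h)`_i) -> (forall i, r %| f`_i) \/ (forall i, r %| h`_i).
Proof.
move=> pr rfh.
case: (excluded_middle_informative (forall i, r %| f`_i)) => [|nf]; first by left.
case: (excluded_middle_informative (forall i, r %| h`_i)) => [|nh]; first by right.
have ef : exists i, ~~ (r %| f`_i).
  case: (excluded_middle_informative (exists i, ~~ (r %| f`_i))) => // ne.
  by case: nf => i; apply/negPn/negP => hi; apply: ne; exists i.
have eh : exists i, ~~ (r %| h`_i).
  case: (excluded_middle_informative (exists i, ~~ (r %| h`_i))) => // ne.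
  by case: nh => i; apply/negPn/negP => hi; apply: ne; exists i.
case: (ex_minnP ef) => i fi imin; case: (ex_minnP eh) => k hk kmin.
have : r %| f`_i * h`_k.
  have := rfh (i + k)%N; rewrite coefM.
  have ik : (i < (i + k).+1)%N by rewrite ltnS leq_addr.
  rewrite (bigD1 (Ordinal ik)) //= addKn addrC dvdp_addr // .
  elim/big_rec: _ => [|j y ji ry]; first exact: dvdp0.
  rewrite dvdp_addl //; have [lt|lt|eji] := ltngtP (val j) i.
  - apply: dvdp_mulr; apply/negPn/negP => h1; have := imin _ h1.
    by rewrite leqNgt lt.
  - apply: dvdp_mull; apply/negPn/negP => h1; have := kmin _ h1.
    have lej : (j <= i + k)%N by rewrite -ltnS ltn_ord.
    by rewrite leqNgt ltn_subLR // ltn_add2r lt.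
  by case/eqP: ji; apply/val_inj.
by move/pr; rewrite (negPf fi) (negPf hk).
Qed.

(** Prime factors of the denominator [c] are removed from [h] one at a time, none
    of them dividing the primitive [f]. *)
Lemma gauss_lemma f g h c : primitive f -> c != 0 -> c%:P * g = f * h ->
  exists h1, h = c%:P * h1.
Proof.
move=> pf; have [n] := ubnP (size c); elim: n c h => // n IH c h; rewrite ltnS => cn c0 e.
have [c1|c1] := ltnP 1 (size c); last first.
  have sc : size c = 1%N by apply/eqP; rewrite eqn_leq c1 size_poly_gt0.
  apply: coef_dvdP => i; apply: dvdUp.
  by rewrite -size_poly_eq1 sc.
have [r [/dvdpP[c2 cE] r1] pr] := prime_divisor c1.
have r0 : r != 0 by rewrite -size_poly_gt0 ltnW.
have c20 : c2 != 0 by apply: contra_neq c0 => c20; rewrite cE c20 mul0r.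
have [] := prime_dvd_coef (f := f) (h := h) pr.
- by move=> i; rewrite -e coefCM cE -mulrA mulrCA dvdp_mulr.
- by move/pf => sr; rewrite sr in r1.
move/coef_dvdP => [h1 hE].
have [|//|h2 h1E] := IH c2 h1 _ c20.
- apply: leq_trans cn; rewrite cE size_mul // -subn1 ltn_subRL addnC addn1 -addn1 ltn_add2l //.
- by apply: (mulfI (x := r%:P)); rewrite ?polyC_eq0 // mulrA -polyCM [r * _]mulrC -cE e hE mulrCA.
by exists h2; rewrite hE h1E mulrA -polyCM cE [r * _]mulrC.
Qed.
End Gauss.

(** * Relations satisfied by an element of K(x) *)

Section RationalLine.
Variable K : fieldType.
Notation R := {fraction {poly K}}.

Definition fracC : {rmorphism K -> R} := @FracField.tofrac {poly K} \o polyC.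

Lemma ev_fracX (p : {poly K}) : ev fracC (tofrac 'X) p = tofrac p.
Proof.
rewrite evE (map_poly_comp tofrac polyC) horner_map; congr (tofrac _).
exact: comp_polyXr.
Qed.

Lemma frac_coprime (u : R) : exists p q : {poly K},
  [/\ q != 0, coprimep p q & u = tofrac p / tofrac q].
Proof.
have [p [q [q0 ->]]] := fracP u; pose g := gcdp p q.
have g0 : g != 0 by rewrite gcdp_eq0 negb_and q0 orbT.
have cop : coprimep (p %/ g) (q %/ g) by rewrite coprimep_div_gcd ?q0 ?orbT.
have [pE qE] : p = p %/ g * g /\ q = q %/ g * g.
  by rewrite !divpK ?dvdp_gcdl ?dvdp_gcdr.
move: (p %/ g) (q %/ g) cop pE qE => p1 q1 cop pE qE.
have q10 : q1 != 0 by apply: contra_neq q0 => e; rewrite qE e mul0r.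
exists p1, q1; split=> //; apply/eqP; rewrite frac_eq //.
by rewrite pE qE -mulrA [g * _]mulrC.
Qed.

Definition lin_form (p q : {poly K}) : {poly {poly K}} := q%:P * 'X - p%:P.

Lemma lin_form_coef0 p q : (lin_form p q)`_0 = - p.
Proof. by rewrite coefB coefMX !coefC /= sub0r. Qed.
Lemma lin_form_coef1 p q : (lin_form p q)`_1 = q.
Proof. by rewrite coefB coefMX !coefC /= subr0. Qed.

Lemma lin_form_primitive p q : coprimep p q -> primitive (lin_form p q).
Proof.
move=> /coprimepP cop e eB; apply/eqP; rewrite size_poly_eq1; apply: cop.
  by have := eB 0%N; rewrite lin_form_coef0 dvdpNr.
by have := eB 1%N; rewrite lin_form_coef1.
Qed.

(** Over K(x) this is the factor theorem; the factor q T - p being primitive,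
    Gauss's lemma removes the denominators. *)
Lemma lin_form_dvd p q (P : {poly {poly K}}) : coprimep p q -> q != 0 ->
  (map_poly tofrac P).[tofrac p / tofrac q] = 0 ->
  exists H, P = lin_form p q * H.
Proof.
move=> cop q0 /rootP/factor_theorem [H0 PE].
have [d d0 [H1 H1E]] := poly_clear_denom H0.
have e : (d * q)%:P * P = lin_form p q * H1.
  have BE : map_poly tofrac (lin_form p q) =
      (tofrac q)%:P * ('X - (tofrac p / tofrac q)%:P).
    rewrite mulrBr -polyCM mulrCA divff ?tofrac_eq0 // mulr1.
    rewrite /lin_form [LHS]rmorphB [X in X - _]rmorphM.
    by congr (_ * _ - _); rewrite /= ?map_polyX ?map_polyC.
  apply: (map_inj_poly (@tofrac_inj _) (rmorph0 _)).
  rewrite [LHS]rmorphM [RHS]rmorphM [X in X * _]map_polyC.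
  change ((tofrac (d * q))%:P * map_poly tofrac P =
          map_poly tofrac (lin_form p q) * map_poly tofrac H1).
  rewrite H1E BE PE -mul_polyC.
  rewrite [tofrac (d * q)]rmorphM polyCM.
  by rewrite [LHS]mulrACA [LHS]mulrC.
have [||H E] := gauss_lemma _ _ e.
- exact: lin_form_primitive.
- by rewrite mulf_neq0.
exists H; apply: (mulfI (x := (d * q)%:P)); first by rewrite polyC_eq0 mulf_neq0.
by rewrite e E mulrCA.
Qed.

Lemma sizeYM (P Q : {poly {poly K}}) : P != 0 -> Q != 0 ->
  sizeY (P * Q) = (sizeY P + sizeY Q).-1.
Proof. by move=> P0 Q0; rewrite !sizeYE rmorphM /= size_mul // swapXY_eq0. Qed.

(** Thus the degree of p/q as a rational function bounds from below the degree in
    x of any polynomial relation that it satisfies. *)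
Lemma lin_form_sizeY p q (P : {poly {poly K}}) : coprimep p q -> q != 0 -> P != 0 ->
  (map_poly tofrac P).[tofrac p / tofrac q] = 0 ->
  (size p <= sizeY P)%N /\ (size q <= sizeY P)%N.
Proof.
move=> cop q0 P0 /(lin_form_dvd cop q0) [H PE].
have [B0 H0] : lin_form p q != 0 /\ H != 0.
  by move: P0; rewrite PE mulf_eq0 negb_or => /andP.
have le : (sizeY (lin_form p q) <= sizeY P)%N.
  rewrite PE sizeYM // -subn1 -addnBA ?leq_addr //.
  by rewrite lt0n sizeY_eq0.
split; apply: leq_trans le.
  by rewrite -size_polyN -(lin_form_coef0 p q) max_size_coefXY.
by rewrite -{1}(lin_form_coef1 p q) max_size_coefXY.
Qed.

End RationalLine.

(** * Lueroth's theorem with automorphisms *)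

(** This says u = (a t + b) / (c t + e); the inverse [w] of the denominator is part
    of the data, so that its nonvanishing needs no separate statement. *)
Definition mobius_image (K F : fieldType) (kap : {rmorphism K -> F}) (t u : F) : Prop :=
  exists a b c e, exists2 w, w != 0 &
    u = w * (kap a * t + kap b) /\ 1 = w * (kap c * t + kap e).

(** The theorem is proved for a field F embedded by [psi] in R = K(x), with its
    automorphisms in view.  An element of F is p/q with p and q coprime, and its
    degree is the maximum of the degrees of p and q.  With d = [R : F], any
    nonconstant coefficient t of the minimal polynomial of x over F has degree
    d, and an element generates F exactly when its degree is d; automorphisms of
    F therefore preserve these elements, and two of them differ by a Moebius
    transformation.  The field R is kept abstract, with the properties of K(x)
    that matter as hypotheses, because the concrete fraction field unfolds during
    unification. *)
Section Luroth.
Variables (K R F : fieldType).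
Variable T : {rmorphism {poly K} -> R}.
Hypothesis T_inj : injective T.
Hypothesis T_clear : forall P : {poly R},
  exists2 d, d != 0 & exists Q : {poly {poly K}}, map_poly T Q = T d *: P.
Hypothesis T_coprime : forall u : R, exists p q : {poly K},
  [/\ q != 0, coprimep p q & u = T p / T q].
Hypothesis T_sizeY : forall p q (P : {poly {poly K}}), coprimep p q -> q != 0 -> P != 0 ->
  (map_poly T P).[T p / T q] = 0 -> (size p <= sizeY P)%N /\ (size q <= sizeY P)%N.
Variable CR : {rmorphism K -> R}.
Hypothesis CRE : forall c, CR c = T c%:P.
Let x := T 'X.
Hypothesis ev_x : forall p, ev CR x p = T p.
Variables (kap : {rmorphism K -> F}) (psi : {rmorphism F -> R}).
Hypothesis psi_kap : forall c, psi (kap c) = CR c.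

Definition evx (h : {poly F}) : R := (map_poly psi h).[x].

Let evx_zmod : zmod_morphism evx.
Proof. by move=> f g; rewrite /evx rmorphB hornerD hornerN. Qed.
Let evxB f g : evx (f - g) = evx f - evx g. Proof. exact: evx_zmod. Qed.
Let evxM f g : evx (f * g) = evx f * evx g.
Proof. by rewrite /evx rmorphM hornerM. Qed.
Let evxZ c f : evx (c *: f) = psi c * evx f.
Proof. by rewrite -mul_polyC evxM /evx map_polyC hornerC. Qed.
Let evx_kap (p : {poly K}) : evx (map_poly kap p) = T p.
Proof.
rewrite /evx -map_poly_comp -ev_x evE; congr (_.[_]).
by apply: eq_map_poly => c; rewrite /= psi_kap.
Qed.

Definition const (u : F) := exists c, u = kap c.

Definition rel_poly (p q : {poly K}) (u : F) : {poly F} :=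
  map_poly kap p - u *: map_poly kap q.

Lemma evx_rel p q u : q != 0 -> psi u = T p / T q -> evx (rel_poly p q u) = 0.
Proof.
move=> q0 e; rewrite evxB evxZ !evx_kap e divfK ?subrr //.
by rewrite -(rmorph0 T) (inj_eq T_inj).
Qed.

Lemma rel_poly_coef p q u i : (rel_poly p q u)`_i = kap p`_i - u * kap q`_i.
Proof. by rewrite coefB coefZ !coef_map. Qed.

Lemma kap_const u a b : b != 0 -> kap a = u * kap b -> const u.
Proof.
move=> b0 e; exists (a / b); apply: (mulIf (x := kap b)); first by rewrite fmorph_eq0.
by rewrite -rmorphM divfK.
Qed.

Lemma rel_coef_eq0 a b u : ~ const u -> kap a - u * kap b = 0 -> a = 0 /\ b = 0.
Proof.
move=> cu /eqP; rewrite subr_eq0 => /eqP e.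
have [b0|b0] := eqVneq b 0; last by case: cu; apply: kap_const e.
by move/eqP: e; rewrite b0 rmorph0 mulr0 fmorph_eq0 => /eqP.
Qed.

Lemma rel_poly_neq0 p q u : q != 0 -> ~ const u -> rel_poly p q u != 0.
Proof.
move=> q0 cu; apply/eqP => /polyP/(_ (size q).-1).
rewrite rel_poly_coef coef0 => /(rel_coef_eq0 cu) [_ /eqP].
by rewrite -lead_coefE lead_coef_eq0 (negPf q0).
Qed.

Lemma size_rel_poly (p q : {poly K}) u n : (size p <= n)%N -> (size q <= n)%N ->
  (size (rel_poly p q u) <= n)%N.
Proof.
move=> pn qn; apply: leq_trans (size_polyD _ _) _; rewrite size_polyN geq_max.
rewrite size_map_poly pn; apply: leq_trans (size_scale_leq _ _) _.
by rewrite size_map_poly.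
Qed.

(** A relation with coefficients in K has degree zero in x, so the element is a
    quotient of constants. *)
Lemma nonconst_transc u : ~ const u -> transc kap u.
Proof.
move=> cu [p p0 pu]; have [a [b [b0 cop uE]]] := T_coprime (psi u).
have [] := T_sizeY (P := map_poly polyC p) cop b0.
- by rewrite map_polyC_eq0.
- rewrite -uE -map_poly_comp (eq_map_poly (g := psi \o kap)).
    by rewrite map_poly_comp horner_map (rootP pu) rmorph0.
  by move=> c; rewrite /= psi_kap CRE.
have -> : sizeY (map_poly polyC p) = 1%N.
  rewrite sizeYE swapXY_map_polyC size_polyC p0 //.
move=> /size1_polyC aE /size1_polyC bE; apply: cu.
apply: (@kap_const u a`_0 b`_0).
  by apply: contra_neq b0 => e; rewrite bE e.
apply: (fmorph_inj psi); rewrite rmorphM !psi_kap !CRE -aE -bE uE divfK //.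
by rewrite -(rmorph0 T) (inj_eq T_inj).
Qed.

(** This says [R : F] = d, in terms of the minimal polynomial of x. *)
Definition x_degree d := (exists2 f : {poly F}, f \is monic /\ size f = d.+1 & evx f = 0)
  /\ forall h : {poly F}, (size h <= d)%N -> evx h = 0 -> h = 0.

Lemma x_degree_exists u : ~ const u -> exists d, x_degree d.
Proof.
move=> cu; have [p [q [q0 _ uE]]] := T_coprime (psi u).
have ex : exists n, asb (exists2 f : {poly F}, f != 0 /\ size f = n & evx f = 0).
  exists (size (rel_poly p q u)); apply/asbP; exists (rel_poly p q u).
    by split=> //; apply: rel_poly_neq0.
  exact: evx_rel.
case: (ex_minnP ex) => n /asbP[f [f0 fn] fx] nmin.
have n0 : (0 < n)%N by rewrite -fn size_poly_gt0.
exists n.-1; split=> [|h hn hx].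
  exists ((lead_coef f)^-1 *: f); last by rewrite evxZ fx mulr0.
  have lf : (lead_coef f)^-1 != 0 by rewrite invr_eq0 lead_coef_eq0.
  split; last by rewrite size_scale // fn prednK.
  by rewrite monicE lead_coefZ mulVf // lead_coef_eq0.
apply/eqP/negPn/negP => h0.
have : (n <= size h)%N by apply: nmin; apply/asbP; exists h.
by apply/negP; rewrite -ltnNge -(prednK n0) ltnS.
Qed.

Lemma map_T_inj : injective (map_poly T).
Proof. exact: map_inj_poly T_inj (rmorph0 _). Qed.

(** The polynomial p(X) q(x) - p(x) q(X) in X over K[x]; it is antisymmetric, so
    its degrees in x and in X agree. *)
Let sym_rel (p q : {poly K}) : {poly {poly K}} :=
  q%:P * map_poly polyC p - p%:P * map_poly polyC q.

Let sym_rel_coef p q i : (sym_rel p q)`_i = p`_i *: q - q`_i *: p.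
Proof.
by rewrite coefB !coefCM !coef_map /= ![_ * _%:P]mulrC !mul_polyC.
Qed.

Let sym_rel_swap p q : swapXY (sym_rel p q) = - sym_rel p q.
Proof.
by rewrite rmorphB !rmorphM /= !swapXY_polyC !swapXY_map_polyC opprB mulrC [X in _ - X]mulrC.
Qed.

Let map_sym_rel p q u : q != 0 -> psi u = T p / T q ->
  map_poly T (sym_rel p q) = T q *: map_poly psi (rel_poly p q u).
Proof.
move=> q0 uE; apply/polyP => i; rewrite coefZ coef_map coef_map rel_poly_coef sym_rel_coef.
have Tq0 : T q != 0 by rewrite -(rmorph0 T) (inj_eq T_inj).
have psiE a b : psi (kap a - u * kap b) = T a%:P - T p / T q * T b%:P.
  by rewrite rmorphB rmorphM !psi_kap !CRE uE.
rewrite [X in T q * X]psiE mulrBr mulrA [T q * (T p / _)]mulrCA divff // mulr1.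
by rewrite [LHS]rmorphB -!mul_polyC !rmorphM; congr (_ - _); apply: mulrC.
Qed.

Lemma nonconst_minor t p q : ~ const t -> q != 0 -> psi t = T p / T q ->
  exists k l, p`_l * q`_k - p`_k * q`_l != 0.
Proof.
move=> ct q0 tE; case: (excluded_middle_informative (exists k l, p`_l * q`_k - p`_k * q`_l != 0)) => // ne.
case: ct; pose k := (size q).-1.
have qk : q`_k != 0 by rewrite -lead_coefE lead_coef_eq0.
exists (p`_k / q`_k); apply: (fmorph_inj psi); rewrite psi_kap CRE tE.
have Tq0 : T q != 0 by rewrite -(rmorph0 T) (inj_eq T_inj).
apply: (mulIf Tq0); rewrite divfK // -rmorphM; congr (T _); apply/polyP => l.
rewrite coefCM; apply: (mulIf qk); rewrite mulrAC divfK //.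
apply/eqP; rewrite -subr_eq0; apply/negPn/negP => h; apply: ne.
by exists k, l.
Qed.

(** Let f be the minimal polynomial of x over F and f1 a primitive multiple of f
    over K[x].  For a nonconstant coefficient t = p/q of f, the polynomial f
    divides p(X) - t q(X), so f1 divides p(X) q(x) - p(x) q(X).  The degree in x
    of the latter is at most that of f1, as p and q divide coefficients of f1;
    hence the cofactor is free of x, and it is constant because p and q are
    coprime.  Comparing degrees in X, which is d for f1, with degrees in x gives
    the claim. *)
Lemma luroth_generator d u0 : ~ const u0 -> x_degree d ->
  exists t p q, [/\ ~ const t, q != 0 /\ coprimep p q, psi t = T p / T q &
     (size p <= d.+1)%N /\ (size q <= d.+1)%N].
Proof.
move=> cu0 [[f [fmon fsz] fx] dmin].
have T0 a : (T a == 0) = (a == 0) by rewrite -(rmorph0 T) (inj_eq T_inj).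
(* a common denominator c of least degree leaves a primitive multiple of f *)
have [c c0 [f1 f1E fprim]] : exists2 c : {poly K}, c != 0 & exists2 f1 : {poly {poly K}},
    map_poly T f1 = T c *: map_poly psi f & primitive f1.
  have ex : exists n, asb (exists2 c : {poly K}, c != 0 /\ size c = n & exists f1 : {poly {poly K}},
      map_poly T f1 = T c *: map_poly psi f).
    have [c c0 fE] := T_clear (map_poly psi f).
    by exists (size c); apply/asbP; exists c.
  case: (ex_minnP ex) => n /asbP[c [c0 cn] [f1 f1E]] nmin; exists c => //.
  exists f1 => // e ef.
  have lf : f1`_d = c.
    apply: T_inj; rewrite -coef_map f1E coefZ coef_map.
    have -> : f`_d = 1 by move/monicP: fmon; rewrite lead_coefE fsz.
    by rewrite /= rmorph1 mulr1.
  have ec : e %| c by rewrite -lf.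
  have [f2 f2E] := coef_dvdP ef; have [c2 c2E] := dvdpP _ _ ec.
  have c20 : c2 != 0 by apply: contra_neq c0 => h; rewrite c2E h mul0r.
  have e0 : e != 0 by apply: contra_neq c0 => h; rewrite c2E h mulr0.
  have : (n <= size c2)%N.
    apply: nmin; apply/asbP; exists c2 => //; exists f2.
    have e00 : T e != 0 by rewrite T0.
    apply: (scalerI e00); rewrite scalerA -rmorphM mulrC -c2E -f1E f2E rmorphM /= map_polyC /=.
    by rewrite mul_polyC.
  rewrite -cn c2E size_mul // -subn1 leq_subLR addnC leq_add2r => se.
  by apply/eqP; rewrite eqn_leq se size_poly_gt0.
(* x being transcendental over K, some coefficient of f is not constant *)
have [i ti] : exists i, ~ const f`_i.
  case: (excluded_middle_informative (exists i, ~ const f`_i)) => // ne.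
  have cf i : {c | f`_i = kap c}.
    apply: constructive_indefinite_description.
    case: (excluded_middle_informative (const f`_i)) => // nc.
    by case: ne; exists i.
  have [f0 fE] : exists f0, f = map_poly kap f0.
    exists (\poly_(i < d.+1) sval (cf i)); apply/polyP => i; rewrite coef_map coef_poly; case: ltnP => h.
      exact: svalP (cf i).
    by rewrite /= rmorph0 nth_default // fsz.
  move/eqP: fx; rewrite fE evx_kap T0 => /eqP e.
  by move: (monic_neq0 fmon); rewrite fE e rmorph0 eqxx.
set t := f`_i in ti.
have [p [q [q0 cop tE]]] := T_coprime (psi t).
have tE1 : T f1`_i = psi t * T c by rewrite -coef_map f1E coefZ coef_map mulrC.
have pqE : f1`_i * q = p * c.
  by apply: T_inj; rewrite !rmorphM tE1 tE mulrAC divfK ?T0.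
have f1i0 : f1`_i != 0.
  rewrite -T0 tE1 mulf_neq0 ?T0 // fmorph_eq0.
  by apply/eqP => h; apply: ti; exists 0; rewrite rmorph0.
have f1d : c = f1`_d.
  apply: T_inj; rewrite -coef_map f1E coefZ coef_map.
  have -> : f`_d = 1 by move/monicP: fmon; rewrite lead_coefE fsz.
  by rewrite /= rmorph1 mulr1.
have p_le : (size p <= sizeY f1)%N.
  apply: leq_trans (max_size_coefXY f1 i); apply: dvdp_leq => //.
  by rewrite -(Gauss_dvdpl _ cop) pqE dvdp_mulr.
have q_le : (size q <= sizeY f1)%N.
  apply: leq_trans (max_size_coefXY f1 d); rewrite -f1d; apply: dvdp_leq => //.
  have cop' : coprimep q p by rewrite coprimep_sym.
  by rewrite -(Gauss_dvdpr c cop') -pqE dvdp_mull.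
exists t, p, q; split=> //.
have [h1 h1E] : exists h1, rel_poly p q t = h1 * f.
  exists (rel_poly p q t %/ f); rewrite {1}(divp_eq (rel_poly p q t) f).
  rewrite (dmin (rel_poly p q t %% f)) ?addr0 //.
    by rewrite -ltnS -fsz ltn_modp monic_neq0.
  have -> : rel_poly p q t %% f = rel_poly p q t - rel_poly p q t %/ f * f.
    by rewrite {2}(divp_eq (rel_poly p q t) f) addrC addKr.
  by rewrite evxB evxM fx mulr0 subr0 (evx_rel q0 tE).
have [d1 d10 [H1 H1E]] := T_clear (map_poly psi h1).
have e1 : (c * d1)%:P * sym_rel p q = f1 * (q%:P * H1).
  apply: map_T_inj; rewrite !rmorphM /= !map_polyC /= f1E H1E (map_sym_rel q0 tE) h1E.
  rewrite [map_poly psi _]rmorphM -!mul_polyC ?rmorphM ?polyCM /=; ring.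
have [||H2 H2E] := gauss_lemma _ _ e1; [by []|by rewrite mulf_neq0|].
have GE : sym_rel p q = f1 * H2.
  apply: (mulfI (x := (c * d1)%:P)); first by rewrite polyC_eq0 mulf_neq0.
  by rewrite e1 H2E mulrCA.
have G0 : sym_rel p q != 0.
  apply/eqP => G0.
  have := map_sym_rel q0 tE; rewrite G0 rmorph0 => /esym/eqP.
  rewrite scaler_eq0 T0 (negPf q0) /= map_poly_eq0.
  by rewrite (negPf (rel_poly_neq0 p q0 ti)).
have [f10 H20] : f1 != 0 /\ H2 != 0.
  by move: G0; rewrite GE mulf_eq0 negb_or => /andP.
have GY : (sizeY (sym_rel p q) <= sizeY f1)%N.
  apply/bigmax_leqP => k _; rewrite sym_rel_coef.
  apply: leq_trans (size_polyD _ _) _; rewrite size_polyN geq_max.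
  by rewrite !(leq_trans (size_scale_leq _ _)).
(* the degrees in x leave no room for x in the cofactor *)
have H2Y : (sizeY H2 <= 1)%N.
  move: GY; rewrite GE sizeYM // -subn1 leq_subLR addnC leq_add2r //.
have [h0 H2C] : exists h0, H2 = map_poly polyC h0.
  exists (map_poly (coefp 0) H2); apply/polyP => k; rewrite coef_map coef_map_id0 /=; last by rewrite coef0.
  by apply: size1_polyC; apply: leq_trans (max_size_coefXY _ _) H2Y.
have h00 : h0 != 0 by apply: contra_neq H20 => h; rewrite H2C h rmorph0.
(* the swapped relation shows that h0 divides all combinations q_k p - p_k q *)
have hdiv k : h0 %| q`_k *: p - p`_k *: q.
  have : swapXY (sym_rel p q) = swapXY f1 * h0%:P.
    by rewrite GE rmorphM H2C /= swapXY_map_polyC.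
  rewrite sym_rel_swap => /polyP/(_ k); rewrite coefN sym_rel_coef opprB coefMC => ->.
  by rewrite dvdp_mull.
have h01 : size h0 = 1%N.
  have [k [l kl]] := nonconst_minor ti q0 tE.
  have scal (a b : K) (u v : {poly K}) : h0 %| u -> h0 %| v -> h0 %| a *: u - b *: v.
    by move=> hu hv; apply: dvdp_sub; rewrite -mul_polyC dvdp_mull.
  have hp : h0 %| p.
    rewrite -(dvdpZr _ _ kl).
    have <- : p`_l *: (q`_k *: p - p`_k *: q) - p`_k *: (q`_l *: p - p`_l *: q) =
       (p`_l * q`_k - p`_k * q`_l) *: p.
      rewrite !scalerBr !scalerA [p`_l * p`_k]mulrC opprB addrA subrK.
      by rewrite scalerBl.
    exact: scal.
  have hq : h0 %| q.
    rewrite -(dvdpZr _ _ kl).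
    have <- : q`_l *: (q`_k *: p - p`_k *: q) - q`_k *: (q`_l *: p - p`_l *: q) =
       (p`_l * q`_k - p`_k * q`_l) *: q.
      rewrite !scalerBr !scalerA [q`_l * q`_k]mulrC opprB addrC addrA subrK.
      by rewrite scalerBl [q`_k * _]mulrC [q`_l * _]mulrC.
    exact: scal.
  by apply/eqP; rewrite size_poly_eq1; move/coprimepP: cop; apply.
have sG : size (sym_rel p q) = d.+1.
  have sf1 : size f1 = d.+1.
    rewrite -fsz -(size_map_inj_poly T_inj (rmorph0 _)) f1E size_scale ?T0 //.
    by rewrite size_map_poly.
  rewrite GE size_mul // sf1 H2C size_map_polyC h01 addn1 //.
have sY : sizeY (sym_rel p q) = d.+1.
  by rewrite sizeYE sym_rel_swap size_polyN.
have s1 : sizeY H2 = 1%N.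
  by apply/eqP; rewrite eqn_leq H2Y lt0n sizeY_eq0.
have le : (sizeY f1 <= d.+1)%N by rewrite -sY GE sizeYM // s1 addn1.
by split; apply: leq_trans le.
Qed.

Definition generates (t : F) := forall m : F, exists P Q : {poly K},
  ev kap t Q != 0 /\ m = ev kap t P / ev kap t Q.

(** The relation G = p(X) - t q(X) has degree at most d in X, so modulo G every
    polynomial in x becomes one of degree less than d with coefficients in K(t).
    For m = a/b in F, the equation m b(x) = a(x) then has degree less than d over
    F, so it holds coefficientwise and expresses m in K(t). *)
Lemma low_degree_generates d t p q : x_degree d -> ~ const t -> q != 0 ->
  psi t = T p / T q -> (size p <= d.+1)%N -> (size q <= d.+1)%N -> generates t.
Proof.
move=> [_ dmin] ct q0 tE pd qd.
have tt := nonconst_transc ct.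
have T0 a : (T a == 0) = (a == 0) by rewrite -(rmorph0 T) (inj_eq T_inj).
pose G : {poly {poly K}} := map_poly polyC p - 'X%:P * map_poly polyC q.
have GE : map_poly (ev kap t) G = rel_poly p q t.
  have evt a b : ev kap t (a%:P - 'X * b%:P) = kap a - t * kap b.
    by rewrite evE rmorphB rmorphM /= !map_polyC map_polyX !hornerE.
  apply/polyP => i; rewrite rel_poly_coef -evt coef_map coefB coefCM.
  by rewrite !(coef_map polyC).
have G0 : G != 0.
  by apply: contra_neq (rel_poly_neq0 p q0 ct) => h; rewrite -GE h rmorph0.
have szG : (size G <= d.+1)%N.
  rewrite -(size_map_inj_poly (transc_inj tt) (rmorph0 _)) GE.
  exact: size_rel_poly.
have Gx : evx (map_poly (ev kap t) G) = 0 by rewrite GE (evx_rel q0 tE).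
(* pseudo-division by G, whose leading coefficient need not be a unit of K[t] *)
have red (a : {poly K}) : exists (l : {poly K}) (r : {poly {poly K}}),
    [/\ ev kap t l != 0, (size r <= d)%N &
        psi (ev kap t l) * T a = evx (map_poly (ev kap t) r)].
  pose a' : {poly {poly K}} := map_poly polyC a.
  exists (lead_coef G ^+ scalp a' G), (a' %% G); split.
  - by apply: transc_ev_neq0 => //; rewrite expf_neq0 // lead_coef_eq0.
  - by rewrite -ltnS; apply: leq_trans szG; rewrite ltn_modp.
  have := Pdiv.Idomain.divp_eq a' G.
  move=> /(congr1 (fun P => evx (map_poly (ev kap t) P))).
  rewrite map_polyZ evxZ rmorphD rmorphM /= [evx (_ + _)]/evx rmorphD hornerD.
  rewrite -![(map_poly psi _).[x]]/(evx _) evxM Gx mulr0 add0r => <-.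
  congr (_ * _); rewrite -evx_kap; congr (evx _).
  rewrite /a' -map_poly_comp; apply: eq_map_poly => c.
  exact: esym (evC kap t c).
move=> m; have [a [b [b0 _ mE]]] := T_coprime (psi m).
have [la [A [la0 Ad AE]]] := red a; have [lb [B [lb0 Bd BE]]] := red b.
set l1 := ev kap t la in la0 AE *; set l2 := ev kap t lb in lb0 BE *.
set A' := map_poly _ A in AE; set B' := map_poly _ B in BE.
have h0 : (m * l1) *: B' - l2 *: A' = 0.
  apply: dmin.
    apply: leq_trans (size_polyD _ _) _; rewrite size_polyN geq_max.
    by rewrite !(leq_trans (size_scale_leq _ _)) // (leq_trans (size_poly _ _)).
  rewrite evxB !evxZ -AE -BE rmorphM mE.
  have Tb0 : T b != 0 by rewrite T0.
  by field.
have [i Bi] : exists i, ev kap t B`_i != 0.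
  have B0 : B' != 0.
    apply: contra_eq_neq BE => ->; rewrite /evx rmorph0 horner0 mulf_neq0 ?T0 //.
    by rewrite fmorph_eq0.
  exists (size B').-1; move: B0; rewrite -lead_coef_eq0 lead_coefE.
  by rewrite [X in X != 0 -> _]coef_map.
exists (lb * A`_i), (la * B`_i); rewrite ![ev kap t (_ * _)]rmorphM; split.
  exact: mulf_neq0.
move/polyP/(_ i): h0; rewrite coefB !coefZ coef0 !coef_map => /eqP.
rewrite subr_eq0 -![GRing.Additive.sort _ _]/(ev kap t _) => /eqP e.
rewrite -/l1 -/l2.
apply: (mulIf (mulf_neq0 la0 Bi)); rewrite mulrA divfK ?mulf_neq0 //.
Qed.

Lemma ev_psi u r : ev CR (psi u) r = psi (ev kap u r).
Proof.
rewrite !evE -horner_map -map_poly_comp; congr (_.[_]).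
by apply: eq_map_poly => c; rewrite /= psi_kap.
Qed.

Lemma generates_clear u (f : {poly F}) : generates u -> exists l : {poly K},
  ev kap u l != 0 /\ exists f1 : {poly {poly K}}, map_poly (ev kap u) f1 = ev kap u l *: f.
Proof.
move=> gu; elim/poly_ind: f => [|f c [l [l0 [f1 f1E]]]].
  by exists 1; rewrite rmorph1 oner_neq0; split=> //; exists 0; rewrite rmorph0 scaler0.
have [P [Q [Q0 cE]]] := gu c.
exists (l * Q); rewrite [ev kap u (l * Q)]rmorphM; split; first exact: mulf_neq0.
exists (Q *: f1 * 'X + (l * P)%:P).
have mapE (g : {rmorphism {poly K} -> F}) (h : {poly {poly K}}) a b :
    map_poly g (a *: h * 'X + b%:P) = g a *: map_poly g h * 'X + (g b)%:P.
  by rewrite rmorphD rmorphM /= map_polyZ map_polyX map_polyC.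
rewrite mapE f1E [ev kap u (l * P)]rmorphM scalerDr; congr (_ + _).
  by rewrite scalerA [ev kap u Q * _]mulrC -scalerAl.
by rewrite -mul_polyC -polyCM cE; congr (_%:P); field.
Qed.

(** Clearing denominators in the minimal polynomial of x with coefficients in K(u)
    gives a relation of u over K[x] whose degree in x is d. *)
Lemma generates_low_degree d u p q : x_degree d -> generates u -> ~ const u ->
  q != 0 -> coprimep p q -> psi u = T p / T q ->
  (size p <= d.+1)%N /\ (size q <= d.+1)%N.
Proof.
move=> [[f [fmon fsz] fx] _] gu cu q0 cop uE.
have tu := nonconst_transc cu.
have [l [l0 [f1 f1E]]] := generates_clear f gu.
have sf1 : size f1 = d.+1.
  by rewrite -(size_map_inj_poly (transc_inj tu) (rmorph0 _)) f1E size_scale.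
have <- : sizeY (swapXY f1) = d.+1 by rewrite sizeYE swapXYK.
apply: T_sizeY => //; first by rewrite swapXY_eq0 -size_poly_gt0 sf1.
rewrite -uE (eq_map_poly (fun r => esym (ev_x r))) ev_swapXY.
rewrite (eq_map_poly (ev_psi u)) map_poly_comp f1E -[LHS]/(evx _) evxZ fx.
by rewrite mulr0.
Qed.

(** Both p(X) - t q(X) and r(X) - u s(X) are multiples of the minimal polynomial of
    x, hence proportional.  Two coefficients at which r and s are not
    proportional give two linear equations, solved for u by Cramer's rule. *)
Lemma low_degree_mobius d t u p q r s : x_degree d ->
  ~ const t -> q != 0 -> psi t = T p / T q -> (size p <= d.+1)%N -> (size q <= d.+1)%N ->
  ~ const u -> s != 0 -> psi u = T r / T s -> (size r <= d.+1)%N -> (size s <= d.+1)%N ->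
  mobius_image kap t u.
Proof.
move=> [_ dmin] ct q0 tE pd qd cu s0 uE rd sd.
have lead (a b : {poly K}) v : b != 0 -> ~ const v -> psi v = T a / T b ->
    (size a <= d.+1)%N -> (size b <= d.+1)%N -> (rel_poly a b v)`_d != 0.
  move=> b0 cv vE ad bd; apply/eqP => h.
  have /eqP := rel_poly_neq0 a b0 cv; apply; apply: dmin; last exact: evx_rel vE.
  have : (size (rel_poly a b v) <= d.+1)%N by apply: size_rel_poly.
  rewrite leq_eqVlt => /orP[/eqP sz|]; last by rewrite ltnS.
  have : lead_coef (rel_poly a b v) = 0 by rewrite lead_coefE sz.
  by move/eqP; rewrite lead_coef_eq0 => /eqP ->; rewrite size_poly0.
have al := lead p q t q0 ct tE pd qd; have be := lead r s u s0 cu uE rd sd.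
set alpha := _`_d in al; set beta := _`_d in be.
have h : beta *: rel_poly p q t - alpha *: rel_poly r s u = 0.
  apply: dmin.
    have le : (size (beta *: rel_poly p q t - alpha *: rel_poly r s u)%R <= d.+1)%N.
      apply: leq_trans (size_polyD _ _) _; rewrite size_polyN geq_max.
      by rewrite !(leq_trans (size_scale_leq _ _)) // size_rel_poly.
    move: le; rewrite leq_eqVlt => /orP[/eqP sz|]; last by rewrite ltnS.
    have /eqP : lead_coef (beta *: rel_poly p q t - alpha *: rel_poly r s u) = 0.
      by rewrite lead_coefE sz coefB !coefZ -/alpha -/beta mulrC subrr.
    by rewrite lead_coef_eq0 => /eqP ->; rewrite size_poly0.
  by rewrite evxB !evxZ (evx_rel q0 tE) (evx_rel s0 uE) !mulr0 subrr.
have eqi i : kap r`_i - u * kap s`_i = beta / alpha * (kap p`_i - t * kap q`_i).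
  move/polyP/(_ i): h; rewrite coefB !coefZ coef0 !rel_poly_coef => /eqP.
  rewrite subr_eq0 => /eqP e; apply: (mulfI al); rewrite -e; field; exact: al.
have [k [i ki]] := nonconst_minor cu s0 uE.
pose de := kap (r`_i * s`_k - r`_k * s`_i).
have de0 : de != 0 by rewrite fmorph_eq0.
have [ek ei] := (eqi k, eqi i).
exists (- (r`_k * q`_i - r`_i * q`_k)), (r`_k * p`_i - r`_i * p`_k).
exists (- (s`_k * q`_i - s`_i * q`_k)), (s`_k * p`_i - s`_i * p`_k).
exists (beta / alpha / de); first by rewrite !mulf_neq0 ?invr_eq0.
split; apply: (mulIf de0).
  transitivity (kap r`_k * (beta / alpha * (kap p`_i - t * kap q`_i)) -
    kap r`_i * (beta / alpha * (kap p`_k - t * kap q`_k))).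
    by rewrite -ek -ei /de rmorphB !rmorphM; ring.
  by clearbody de alpha beta; rewrite !(rmorphN, rmorphB, rmorphM) /=; field; rewrite de0 al.
transitivity (kap s`_k * (beta / alpha * (kap p`_i - t * kap q`_i)) -
    kap s`_i * (beta / alpha * (kap p`_k - t * kap q`_k))).
  by rewrite -ek -ei /de rmorphB !rmorphM; ring.
by clearbody de alpha beta; rewrite !(rmorphN, rmorphB, rmorphM) /=; field; rewrite de0 al.
Qed.

Theorem luroth_abstract u0 : ~ const u0 -> exists t, [/\ transc kap t, generates t &
  forall s : {rmorphism F -> F}, (forall c, s (kap c) = kap c) ->
    (forall y, exists z, s z = y) -> mobius_image kap t (s t)].
Proof.
move=> cu0; have [d xd] := x_degree_exists cu0.
have [t [p [q [ct [q0 cop] tE [pd qd]]]]] := luroth_generator cu0 xd.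
have gt := low_degree_generates xd ct q0 tE pd qd.
exists t; split=> //; first exact: nonconst_transc.
move=> s sC s_surj.
have s_inj : injective s by apply: fmorph_inj.
have cs : ~ const (s t) by move=> [c sc]; apply: ct; exists c; apply: s_inj; rewrite sc sC.
have ev_s P : s (ev kap t P) = ev kap (s t) P.
  rewrite !evE -horner_map -map_poly_comp; congr (_.[_]).
  by apply: eq_map_poly => c; rewrite /= sC.
have gs : generates (s t).
  move=> y; have [z <-] := s_surj y; have [P [Q [Q0 ->]]] := gt z.
  by exists P, Q; rewrite -!ev_s fmorph_eq0 fmorph_div.
have [r1 [s1 [s10 cop1 sE]]] := T_coprime (psi (s t)).
have [r1d s1d] := generates_low_degree xd gs cs s10 cop1 sE.
exact: (low_degree_mobius xd ct q0 tE pd qd cs s10 sE r1d s1d).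
Qed.

End Luroth.

Theorem luroth (K F : fieldType) (kap : {rmorphism K -> F})
    (psi : {rmorphism F -> {fraction {poly K}}}) u0 :
  (forall c, psi (kap c) = fracC K c) -> ~ const kap u0 ->
  exists t, [/\ transc kap t, generates kap t &
  forall s : {rmorphism F -> F}, (forall c, s (kap c) = kap c) ->
    (forall y, exists z, s z = y) -> mobius_image kap t (s t)].
Proof.
move=> psiC cu0; have C0 c : fracC K c = tofrac c%:P by [].
exact: (luroth_abstract (@tofrac_inj {poly K}) (@poly_clear_denom {poly K})
  (@frac_coprime K) (@lin_form_sizeY K) C0 (@ev_fracX K) psiC cu0).
Qed.

Lemma frac_alg_closed (K : fieldType) (u : {fraction {poly K}}) :
  algebraicOver (fracC K) u -> exists c, u = fracC K c.
Proof.
move=> au; have C0 c : fracC K c = tofrac c%:P by [].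
case: (excluded_middle_informative (const (fracC K) u)) => // nc.
have idC c : (idfun : {rmorphism {fraction {poly K}} -> {fraction {poly K}}}) (fracC K c) = fracC K c by [].
by case: (nonconst_transc (@tofrac_inj {poly K})
  (@frac_coprime K) (@lin_form_sizeY K) C0 idC nc).
Qed.

(** * Kronecker substitution and subfields *)

Section Kronecker.
Variable K : fieldType.

Lemma base_inj m N (f g : 'I_m -> nat) : (forall i, f i < N)%N -> (forall i, g i < N)%N ->
  (\sum_(i < m) f i * N ^ i = \sum_(i < m) g i * N ^ i)%N -> f =1 g.
Proof.
elim: m f g => [|m IH] f g fN gN; first by move=> _ [].
have N0 : (0 < N)%N by apply: leq_ltn_trans (fN ord0).
have E (h : 'I_m.+1 -> nat) : (\sum_(i < m.+1) h i * N ^ i =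
   (\sum_(i < m) h (lift ord0 i) * N ^ i) * N + h ord0)%N.
  rewrite big_ord_recl expn0 muln1 addnC; congr (_ + _)%N.
  by rewrite big_distrl /=; apply: eq_bigr => i _; rewrite -mulnA -expnSr.
rewrite !E => e.
have e0 : f ord0 = g ord0.
  by move/(congr1 (modn^~ N)): e; rewrite !modnMDl !modn_small.
have /IH e1 : (\sum_(i < m) f (lift ord0 i) * N ^ i = \sum_(i < m) g (lift ord0 i) * N ^ i)%N.
  by move/eqP: e; rewrite e0 eqn_add2r eqn_pmul2r // => /eqP.
move=> i; case: (unliftP ord0 i) => [j ->|-> //].
exact: e1 (fun k => fN _) (fun k => gN _) j.
Qed.

Variables (m N : nat).

(** Restriction to a curve on which monomials with exponents below N stay
    distinct, whatever the size of K. *)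
Definition kronecker : {rmorphism {mpoly K[m]} -> {poly K}} :=
  mmap polyC (fun i : 'I_m => 'X^(N ^ i)).

Lemma kroneckerC c : kronecker c%:MP = c%:P. Proof. exact: mmapC. Qed.

Lemma kronecker_neq0 (p : {mpoly K[m]}) : (msize p <= N)%N -> p != 0 -> kronecker p != 0.
Proof.
move=> pN p0; pose e (u : 'X_{1..m}) := (\sum_(i < m) u i * N ^ i)%N.
have eE u : mmap1 (fun i : 'I_m => 'X^(N ^ i)) u = 'X^(e u) :> {poly K}.
  rewrite /mmap1 /e expr_sum; apply: eq_bigr => i _.
  by rewrite -exprM mulnC.
apply/eqP => /polyP/(_ (e (mlead p))); rewrite coef0.
rewrite /kronecker /= /mmap coef_sum (bigD1_seq (mlead p)) ?mlead_supp ?msupp_uniq //=.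
rewrite eE coefCM coefXn eqxx mulr1 big_seq_cond big1 => [|u /andP[us une]].
  by rewrite addr0 => /eqP; rewrite mleadc_eq0 (negPf p0).
rewrite eE coefCM coefXn; case: eqP => [h|]; last by rewrite mulr0.
have bnd w : w \in msupp p -> forall i, (w i < N)%N.
  move=> ws i; apply: leq_trans pN; apply: leq_ltn_trans (msize_mdeg_lt ws).
  by rewrite mdegE (bigD1 i) //= leq_addr.
case/eqP: une; apply/esym/mnmP => i.
by apply: (base_inj _ _ h); apply: bnd => //; apply: mlead_supp.
Qed.
End Kronecker.

Section SubfieldType.
Variables (L : fieldType) (S : {pred L}) (hS : divring_closed S).
(** An alias, because the closure instance has to be attached to a constant. *)
Definition subfield_pred : {pred L} := S.
HB.instance Definition _ := GRing.isDivringClosed.Build L subfield_pred hS.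
Record subfield_type := SubfieldType { sf_val : L; sf_valP : sf_val \in subfield_pred }.
HB.instance Definition _ := [isSub for sf_val].
HB.instance Definition _ := [Choice of subfield_type by <:].
HB.instance Definition _ := [SubChoice_isSubIntegralDomain of subfield_type by <:].
HB.instance Definition _ := [SubIntegralDomain_isSubField of subfield_type by <:].

Lemma subfield_exists : exists (F : fieldType) (v : {rmorphism F -> L}),
  forall x, x \in S <-> exists y, v y = x.
Proof.
exists subfield_type, (val : {rmorphism subfield_type -> L}) => x; split.
  by move=> xS; exists (SubfieldType xS).
by case=> y <-; apply: (valP y).
Qed.
End SubfieldType.

Lemma rmorph_pack (A B : nzRingType) (f : A -> B) : zmod_morphism f -> monoid_morphism f ->
  exists g : {rmorphism A -> B}, g =1 f.
Proof.
move=> hz hm.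
pose g : {rmorphism A -> B} := HB.pack f (GRing.isZmodMorphism.Build _ _ f hz)
    (GRing.isMonoidMorphism.Build _ _ f hm).
by exists g.
Qed.

Lemma rmorph_factor (A : nzRingType) (F L : fieldType) (v : {rmorphism F -> L})
    (f : {rmorphism A -> L}) : (forall a, exists y, v y = f a) ->
  exists g : {rmorphism A -> F}, forall a, v (g a) = f a.
Proof.
move=> h; pose g a := sval (constructive_indefinite_description _ (h a)).
have gE a : v (g a) = f a by exact: svalP (constructive_indefinite_description _ (h a)).
have vi : injective v by apply: fmorph_inj.
have [g' g'E] : exists g' : {rmorphism A -> F}, g' =1 g.
  apply: rmorph_pack => [a b|].
    by apply: vi; rewrite rmorphB !gE rmorphB.
  by split=> [|a b]; apply: vi; rewrite ?rmorphM ?rmorph1 ?gE ?rmorph1 ?rmorphM.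
by exists g' => a; rewrite g'E.
Qed.

(** * Specializing a field of transcendence degree one *)

(** A specialization chi of A extends to the fractions whose denominator it does not
    kill.  On a field of transcendence degree one whose elements all have a value,
    the extension is an embedding as soon as one element has a transcendental
    value: this turns a G-stable field inside Frac A into a subfield of R. *)
Section Place.
Variables (A : idomainType) (K L R : fieldType).
Variables (T : {rmorphism A -> L}) (chi : {rmorphism A -> R}).
Hypothesis T_inj : injective T.
Variables (iota : {rmorphism K -> L}) (CR : {rmorphism K -> R}) (cA : K -> A).
Hypotheses (iotaE : forall c, iota c = T (cA c)) (CRE : forall c, CR c = chi (cA c)).

(** A relation and not a function: a fraction may have several numerators and
    denominators, of which only some are good for chi. *)
Definition place (u : L) (w : R) : Prop :=
  exists p q, [/\ chi q != 0, u = T p / T q & w = chi p / chi q].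

Let chi_T q : chi q != 0 -> T q != 0.
Proof.
move=> q0; rewrite -(rmorph0 T) (inj_eq T_inj).
by apply: contra_neq q0 => ->; rewrite rmorph0.
Qed.

Lemma place_fun u w w' : place u w -> place u w' -> w = w'.
Proof.
move=> [p [q [q0 -> ->]]] [p' [q' [q'0 e ->]]].
apply/eqP; rewrite eqr_div // -!rmorphM.
move/eqP: e; rewrite eqr_div ?chi_T // -!rmorphM (inj_eq T_inj) => /eqP -> //.
Qed.

Lemma placeT p : place (T p) (chi p).
Proof. by exists p, 1; rewrite !rmorph1 oner_neq0 !divr1. Qed.

Lemma placeD u w u' w' : place u w -> place u' w' -> place (u + u') (w + w').
Proof.
move=> [p [q [q0 -> ->]]] [p' [q' [q'0 -> ->]]].
exists (p * q' + p' * q), (q * q').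
by rewrite !rmorphM !rmorphD !rmorphM mulf_neq0 // !addf_div ?chi_T.
Qed.

Lemma placeM u w u' w' : place u w -> place u' w' -> place (u * u') (w * w').
Proof.
move=> [p [q [q0 -> ->]]] [p' [q' [q'0 -> ->]]].
by exists (p * p'), (q * q'); rewrite !rmorphM mulf_neq0 // !mulf_div.
Qed.

Lemma placeN u w : place u w -> place (- u) (- w).
Proof.
by move=> [p [q [q0 -> ->]]]; exists (- p), q; rewrite !rmorphN !mulNr.
Qed.

Lemma placeV u w : place u w -> w != 0 -> place u^-1 w^-1.
Proof.
move=> [p [q [q0 -> ->]]]; rewrite mulf_eq0 invr_eq0 (negPf q0) orbF => p0.
by exists q, p; rewrite !invf_div.
Qed.

Lemma placeC c : place (iota c) (CR c).
Proof. by rewrite iotaE CRE; apply: placeT. Qed.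

Lemma placeX u w n : place u w -> place (u ^+ n) (w ^+ n).
Proof.
move=> h; elim: n => [|n IH]; last by rewrite !exprS; apply: placeM.
by have := placeT 1; rewrite !rmorph1.
Qed.

Lemma place_horner (I : nat) (f : nat -> L) (g : nat -> R) u w :
  (forall i, place (f i) (g i)) -> place u w ->
  place (\sum_(i < I) f i * u ^+ i) (\sum_(i < I) g i * w ^+ i).
Proof.
move=> fg uw; elim: I => [|n IH]; last first.
  by rewrite !big_ord_recr; apply: placeD => //; apply: placeM => //; apply: placeX.
by rewrite !big_ord0; have := placeT 0; rewrite !rmorph0.
Qed.

Lemma place_ev u w (r : {poly K}) : place u w -> place (ev iota u r) (ev CR w r).
Proof.
move=> uw; rewrite !evE !(@horner_coef_wide _ (size r)) ?size_poly //.
by apply: place_horner => // i; rewrite !coef_map; apply: placeC.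
Qed.

Lemma place_ev2 u w u' w' (P : {poly {poly K}}) : place u w -> place u' w' ->
  place (map_poly (ev iota u) P).[u'] (map_poly (ev CR w) P).[w'].
Proof.
move=> uw uw'; rewrite !(@horner_coef_wide _ (size P)) ?size_poly //.
by apply: place_horner => // i; rewrite !coef_map; apply: place_ev.
Qed.

(** Were the value of u zero, specializing its equation over K(t) would kill the
    constant coefficient, which is impossible for a nonzero polynomial in t; so
    the equation could be divided by u, again and again. *)
Lemma place_neq0 t wt u w : place t wt -> transc CR wt -> alg_over iota t u ->
  u != 0 -> place u w -> w != 0.
Proof.
move=> tw wtr [P P0 Pu] u0 uw; apply/eqP => w0.
have [n] := ubnP (size P); elim: n P P0 Pu => // n IH P P0 Pu; rewrite ltnS => Pn.
have P00 : P`_0 = 0.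
  apply: (transc_inj wtr); rewrite rmorph0.
  have pu := place_ev2 P tw uw; rewrite Pu in pu.
  have p0 : place 0 0 by have := placeT 0; rewrite !rmorph0.
  have := place_fun pu p0.
  by rewrite w0 horner_coef0 coef_map.
have [P1 PE] : exists P1, P = P1 * 'X.
  have /factor_theorem [P1 PE] : root P 0 by rewrite /root horner_coef0 P00.
  by exists P1; rewrite PE subr0.
have P10 : P1 != 0 by apply: contra_neq P0 => h; rewrite PE h mul0r.
apply: (IH P1 P10); last by move: Pn; rewrite PE size_mulX.
move/eqP: Pu; rewrite PE rmorphM /= map_polyX hornerM hornerX mulf_eq0.
by rewrite (negPf u0) orbF => /eqP.
Qed.

Section Model.
Variables (gT : finGroupType) (G : {group gT}) (act : gT -> {rmorphism L -> L}).
Hypothesis act1 : forall x, act 1%g x = x.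
Hypothesis actM : forall g h x, g \in G -> h \in G -> act (g * h)%g x = act g (act h x).
Hypothesis actC : forall g c, act g (iota c) = iota c.
Variables (t : L) (wt : R).
Hypotheses (tt : transc iota t) (act_t : forall g, g \in G -> act g t = t).
Hypotheses (twt : place t wt) (wtt : transc CR wt).

(** The conditions bear on all conjugates of u to make the field G-stable. *)
Definition model_pred : {pred L} := [pred u | asb (forall g, g \in G ->
  (exists w, place (act g u) w) /\ alg_over iota t (act g u))].

Lemma model_predP u : u \in model_pred <-> forall g, g \in G ->
  (exists w, place (act g u) w) /\ alg_over iota t (act g u).
Proof. by split=> [/asbP|h]; last exact/asbP. Qed.

Lemma model_pred_divring : divring_closed model_pred.
Proof.
split.
- apply/model_predP => g gG; rewrite rmorph1; split; last first.
    by rewrite -(rmorph1 iota); apply: alg_overC.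
  by exists 1; have := placeT 1; rewrite !rmorph1.
- move=> u v /model_predP hu /model_predP hv; apply/model_predP => g gG.
  have [[w uw] ua] := hu g gG; have [[w' vw'] va] := hv g gG; rewrite rmorphB; split.
    by exists (w - w'); apply: placeD => //; apply: placeN.
  exact: alg_overB.
- move=> u v /model_predP hu /model_predP hv; apply/model_predP => g gG.
  have [[w uw] ua] := hu g gG; have [[w' vw'] va] := hv g gG.
  rewrite fmorph_div; split; last by apply: alg_overM => //; apply: alg_overV.
  have [->|v0] := eqVneq (act g v) 0.
    by rewrite invr0 mulr0; exists 0; have := placeT 0; rewrite !rmorph0.
  exists (w / w'); apply: placeM => //; apply: placeV => //.
  exact: (place_neq0 twt wtt va v0 vw').
Qed.

Lemma subfield_model : exists (F : fieldType) (v : {rmorphism F -> L})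
    (kap : {rmorphism K -> F}) (psi : {rmorphism F -> R}) (s : gT -> {rmorphism F -> F}),
  [/\ forall c, v (kap c) = iota c, forall c, psi (kap c) = CR c,
      forall g y, g \in G -> v (s g y) = act g (v y) &
      forall u, u \in model_pred -> exists y, v y = u].
Proof.
have [F [v vP]] := subfield_exists model_pred_divring.
have [kap kapE] : exists kap : {rmorphism K -> F}, forall c, v (kap c) = iota c.
  apply: rmorph_factor => c; apply/vP/model_predP => g gG; rewrite actC; split.
    by exists (CR c); apply: placeC.
  exact: alg_overC.
have sP g : exists s : {rmorphism F -> F}, g \in G -> forall y, v (s y) = act g (v y).
  case: (boolP (g \in G)) => gG; last by exists idfun.
  have [|s sE] := rmorph_factor (v := v) (f := act g \o v); last by exists s.
  move=> y; apply/vP/model_predP => h hG.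
  have /vP/model_predP hy : exists z, v z = v y by exists y.
  by rewrite /= -actM //; apply: hy; rewrite groupM.
pose s g := sval (constructive_indefinite_description _ (sP g)).
have sE g y : g \in G -> v (s g y) = act g (v y).
  by move=> gG; exact: (svalP (constructive_indefinite_description _ (sP g)) gG).
have plv y : exists w, place (v y) w.
  have /vP/model_predP hy : exists z, v z = v y by exists y.
  by have [[w]] := hy 1%g (group1 G); rewrite act1; exists w.
pose psi y := sval (constructive_indefinite_description _ (plv y)).
have psiE y : place (v y) (psi y) by exact: svalP (constructive_indefinite_description _ (plv y)).
have [psi' psi'E] : exists psi' : {rmorphism F -> R}, psi' =1 psi.
  apply: rmorph_pack => [a b|].
    apply: (place_fun (psiE _)); rewrite rmorphB; apply: placeD => //.
    exact: placeN.
  split=> [|a b]; apply: (place_fun (psiE _)).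
    by rewrite rmorph1; have := placeT 1; rewrite !rmorph1.
  by rewrite rmorphM; apply: placeM.
exists F, v, kap, psi', s; split=> //; last by move=> u /vP.
move=> c; rewrite psi'E; apply: (place_fun (psiE _)).
by rewrite kapE; apply: placeC.
Qed.
End Model.

End Place.

(** * From invariant functions to Moebius transformations *)

(** A faithful action of [G] by Moebius transformations of one variable, which
    amounts to an embedding of [G] in PGL_2(K). *)
Definition mobius_action (K : fieldType) (gT : finGroupType) (G : {group gT}) : Prop :=
  exists (F : fieldType) (kap : {rmorphism K -> F}) (x : F) (s : gT -> {rmorphism F -> F}),
  [/\ transc kap x,
      (forall g h, g \in G -> h \in G -> s (g * h)%g x = s g (s h x)) /\
        (forall g c, g \in G -> s g (kap c) = kap c),
      forall g, g \in G -> s g x = x -> g = 1%g &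
      forall g, g \in G -> mobius_image kap x (s g x)].

Section MobiusModel.
Variables (K : fieldType) (m : nat).
Notation L := (ratfun K m).
Notation iC := (ratfunC K m).

Lemma common_msize (us : seq L) : exists N, forall u, u \in us -> exists p q : {mpoly K[m]},
  [/\ q != 0, u = tofrac p / tofrac q & (msize p <= N)%N && (msize q <= N)%N].
Proof.
elim: us => [|u us [N IH]]; first by exists 0%N.
have [p [q [q0 uE]]] := fracP u.
exists (maxn N (maxn (msize p) (msize q))) => u'; rewrite inE => /orP[/eqP ->|/IH].
  by exists p, q; rewrite !leq_max !leqnn !orbT.
move=> [p' [q' [q'0 u'E /andP[pN qN]]]]; exists p', q'; split=> //.
by rewrite !leq_max pN qN.
Qed.

(** Choose for each g <> 1 an element e_g algebraic over K(t) that g moves.  For N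
    large the Kronecker substitution kills none of the finitely many numerators
    and denominators of t and of the conjugates of the e_g, so the G-stable field
    containing them embeds in K(x).  By Lueroth's theorem it is generated by one
    element, on which G acts by Moebius transformations; the action is faithful
    because of the e_g. *)
Theorem mobius_model (gT : finGroupType) (G : {group gT}) (act : gT -> {rmorphism L -> L}) (t : L) :
  (forall x, act 1%g x = x) ->
  (forall g h x, g \in G -> h \in G -> act (g * h)%g x = act g (act h x)) ->
  (forall g c, act g (iC c) = iC c) ->
  transc iC t -> (forall g, g \in G -> act g t = t) ->
  (forall g, g \in G -> g != 1%g -> exists2 e, alg_over iC t e & act g e != e) ->
  mobius_action K G.
Proof.
move=> act1 actM actC tt act_t moved.
have e_ex g : exists e : L, alg_over iC t e /\ (g \in G -> g != 1%g -> act g e != e).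
  case: (boolP ((g \in G) && (g != 1%g))) => [/andP[gG g1]|].
    by have [e ea ge] := moved g gG g1; exists e.
  rewrite negb_and => ng; exists (iC 0); split; first exact: alg_overC.
  by move=> gG g1; rewrite gG g1 in ng.
pose e g := sval (constructive_indefinite_description _ (e_ex g)).
have eP g : alg_over iC t (e g) /\ (g \in G -> g != 1%g -> act g (e g) != e g).
  exact: svalP (constructive_indefinite_description _ (e_ex g)).
have [N NP] := common_msize (t :: [seq act g (e h) | g <- enum G, h <- enum G]).
pose chi : {rmorphism {mpoly K[m]} -> {fraction {poly K}}} := @FracField.tofrac {poly K} \o kronecker K m N.
have chi_neq0 p : (msize p <= N)%N -> p != 0 -> chi p != 0.
  by move=> pN p0; rewrite /chi /= tofrac_eq0; apply: kronecker_neq0.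
pose pl := place (@FracField.tofrac {mpoly K[m]}) chi.
have plP u : u \in t :: [seq act g (e h) | g <- enum G, h <- enum G] -> exists w, pl u w.
  move=> /NP [p [q [q0 uE /andP[pN qN]]]]; exists (chi p / chi q), p, q.
  by split=> //; apply: chi_neq0.
have iCE c : iC c = tofrac c%:MP by [].
have fCE c : fracC K c = chi c%:MP by rewrite /chi /= kroneckerC.
have [p [q [q0 tE /andP[pN qN]]]] := NP t (mem_head _ _).
have plt : pl t (chi p / chi q) by exists p, q; split=> //; apply: chi_neq0.
have wtt : transc (fracC K) (chi p / chi q).
  move=> /frac_alg_closed [c cE].
  have e1 : chi (p - c *: q) = 0.
    rewrite rmorphB -mul_mpolyC rmorphM -fCE -cE divfK ?subrr //.
    exact: chi_neq0.
  have r0 : p - c *: q = 0.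
    apply/eqP/negPn/negP => r0; have := chi_neq0 _ _ r0; rewrite e1 eqxx.
    move=> h; have /h // : (msize (p - c *: q)%R <= N)%N.
    apply: leq_trans (msizeD_le _ _) _; rewrite msizeN geq_max pN.
    exact: leq_trans (msizeZ_le _ _) qN.
  apply: tt; rewrite tE; have -> : p = c *: q by apply/eqP; rewrite -subr_eq0 r0.
  rewrite -mul_mpolyC rmorphM mulfK ?tofrac_eq0 //.
  exact: (algebraic_id iC c).
have [F [v [kap [psi [s [vk psik vs vsurj]]]]]] :=
  subfield_model (@tofrac_inj _) iCE fCE act1 actM actC tt plt wtt.
have inF u : (forall g, g \in G -> act g u \in t :: [seq act g (e h) | g <- enum G, h <- enum G]) ->
    alg_over iC t u -> exists y, v y = u.
  move=> hu ua; apply: vsurj; apply/model_predP => g gG; split; first exact/plP/hu.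
  by rewrite -(act_t g gG); apply: alg_over_map ua => c; apply: actC.
have [y0 y0E] : exists y, v y = t.
  by apply: inF => [g gG|]; rewrite ?act_t ?mem_head //; apply: alg_over_id.
have cy0 : ~ const kap y0.
  by case=> c yc; apply: tt; rewrite -y0E yc vk; apply: algebraic_id.
have [x [tx gx mob]] := luroth psik cy0.
have v_inj : injective v by apply: fmorph_inj.
have sM g h y : g \in G -> h \in G -> s (g * h)%g y = s g (s h y).
  by move=> gG hG; apply: v_inj; rewrite !vs ?groupM // actM.
have sC g c : g \in G -> s g (kap c) = kap c.
  by move=> gG; apply: v_inj; rewrite vs // vk actC.
have s1 y : s 1%g y = y by apply: v_inj; rewrite vs // act1.
exists F, kap, x, s; split=> [//| |g gG|g gG].
- by split=> [g h gG hG|g c gG]; [apply: sM|apply: sC].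
  move=> sx; case: (eqVneq g 1%g) => // g1.
  have [ea ge] := eP g; have /eqP[] := ge gG g1.
  have [z zE] : exists z, v z = e g.
    apply: inF ea => h hG; rewrite inE; apply/orP; right.
    by apply/allpairsP; exists (h, g); rewrite !mem_enum.
  rewrite -zE -vs //; congr (v _).
  have ev_s P : s g (ev kap x P) = ev kap x P.
    rewrite !evE -horner_map sx -map_poly_comp; congr (_.[_]).
    by apply: eq_map_poly => c; rewrite /= sC.
  by have [P [Q [Q0 ->]]] := gx z; rewrite fmorph_div !ev_s.
apply: mob => [c|y]; first exact: sC.
by exists (s g^-1%g y); rewrite -sM ?groupV // mulgV s1.
Qed.
End MobiusModel.

(** * Moebius transformations and two-by-two matrices *)

Section Mobius.
Variables (K F : fieldType) (kap : {rmorphism K -> F}) (x : F).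
Hypothesis tx : transc kap x.

Let X : 'cV[F]_2 := \col_i (if i == 0 then x else 1).

(** The Moebius transformation of matrix A, in homogeneous coordinates (x : 1). *)
Definition mobius (f : {rmorphism F -> F}) (A : 'M[K]_2) : Prop :=
  exists2 w, w != 0 & map_mx f X = w *: (map_mx kap A *m X).

Lemma mobius_of (f : {rmorphism F -> F}) a b c e w : w != 0 ->
  f x = w * (kap a * x + kap b) -> 1 = w * (kap c * x + kap e) ->
  exists A, mobius f A.
Proof.
move=> w0 e1 e2.
exists (\matrix_(i, k) (if i == 0 then (if k == 0 then a else b) else (if k == 0 then c else e))).
exists w => //; apply/colP => i; rewrite !mxE !big_ord_recl big_ord0 !mxE /= mulr1 addr0.
case: (unliftP 0 i) => [k|] -> /=; first by rewrite rmorph1 e2.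
exact: e1.
Qed.

(** Composition reverses the factors because [f] fixes the entries of the matrix of
    [g], so that the matrix of [f] acts on the inner coordinates. *)
Lemma mobius_comp (f g h : {rmorphism F -> F}) A B : (forall c, f (kap c) = kap c) ->
  h x = f (g x) -> mobius f A -> mobius g B -> mobius h (B *m A).
Proof.
move=> fC hx [w w0 fA] [w' w'0 gB]; exists (f w' * w); first by rewrite mulf_neq0 ?fmorph_eq0.
have -> : map_mx h X = map_mx f (map_mx g X).
  by apply/colP => i; rewrite !mxE; case: ifP => _; rewrite ?rmorph1.
rewrite gB map_mxZ map_mxM fA.
have -> : map_mx f (map_mx kap B) = map_mx kap B by apply/matrixP => i k; rewrite !mxE fC.
by rewrite -scalemxAr scalerA map_mxM mulmxA.
Qed.

Lemma transc_quad (a b c : K) : kap a * x ^+ 2 + kap b * x + kap c = 0 ->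
  [/\ a = 0, b = 0 & c = 0].
Proof.
move=> e; pose p := a *: 'X^2 + b *: 'X + c%:P.
have p0 : p = 0.
  apply: (transc_inj tx); rewrite rmorph0 -e evE !rmorphD /= !map_polyZ map_polyXn.
  by rewrite map_polyX map_polyC !hornerE.
split; [move/polyP/(_ 2): p0|move/polyP/(_ 1%N): p0|move/polyP/(_ 0%N): p0];
by rewrite !coefD !coefZ coefXn coefX coefC coef0 /= ?mulr0 ?mulr1 ?addr0 ?add0r.
Qed.

(** The equation x (c x + e) = a x + b is quadratic over K, and x transcendental. *)
Lemma mobius_id (f : {rmorphism F -> F}) A : f x = x -> mobius f A ->
  exists2 c, c != 0 & A = c%:M.
Proof.
move=> fx [w w0 fA].
have := congr1 (fun M : 'cV_2 => M 0 0) fA; have := congr1 (fun M : 'cV_2 => M 1 0) fA.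
rewrite !mxE !big_ord_recl !big_ord0 !mxE /= rmorph1 !mulr1 !addr0 fx.
have -> : lift 0 0 = 1 :> 'I_2 by apply/val_inj.
move=> e1 e0.
have e : kap (A 1 0) * x ^+ 2 + kap (A 1 1 - A 0 0) * x + kap (- A 0 1) = 0.
  have : w * (kap (A 1 0) * x ^+ 2 + kap (A 1 1 - A 0 0) * x + kap (- A 0 1)) = 0.
    transitivity (x * (w * (kap (A 1 0) * x + kap (A 1 1))) - w * (kap (A 0 0) * x + kap (A 0 1))).
      by rewrite rmorphB rmorphN; ring.
    by rewrite -e1 -e0 mulr1 subrr.
  by move/eqP; rewrite mulf_eq0 (negPf w0) => /eqP.
have [a10 /eqP a11 /eqP a01] := transc_quad e.
rewrite subr_eq0 in a11; rewrite oppr_eq0 in a01.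
exists (A 0 0).
  apply/eqP => a00; move: e1; rewrite a10 (eqP a11) a00 !rmorph0 mul0r addr0 mulr0 => /eqP.
  by rewrite oner_eq0.
apply/matrixP => i k; rewrite mxE.
case: (unliftP 0 i) => [i'|] ->; case: (unliftP 0 k) => [k'|] ->; rewrite ?ord1 /=.
- have -> : lift 0 0 = 1 :> 'I_2 by apply/val_inj.
  by rewrite (eqP a11).
- have -> : lift 0 0 = 1 :> 'I_2 by apply/val_inj.
  by rewrite a10.
- have -> : lift 0 0 = 1 :> 'I_2 by apply/val_inj.
  by rewrite (eqP a01).
- by rewrite mulr1n.
Qed.

Lemma mobius_scalar (f : {rmorphism F -> F}) c : mobius f c%:M -> f x = x.
Proof.
move=> [w w0 fA].
have := congr1 (fun M : 'cV_2 => M 0 0) fA; have := congr1 (fun M : 'cV_2 => M 1 0) fA.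
rewrite map_scalar_mx mul_scalar_mx !mxE /= rmorph1 mulr1 => e1 ->.
by rewrite mulrA -e1 mul1r.
Qed.
End Mobius.

Section TwoByTwo.
Variable K : fieldType.
Implicit Types A B : 'M[K]_2.

Lemma mx2P A B : A 0 0 = B 0 0 -> A 0 1 = B 0 1 -> A 1 0 = B 1 0 -> A 1 1 = B 1 1 -> A = B.
Proof.
move=> h00 h01 h10 h11; apply/matrixP => i k.
have l01 : lift 0 0 = 1 :> 'I_2 by apply/val_inj.
by case: (unliftP 0 i) => [i'|] ->; case: (unliftP 0 k) => [k'|] ->; rewrite ?ord1 ?l01.
Qed.

Lemma mulmx2 A B i k : (A *m B) i k = A i 0 * B 0 k + A i 1 * B 1 k.
Proof.
rewrite mxE !big_ord_recl big_ord0 addr0.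
by have -> : lift 0 0 = 1 :> 'I_2 by apply/val_inj.
Qed.

Definition scalar2 A := exists c, A = c%:M.

Lemma nonscalar2 A : ~ scalar2 A -> [|| A 0 1 != 0, A 1 0 != 0 | A 0 0 != A 1 1].
Proof.
move=> nA; apply: contra_notT nA; rewrite !negb_or !negbK => /and3P[/eqP a /eqP b /eqP c].
by exists (A 0 0); apply: mx2P; rewrite !mxE /= ?mulr1n ?mulr0n.
Qed.

(** A nonscalar two-by-two matrix has a cyclic vector, so its centralizer consists of
    the polynomials in it; here this is solved entry by entry. *)
Lemma commute2 A B : ~ scalar2 A -> A *m B = B *m A -> exists a b, B = a%:M + b *: A.
Proof.
move=> /nonscalar2 nA AB.
have e i k : A i 0 * B 0 k + A i 1 * B 1 k = B i 0 * A 0 k + B i 1 * A 1 k.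
  by rewrite -!mulmx2 AB.
have lin (u v l r d : K) : l = r -> u - v = (l - r) * d -> u = v.
  by move=> -> uv; apply/eqP; rewrite -subr_eq0 uv subrr mul0r.
case/or3P: nA => h.
- exists (B 0 0 - B 0 1 / A 0 1 * A 0 0), (B 0 1 / A 0 1).
  apply: mx2P; rewrite !mxE /= ?mulr1n ?mulr0n ?add0r.
  + by rewrite subrK.
  + by rewrite divfK.
  + by apply: (lin _ _ _ _ (A 0 1)^-1 (e 0 0)); field; exact: h.
  + by apply: (lin _ _ _ _ (A 0 1)^-1 (e 0 1)); field; exact: h.
- exists (B 0 0 - B 1 0 / A 1 0 * A 0 0), (B 1 0 / A 1 0).
  apply: mx2P; rewrite !mxE /= ?mulr1n ?mulr0n ?add0r.
  + by rewrite subrK.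
  + by apply: (lin _ _ _ _ (- (A 1 0)^-1) (e 0 0)); field; exact: h.
  + by rewrite divfK.
  + by apply: (lin _ _ _ _ (- (A 1 0)^-1) (e 1 0)); field; exact: h.
have h' : A 0 0 - A 1 1 != 0 by rewrite subr_eq0.
pose b := (B 0 0 - B 1 1) / (A 0 0 - A 1 1).
exists (B 0 0 - b * A 0 0), b.
apply: mx2P; rewrite !mxE /= ?mulr1n ?mulr0n ?add0r.
- by rewrite subrK.
- by rewrite /b; apply: (lin _ _ _ _ (A 0 0 - A 1 1)^-1 (e 0 1)); field; exact: h'.
- by rewrite /b; apply: (lin _ _ _ _ (- (A 0 0 - A 1 1)^-1) (e 1 0)); field; exact: h'.
- by rewrite /b; field; exact: h'.
Qed.

Lemma mul2_scalar A c : A *m c%:M = c%:M *m A.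
Proof. by rewrite mul_mx_scalar mul_scalar_mx. Qed.

(** With B = A ^ k, the matrix A commutes with B and so A = a + b B.  By the Frobenius
    endomorphism A ^ p = a ^ p + b ^ p B ^ p, a scalar. *)
Lemma scalar_pow_pchar A p k : p \in [pchar K] -> ~ scalar2 (A ^+ k) -> scalar2 (A ^+ (k * p)) ->
  scalar2 (A ^+ p).
Proof.
move=> pK nB [c Bp].
have pM : p \in [pchar 'M[K]_2].
  have /andP[pp /eqP p0] := pK; rewrite inE pp /=.
  by rewrite -(rmorph_nat (scalar_mx : {rmorphism K -> 'M[K]_2})) p0 raddf0.
have AB : A ^+ k *m A = A *m A ^+ k by rewrite -[LHS]exprSr -[RHS]exprS.
have [a [b AE]] := commute2 nB AB.
exists (a ^+ p + b ^+ p * c).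
have cm : GRing.comm (a%:M : 'M[K]_2) (b *: A ^+ k).
  exact/esym/mul2_scalar.
rewrite {1}AE -(pFrobenius_autE pM) pFrobenius_autD_comm // !pFrobenius_autE.
rewrite exprZn -exprM Bp scale_scalar_mx; apply: etrans (esym (raddfD scalar_mx _ _)).
congr (_ + _); exact: (esym (rmorphXn (scalar_mx : {rmorphism K -> 'M[K]_2}) p a)).
Qed.
End TwoByTwo.

Section Lucas.
Variable K : fieldType.

(** The Lucas sequence (u^k - v^k) / (u - v), for u + v = t and u v = d, defined
    without the roots u and v. *)
Fixpoint lucas (t d : K) (k : nat) : K :=
  if k is k1.+1 then (if k1 is k2.+1 then t * lucas t d k1 - d * lucas t d k2 else 1) else 0.

Lemma lucasE t d k : lucas t d k.+2 = t * lucas t d k.+1 - d * lucas t d k.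
Proof. by []. Qed.

Lemma lucas_roots (L : fieldType) (j : {rmorphism K -> L}) t d u v k :
  j t = u + v -> j d = u * v -> j (lucas t d k) * (u - v) = u ^+ k - v ^+ k.
Proof.
move=> tE dE.
suff : j (lucas t d k) * (u - v) = u ^+ k - v ^+ k /\
       j (lucas t d k.+1) * (u - v) = u ^+ k.+1 - v ^+ k.+1 by case.
elim: k => [|k [IH1 IH2]].
  by rewrite /= rmorph0 rmorph1 mul0r mul1r !expr0 !expr1 subrr.
split=> //; rewrite lucasE rmorphB !rmorphM mulrBl -!mulrA IH1 IH2 tE dE !exprS; ring.
Qed.

Lemma lucas_double (L : fieldType) (j : {rmorphism K -> L}) t d u k :
  j t = u + u -> j d = u * u -> j (lucas t d k.+1) = k.+1%:R * u ^+ k.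
Proof.
move=> tE dE.
suff : j (lucas t d k.+1) = k.+1%:R * u ^+ k /\
       j (lucas t d k.+2) = k.+2%:R * u ^+ k.+1 by case.
elim: k => [|k [IH1 IH2]].
  by rewrite lucasE /= rmorphB !rmorphM rmorph1 rmorph0 tE expr0 expr1 mulr0 subr0; split; ring.
split=> //; rewrite lucasE rmorphB !rmorphM IH1 IH2 tE dE !exprS -!natr1; ring.
Qed.

Definition tr2 (A : 'M[K]_2) := A 0 0 + A 1 1.
Definition det2 (A : 'M[K]_2) := A 0 0 * A 1 1 - A 0 1 * A 1 0.

Lemma cayley2 (A : 'M[K]_2) : A *m A = tr2 A *: A - (det2 A)%:M.
Proof.
by apply: mx2P; rewrite mulmx2 !mxE /= ?mulr1n ?mulr0n /tr2 /det2; ring.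
Qed.

Lemma mx2_exp (A : 'M[K]_2) k :
  A ^+ k.+1 = lucas (tr2 A) (det2 A) k.+1 *: A - (det2 A * lucas (tr2 A) (det2 A) k)%:M.
Proof.
elim: k => [|k IH]; first by rewrite expr1 /= scale1r mulr0 raddf0 subr0.
rewrite exprS IH lucasE -[LHS]/(A *m _) mulmxBr mul_mx_scalar -scalemxAr cayley2.
by apply: mx2P; rewrite !mxE /= ?mulr1n ?mulr0n; ring.
Qed.

Lemma mx2_exp_scalar (A : 'M[K]_2) k : ~ scalar2 A ->
  scalar2 (A ^+ k) <-> lucas (tr2 A) (det2 A) k = 0.
Proof.
move=> nA; case: k => [|k]; first by split=> // _; exists 1.
rewrite mx2_exp; split=> [[c e]|->].
  apply/eqP/negPn/negP => l0; apply: nA.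
  exists ((lucas (tr2 A) (det2 A) k.+1)^-1 * (c + det2 A * lucas (tr2 A) (det2 A) k)).
  apply: (scalerI l0); rewrite scale_scalar_mx mulVKf // raddfD /=.
  by rewrite -e subrK.
by exists (- (det2 A * lucas (tr2 A) (det2 A) k)); rewrite scale0r sub0r raddfN.
Qed.

Lemma det2_unit (A : 'M[K]_2) : ~ scalar2 A -> A \is a GRing.unit -> det2 A != 0.
Proof.
move=> nA uA; apply/eqP => d0; apply: nA; exists (tr2 A).
apply: (mulrI uA); rewrite -[LHS]/(A *m A) cayley2 d0 raddf0 subr0.
by rewrite -[RHS]/(A *m _) mul_mx_scalar.
Qed.

(** Let u and v be the eigenvalues of A.  Then A ^ k is scalar when u^k = v^k, so u/v is
    a primitive n-th root of unity; u = v is excluded because A ^ n would not be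
    scalar for n invertible in K.  The sum of u/v and v/u is tr(A)^2 / det(A) - 2. *)
Lemma zeta_sum_of_matrix (Kbar : closedFieldType) (j : {rmorphism K -> Kbar}) n (A : 'M[K]_2) :
  (0 < n)%N -> (n%:R != 0 :> K) -> A ^+ n \is a GRing.unit ->
  (forall k, scalar2 (A ^+ k) <-> n %| k)%N -> zeta_sum_in j n.
Proof.
move=> n0 nK uAn hA; have uA : A \is a GRing.unit by rewrite -(unitrX_pos _ n0).
case: (excluded_middle_informative (scalar2 A)) => [sA|nA].
  have n1 : n = 1%N by apply/eqP; rewrite -dvdn1; apply/hA; rewrite expr1.
  exists 1; last by exists 2; rewrite invr1 rmorph_nat.
  rewrite n1; have [//|m pm] := prim_order_exists (n := 1) (z := 1 : Kbar) _ (expr1n _ _).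
  by rewrite dvdn1 => /eqP m1; rewrite m1 in pm.
have d0 := det2_unit nA uA.
pose t := tr2 A; pose d := det2 A.
have [u uE] := solve_monicpoly (fun i : nat => if i == 0%N then - j d else j t) (isT : (0 < 2)%N).
rewrite !big_ord_recl big_ord0 /= expr0 mulr1 expr1 addr0 in uE.
pose v := j t - u.
have tE : j t = u + v by rewrite /v addrC subrK.
have dE : j d = u * v by rewrite /v mulrBr -expr2 uE; ring.
have jd0 : j d != 0 by rewrite fmorph_eq0.
have [u0 v0] : u != 0 /\ v != 0 by move: jd0; rewrite dE mulf_eq0 negb_or => /andP.
have ln : lucas t d n = 0 by apply/(mx2_exp_scalar n nA)/hA.
have uv : u - v != 0.
  apply/eqP => /eqP; rewrite subr_eq0 => /eqP uv.
  move: n0 nK ln; case: (n) => // n' _ nK ln.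
  have := lucas_double (j := j) (t := t) (d := d) (u := u) n'.
  rewrite ln rmorph0 tE dE -uv => /(_ erefl erefl)/esym/eqP.
  by rewrite mulf_eq0 expf_eq0 (negPf u0) andbF orbF -(rmorph_nat j) fmorph_eq0 (negPf nK).
have zP k : ((u / v) ^+ k == 1) = (n %| k)%N.
  rewrite expr_div_n -(inj_eq (mulIf (expf_neq0 k v0))) mul1r divfK ?expf_neq0 //.
  rewrite -subr_eq0 -(lucas_roots k tE dE) mulf_eq0 (negPf uv) orbF fmorph_eq0.
  by apply/eqP/idP => [/(mx2_exp_scalar k nA)/hA|/hA/(mx2_exp_scalar k nA)].
exists (u / v).
  have [|m pm mn] := prim_order_exists (z := u / v) n0; first by apply/eqP; rewrite zP.
  suff -> : n = m by [].
  by apply/eqP; rewrite eqn_dvd mn andbT -zP (prim_expr_order pm).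
exists ((t ^+ 2 - 2 * d) / d).
rewrite fmorph_div rmorphB rmorphXn rmorphM rmorph_nat /= tE dE; field.
by rewrite u0 v0.
Qed.

End Lucas.

(** * Groups of Moebius transformations *)

(** Two commuting involutions satisfy B = a + b A, with b = 1 as B is not scalar.  If
    a = 0 then B A = 1; if a = 1 then B = 1 + A has square 1 + 1 = 0.  This is the
    reason why four elements are needed in K. *)
Lemma no_klein_F2 (K : fieldType) (A B : 'M[K]_2) : (forall c : K, c = 0 \/ c = 1) ->
  A *m A = 1%:M -> B *m B = 1%:M -> (B *m A) *m (B *m A) = 1%:M ->
  ~ scalar2 A -> ~ scalar2 B -> ~ scalar2 (B *m A) -> False.
Proof.
move=> K01 AA BB BABA nA nB nBA.
have K2 : (1 + 1 : K) = 0.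
  by case: (K01 (1 + 1)) => // /eqP; rewrite addrC -subr_eq0 addrK oner_eq0.
have AB : A *m B = B *m A.
  have e : B *m A *m (A *m B) = 1%:M by rewrite mulmxA -[B *m A *m A]mulmxA AA mulmx1.
  by rewrite -[LHS]mul1mx -BABA -[LHS]mulmxA e mulmx1.
have [a [b BE]] := commute2 nA AB.
have b1 : b = 1.
  by case: (K01 b) => // b0; case: nB; exists a; rewrite BE b0 scale0r addr0.
rewrite b1 scale1r in BE; case: (K01 a) => a01.
  by apply: nBA; exists 1; rewrite BE a01 raddf0 add0r.
have z : 1%:M + 1%:M = 0 :> 'M[K]_2 by rewrite -raddfD K2 raddf0.
have zA : A + A = 0 by rewrite -[A]mulmx1 -mulmxDr z mulmx0.
move: BB; rewrite BE a01 mulmxDl mul1mx mulmxDr mulmx1 AA.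
rewrite -addrA [A + (A + _)]addrA zA add0r z => /matrixP/(_ 0 0)/eqP.
by rewrite !mxE eq_sym oner_eq0.
Qed.

Section MobiusAction.
Variables (K : fieldType) (gT : finGroupType) (G : {group gT}).
Hypothesis act : mobius_action K G.

(** The matrices form a faithful projective representation; they are only related to
    [G] by the predicate [mobius], as they are determined up to scalars. *)
Lemma mobius_action_mx : exists (F : fieldType) (kap : {rmorphism K -> F}) (x : F) (s : gT -> {rmorphism F -> F}),
  transc kap x /\ (forall g, g \in G -> exists A, mobius kap x (s g) A) /\
  (forall g h A B, g \in G -> h \in G -> mobius kap x (s g) A -> mobius kap x (s h) B ->
     mobius kap x (s (g * h)%g) (B *m A)) /\
  (forall g A, g \in G -> mobius kap x (s g) A ->
     (scalar2 A <-> g = 1%g) /\ (g = 1%g -> exists2 c, c != 0 & A = c%:M)).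
Proof.
case: act => F [kap [x [s [tx [sM sC] faith mob]]]].
exists F, kap, x, s; split=> //; split.
  move=> g gG; have [a [b [c [e [w w0 [e1 e2]]]]]] := mob g gG.
  exact: mobius_of w0 e1 e2.
split.
  move=> g h A B gG hG gA hB.
  apply: (mobius_comp _ _ gA hB); last exact: sM.
  by move=> c; apply: sC.
have s1 : s 1%g x = x.
  by apply: (fmorph_inj (s 1%g)); rewrite -sM // mulg1.
move=> g A gG gA; split; [split|].
- by move=> [c AE]; apply: faith => //; rewrite AE in gA; apply: mobius_scalar gA.
- move=> g1; rewrite g1 in gA; have [c _ ->] := mobius_id tx s1 gA.
  by exists c.
- by move=> g1; rewrite g1 in gA; exact: (mobius_id tx s1 gA).
Qed.

Lemma mobius_order g : g \in G -> exists A : 'M[K]_2,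
  (forall k, scalar2 (A ^+ k) <-> #[g]%g %| k)%N /\ A ^+ #[g]%g \is a GRing.unit.
Proof.
move=> gG; have [F [kap [x [s [tx [mob [comp faith]]]]]]] := mobius_action_mx.
have [A gA] := mob g gG; exists A.
have pA k : mobius kap x (s (g ^+ k.+1)%g) (A ^+ k.+1).
  elim: k => [|k IH]; first by rewrite expr1 expg1.
  by rewrite expgS exprSr; apply: comp => //; apply: groupX.
have hk k : scalar2 (A ^+ k.+1) <-> (#[g]%g %| k.+1)%N.
  rewrite order_dvdn.
  have [h _] := faith _ _ (groupX k.+1 gG) (pA k).
  by split=> [/h ->|/eqP/h].
split.
  by case=> [|k]; [split=> _; [apply: dvdn0|exists 1; rewrite expr0]|apply: hk].
have := order_gt0 g; case E : #[g]%g => [//|k] _.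
have [_ h] := faith _ _ (groupX k.+1 gG) (pA k).
have [|c c0 ->] := h; first by rewrite -E expg_order.
by rewrite [_ \in _]unitmxE det_scalar unitfE expf_neq0.
Qed.

Lemma mobius_action_zeta (Kbar : closedFieldType) (j : {rmorphism K -> Kbar}) g :
  g \in G -> char_ndvd K #[g]%g -> zeta_sum_in j #[g]%g.
Proof.
move=> gG ch; have [A [hA uA]] := mobius_order gG.
apply: zeta_sum_of_matrix uA hA => //.
apply/negP => n0; have [p pK] := natf0_pchar (order_gt0 g) n0.
by have := ch p pK; rewrite (dvdn_pcharf pK) n0.
Qed.

Lemma mobius_action_pchar g p : g \in G -> p \in [pchar K] -> (p %| #[g]%g)%N -> #[g]%g = p.
Proof.
move=> gG pK pg; have [A [hA _]] := mobius_order gG.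
have pp : prime p by apply: pcharf_prime pK.
have gp : (0 < #[g]%g)%N by apply: order_gt0.
have [k gE] := dvdnP pg.
have k0 : (0 < k)%N by move: gp; rewrite gE; case: (k).
have nk : ~ scalar2 (A ^+ k).
  move/hA => /(dvdn_leq k0); rewrite gE leqNgt => /negP; apply.
  by rewrite -[X in (X < _)%N]muln1 ltn_pmul2l // prime_gt1.
have sk : scalar2 (A ^+ (k * p)) by apply/hA; rewrite -gE.
have /hA := scalar_pow_pchar pK nk sk.
by move=> gp'; apply/eqP; rewrite eqn_dvd gp' pg.
Qed.

Lemma mobius_action_klein g h : (forall c : K, c = 0 \/ c = 1) -> g \in G -> h \in G ->
  (g * g = 1)%g -> (h * h = 1)%g -> (g * h * (g * h) = 1)%g ->
  g != 1%g -> h != 1%g -> (g * h != 1)%g -> False.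
Proof.
move=> K01 gG hG gg hh ghgh g1 h1 gh1.
have [F [kap [x [s [tx [mob [comp faith]]]]]]] := mobius_action_mx.
have [A gA] := mob g gG; have [B hB] := mob h hG.
have ghG : (g * h)%g \in G by rewrite groupM.
have BA := comp _ _ _ _ gG hG gA hB.
have sq k M : k \in G -> mobius kap x (s k) M -> (k * k = 1)%g -> M *m M = 1%:M.
  move=> kG kM kk; have [_ h2] := faith _ _ (groupM kG kG) (comp _ _ _ _ kG kG kM kM).
  by have [c c0 ->] := h2 kk; case: (K01 c) c0 => ->; rewrite ?eqxx.
have ns k M : k \in G -> mobius kap x (s k) M -> k != 1%g -> ~ scalar2 M.
  by move=> kG kM k1 /(faith _ _ kG kM).1 e; rewrite e eqxx in k1.
exact: (no_klein_F2 K01 (sq _ _ gG gA gg) (sq _ _ hG hB hh) (sq _ _ ghG BA ghgh)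
  (ns _ _ gG gA g1) (ns _ _ hG hB h1) (ns _ _ ghG BA gh1)).
Qed.
End MobiusAction.

(** * Artin's theorem by interpolation *)

Section Artin.
Variables (K L : fieldType) (iota : {rmorphism K -> L}).
Variables (gT : finGroupType) (G : {group gT}) (act : gT -> {rmorphism L -> L}).
Hypothesis act1 : forall x, act 1%g x = x.
Hypothesis actM : forall g h x, g \in G -> h \in G -> act (g * h)%g x = act g (act h x).
Hypothesis actC : forall g c, g \in G -> act g (iota c) = iota c.
Hypothesis Kcl : forall x, algebraicOver iota x -> exists c, x = iota c.
Variable (L0 : {pred L}).
Hypothesis L0P : forall x, x \in L0 <-> forall g, g \in G -> act g x = x.

Definition free_orbit z := forall g, g \in G -> g != 1%g -> act g z != z.

Lemma free_orbit_inj z : free_orbit z -> {in G &, injective (fun g => act g z)}.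
Proof.
move=> fz g h gG hG e; apply/eqP; rewrite eq_mulVg1; apply/negPn/negP => n1.
have /eqP[] := fz (g^-1 * h)%g (groupM (groupVr gG) hG) n1.
by rewrite actM ?groupV // -e -actM ?groupV // mulVg act1.
Qed.

Lemma orbit_poly_eq0 z (P : {poly L}) : free_orbit z -> (size P <= #|G|)%N ->
  (forall g, g \in G -> P.[act g z] = 0) -> P = 0.
Proof.
move=> fz sP Pz; apply/eqP/negPn/negP => P0.
have : (size [seq act g z | g <- enum G] < size P)%N.
  apply: max_poly_roots => //.
    by apply/allP => _ /mapP[g gG ->]; apply/rootP/Pz; rewrite mem_enum in gG.
  rewrite map_inj_in_uniq ?enum_uniq // => g h; rewrite !mem_enum.
  exact: free_orbit_inj.
by rewrite size_map -cardE ltnNge sP.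
Qed.

Definition orbit_but z g : {poly L} :=
  \prod_(a <- [seq act h z | h <- enum (G :\ g)]) ('X - a%:P).

(** The interpolation polynomial of the function g z |-> g x on the orbit of z. *)
Definition lagrange z (x : L) : {poly L} :=
  \sum_(g in G) (act g x / (orbit_but z g).[act g z]) *: orbit_but z g.

Lemma orbit_butE z g h : free_orbit z -> g \in G -> h \in G ->
  ((orbit_but z g).[act h z] == 0) = (h != g).
Proof.
move=> fz gG hG; rewrite -[_ == 0]/(root _ _) root_prod_XsubC.
apply/mapP/idP => [[k]|hg].
  rewrite mem_enum !inE => /andP[kg kG] /(free_orbit_inj fz hG kG) -> //.
by exists h => //; rewrite mem_enum !inE hg.
Qed.

Lemma lagrangeE z x g : free_orbit z -> g \in G -> (lagrange z x).[act g z] = act g x.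
Proof.
move=> fz gG; rewrite horner_sum (bigD1 g) //= big1 ?addr0 => [|h /andP[hG hg]].
  by rewrite hornerZ divfK // orbit_butE // eqxx.
have /eqP e : (orbit_but z h).[act g z] == 0 by rewrite orbit_butE // eq_sym.
by rewrite hornerZ e mulr0.
Qed.

Lemma size_lagrange z x : (size (lagrange z x) <= #|G|)%N.
Proof.
apply: leq_trans (size_sum _ _ _) _; apply/bigmax_leqP => g gG.
apply: leq_trans (size_scale_leq _ _) _.
by rewrite size_prod_XsubC size_map -cardE [X in (_ <= X)%N](cardsD1 g G) gG.
Qed.

(** Applying h permutes the interpolation conditions, and the polynomial of degree
    less than |G| that meets them is unique. *)
Lemma lagrange_fixed z x i : free_orbit z -> (lagrange z x)`_i \in L0.
Proof.
move=> fz; apply/L0P => h hG.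
have e : map_poly (act h) (lagrange z x) - lagrange z x = 0.
  apply: (orbit_poly_eq0 fz) => [|g gG].
    apply: leq_trans (size_polyD _ _) _; rewrite size_polyN geq_max size_map_poly.
    by rewrite size_lagrange.
  rewrite hornerD hornerN lagrangeE //.
  have -> : act g z = act h (act (h^-1 * g)%g z) by rewrite -actM ?groupM ?groupV // mulKVg.
  rewrite horner_map lagrangeE ?groupM ?groupV // -actM ?groupM ?groupV //.
  by rewrite mulKVg subrr.
by move/polyP/(_ i)/eqP: e; rewrite coefB coef_map coef0 subr_eq0 => /eqP.
Qed.

Section Stable.
Variable (E : {pred L}) (hE : divring_closed E).
Hypothesis E_act : forall g x, g \in G -> x \in E -> act g x \in E.

Let E' := subfield_pred E.
HB.instance Definition _ := GRing.isDivringClosed.Build L E' hE.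

Lemma lagrange_over z x i : z \in E -> x \in E -> (lagrange z x)`_i \in E.
Proof.
move=> zE xE; suff /polyOverP : lagrange z x \is a polyOver E' by apply.
have ob g : orbit_but z g \is a polyOver E'.
  rewrite /orbit_but big_map big_enum_cond /=; apply: rpred_prod => h /andP[]; rewrite !inE => /andP[_ hG] _.
  by rewrite rpredB ?polyOverX // polyOverC; apply: E_act.
apply: rpred_sum => g gG; apply: polyOverZ; last exact: ob.
by rewrite rpred_div //; [exact: E_act|apply: rpred_horner => //; apply: E_act].
Qed.

(** The first |G| powers of z form a basis of E over its invariants and also of L over
    [L0]: the coordinates of x are the coefficients of its interpolation polynomial,
    and independence is uniqueness of interpolation. *)
Lemma artin_defined_over z : free_orbit z -> z \in E -> (forall c, iota c \in E) ->
  defined_over iota L0 [pred x | (x \in E) && (x \in L0)].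
Proof.
move=> fz zE KE.
have L0_div : divring_closed L0.
  split; first by apply/L0P => g gG; rewrite rmorph1.
    by move=> x y /L0P hx /L0P hy; apply/L0P => g gG; rewrite rmorphB hx ?hy.
  by move=> x y /L0P hx /L0P hy; apply/L0P => g gG; rewrite fmorph_div hx ?hy.
have [E1 EB Ediv] := hE; have [L01 L0B L0div] := L0_div.
have span x : x = \sum_(i < #|G|) (lagrange z x)`_i * z ^+ i.
  have := lagrangeE x fz (group1 G); rewrite !act1 => {1}<-.
  by apply: horner_coef_wide; apply: size_lagrange.
have indep (c : 'I_#|G| -> L) : (forall i, c i \in L0) ->
    \sum_(i < #|G|) c i * z ^+ i = 0 -> forall i, c i = 0.
  move=> cL0 cz i.
  pose P : {poly L} := \poly_(k < #|G|) (if insub k is Some k' then c k' else 0).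
  have cP (k : 'I_#|G|) : P`_k = c k by rewrite coef_poly ltn_ord valK.
  have P0 : P = 0.
    apply: (orbit_poly_eq0 fz); first exact: size_poly.
    move=> g gG; rewrite (@horner_coef_wide _ #|G|) ?size_poly //.
    transitivity (act g 0); last by rewrite rmorph0.
    rewrite -[in RHS]cz rmorph_sum; apply: eq_bigr => k _.
    by rewrite cP rmorphM rmorphXn; have /L0P -> := cL0 k.
  by rewrite -cP P0 coef0.
have zX i : z ^+ i \in E by exact: (rpredX i (zE : z \in E')).
split.
  split=> [|c|x]; last by rewrite inE => /andP[].
    split; rewrite ?inE ?E1 ?L01 // => x y; rewrite !inE => /andP[xE xL] /andP[yE yL].
      by rewrite EB ?L0B.
    by rewrite Ediv ?L0div.
  by rewrite inE KE; apply/L0P => g gG; rewrite actC.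
exists E; split=> //.
- by move=> x; rewrite inE => /andP[].
- exists #|G|; split; exists (fun i => z ^+ i); split.
  + by move=> i; apply: zX.
  + by move=> c cE; apply: indep => i; have := cE i; rewrite inE => /andP[].
  + move=> x xE; exists (fun i => (lagrange z x)`_i); last exact: span.
    by move=> i; rewrite inE lagrange_over // lagrange_fixed.
  + by [].
  + exact: indep.
  + by move=> x _; exists (fun i => (lagrange z x)`_i); [move=> i; apply: lagrange_fixed|exact: span].
move=> F hF EF L0F x.
have [F1 FB Fdiv] := hF.
pose F' := subfield_pred F.
pose SF : divringClosed L := HB.pack F (GRing.isDivringClosed.Build L F hF).
suff : x \in SF by [].
rewrite (span x); apply: rpred_sum => i _; apply: rpredM.
  by apply: L0F; apply: lagrange_fixed.
by apply: EF.
Qed.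
End Stable.
End Artin.

(** * Fields of definition from a plane representation *)

Section SimpleExtension.
Variables (K L : fieldType) (iota : {rmorphism K -> L}) (z : L).

Definition simple_ext : {pred L} := [pred x | asb (exists P Q : {poly K},
  ev iota z Q != 0 /\ x = ev iota z P / ev iota z Q)].

Lemma simple_extP x : x \in simple_ext <-> exists P Q : {poly K},
  ev iota z Q != 0 /\ x = ev iota z P / ev iota z Q.
Proof. by split=> [/asbP|h]; last exact/asbP. Qed.

Lemma simple_ext_ev P : ev iota z P \in simple_ext.
Proof. by apply/simple_extP; exists P, 1; rewrite rmorph1 oner_neq0 divr1. Qed.

Lemma simple_extC c : iota c \in simple_ext.
Proof. by rewrite -(evC iota z); apply: simple_ext_ev. Qed.

Lemma simple_ext_id : z \in simple_ext.
Proof. by rewrite -{1}(evX iota z); apply: simple_ext_ev. Qed.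

Lemma simple_ext_div : divring_closed simple_ext.
Proof.
split; first by rewrite -(rmorph1 iota); apply: simple_extC.
- move=> x y /simple_extP [P [Q [Q0 ->]]] /simple_extP [R [S [S0 ->]]].
  apply/simple_extP; exists (P * S - R * Q), (Q * S).
  rewrite rmorphM mulf_neq0 //; split=> //.
  by rewrite rmorphB !rmorphM; field; rewrite Q0 S0.
- move=> x y /simple_extP [P [Q [Q0 ->]]] /simple_extP [R [S [S0 ->]]].
  apply/simple_extP; have [->|R0] := eqVneq (ev iota z R) 0.
    by exists 0, 1; rewrite rmorph1 oner_neq0 rmorph0 !mul0r invr0 mulr0.
  exists (P * S), (Q * R); rewrite !rmorphM mulf_neq0 //; split=> //.
  by field; rewrite Q0 R0 S0.
Qed.

(** If a = P(z)/Q(z) is transcendental, then z is algebraic over K(a) as a root of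
    a Q - P, and so is all of K(z). *)
Lemma simple_ext_dependent a b : a \in simple_ext -> b \in simple_ext -> alg_over iota a b.
Proof.
move=> /simple_extP [P [Q [Q0 aE]]] /simple_extP [R [S [S0 ->]]].
case: (excluded_middle_informative (algebraicOver iota a)) => [[f f0 fa]|ta].
  exists f%:P; first by rewrite polyC_eq0.
  by rewrite map_polyC hornerC; apply/eqP.
have az : alg_over iota a z.
  pose H : {poly {poly K}} := 'X%:P * map_poly polyC Q - map_poly polyC P.
  exists H.
    apply/eqP => H0; move: Q0; have -> : Q = 0; last by rewrite rmorph0 eqxx.
    apply/polyP => i; move/polyP/(_ i)/polyP/(_ 1%N): H0.
    rewrite coefB coefCM !(coef_map polyC) !coef0 coefB coefXM coefC /= coefC /=.
    by rewrite subr0.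
  have hP (r : {poly K}) : map_poly (ev iota a) (map_poly polyC r) = map_poly iota r.
    by rewrite -map_poly_comp; apply: eq_map_poly => c; apply: evC.
  have HE (g : {rmorphism {poly K} -> L}) u v w : map_poly g (u%:P * v - w) =
      (g u)%:P * map_poly g v - map_poly g w.
    by rewrite rmorphB rmorphM /= map_polyC.
  rewrite HE !hP evX hornerD hornerN hornerM hornerC -!evE aE divfK ?subrr //.
have aev r : alg_over iota a (ev iota z r).
  elim/poly_ind: r => [|r c IH]; first by rewrite rmorph0 -(rmorph0 iota); apply: alg_overC.
  rewrite rmorphD [ev iota z (r * 'X)]rmorphM evC evX.
  by apply: alg_overD => //; [apply: alg_overM|apply: alg_overC].
by apply: alg_overM => //; apply: alg_overV.
Qed.
End SimpleExtension.

Section Upper.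
Variables (K L : fieldType) (iota : {rmorphism K -> L}).
Variables (gT : finGroupType) (G : {group gT}) (act : gT -> {rmorphism L -> L}).
Hypothesis act1 : forall x, act 1%g x = x.
Hypothesis actM : forall g h x, g \in G -> h \in G -> act (g * h)%g x = act g (act h x).
Hypothesis actC : forall g c, g \in G -> act g (iota c) = iota c.
Hypothesis Kcl : forall x, algebraicOver iota x -> exists c, x = iota c.
Variable (L0 : {pred L}).
Hypothesis L0P : forall x, x \in L0 <-> forall g, g \in G -> act g x = x.
Hypothesis faithful : forall g, g \in G -> g != 1%g -> exists x, act g x != x.
Variable g1 : gT.
Hypotheses (g1G : g1 \in G) (g1n : g1 != 1%g).

Lemma moved_transc g x : g \in G -> act g x != x -> transc iota x.
Proof. by move=> gG gx /Kcl [c xE]; move: gx; rewrite xE actC ?eqxx. Qed.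

(** Were all fixed elements algebraic over K, an element moved by [G] would be algebraic
    too, as a root of the product of the X - g(x). *)
Lemma fixed_transc : exists2 f, f \in L0 & transc iota f.
Proof.
case: (excluded_middle_informative (exists2 f, f \in L0 & transc iota f)) => // nf.
have [x gx] := faithful g1G g1n; case: (moved_transc g1G gx).
pose P := \prod_(g in G) ('X - (act g x)%:P).
apply/integral_algebraic; apply: (integral_root (p := P)).
- by apply/prodf_neq0 => g _; rewrite polyXsubC_eq0.
- rewrite /root horner_prod prodf_seq_eq0; apply/hasP; exists 1%g; first by rewrite mem_index_enum.
  by rewrite group1 hornerXsubC act1 subrr eqxx.
apply/integral_poly => i; apply/integral_algebraic.
case: (excluded_middle_informative (algebraicOver iota P`_i)) => // nP.
case: nf; exists P`_i => //; apply/L0P => h hG.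
suff PE : map_poly (act h) P = P by rewrite -{2}PE coef_map.
rewrite /P rmorph_prod [RHS](reindex_inj (mulgI h)) /=; apply: eq_big => g.
  by rewrite groupMl.
by move=> gG; rewrite rmorphB /= map_polyX map_polyC /= actM.
Qed.

(** Fixed elements abound: the powers of a transcendental one are distinct, so one of
    them is not a root of P. *)
Lemma fixed_avoid (P : {poly L}) : P != 0 -> exists2 f, f \in L0 & P.[f] != 0.
Proof.
move=> P0; have [f fL0 ft] := fixed_transc.
have fX k : f ^+ k \in L0.
  by apply/L0P => g gG; rewrite rmorphXn; have /L0P -> := fL0.
case: (excluded_middle_informative (exists2 f, f \in L0 & P.[f] != 0)) => // nf.
have : (size (mkseq (fun k => (f ^+ k)%R) (size P)) < size P)%N.
  apply: max_poly_roots => //.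
    apply/allP => _ /mapP[k _ ->]; apply/rootP/eqP/negPn/negP => h.
    by apply: nf; exists (f ^+ k).
  apply: mkseq_uniq => i k e; apply/eqP/negPn/negP => ik.
  apply: ft; exists ('X^i - 'X^k).
    apply/eqP => /polyP/(_ i); rewrite coefB !coefXn eqxx (negPf ik) subr0 coef0.
    by move/eqP; rewrite oner_eq0.
  by rewrite /root rmorphB /= !map_polyXn hornerD hornerN !hornerXn e subrr.
by rewrite size_mkseq ltnn.
Qed.

(** For each g <> 1 take an element that g moves; a combination of these elements with
    generic fixed coefficients is moved by all of them.  The coefficients are taken
    to be the powers of one fixed element [f]. *)
Lemma free_orbit_exists : exists z, free_orbit G act z.
Proof.
have e_ex g : exists e : L, g \in G -> g != 1%g -> act g e != e.
  case: (boolP ((g \in G) && (g != 1%g))) => [/andP[gG gn]|].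
    by have [e ge] := faithful gG gn; exists e.
  by rewrite negb_and => ng; exists 0 => gG gn; rewrite gG gn in ng.
pose e g := sval (constructive_indefinite_description _ (e_ex g)).
have eP g : g \in G -> g != 1%g -> act g (e g) != e g.
  exact: svalP (constructive_indefinite_description _ (e_ex g)).
pose Z : {poly L} := \sum_(h : gT) e h *: 'X^(enum_rank h).
have ZE g : Z`_(enum_rank g) = e g.
  rewrite coef_sum (bigD1 g) //= coefZ coefXn eqxx mulr1 big1 ?addr0 // => h hg.
  rewrite coefZ coefXn; case: eqP => [/val_inj/enum_rank_inj gh|]; last by rewrite mulr0.
  by rewrite gh eqxx in hg.
pose D := \prod_(g in G | g != 1%g) (map_poly (act g) Z - Z).
have D0 : D != 0.
  apply/prodf_neq0 => g /andP[gG gn]; apply: contraNneq (eP g gG gn) => /polyP/(_ (enum_rank g)).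
  by rewrite coefB coef_map ZE coef0 => /eqP; rewrite subr_eq0.
have [f fL0] := fixed_avoid D0; rewrite horner_prod => /prodf_neq0 Df.
exists Z.[f] => g gG gn.
have := Df g; rewrite gG gn => /(_ isT); rewrite hornerD hornerN subr_eq0.
have /L0P /(_ g gG) ff := fL0.
by rewrite -{1}ff horner_map.
Qed.

Section Equivariant.
Variable rho : gT -> 'M[K]_2.
Hypothesis rhoM : forall g h, g \in G -> h \in G -> rho (g * h)%g = rho g *m rho h.
Hypothesis rho1 : rho 1%g = 1%:M.
Hypothesis rho_ns : forall g, g \in G -> g != 1%g -> ~ scalar2 (rho g).

Let rhoL g : 'M[L]_2 := map_mx iota (rho g).

Let rhoLM g h : g \in G -> h \in G -> rhoL (g * h)%g = rhoL g *m rhoL h.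
Proof. by move=> gG hG; rewrite /rhoL rhoM // map_mxM. Qed.

(** Averages of the vectors z^k e_l over [G], for the twisted action on L^2. *)
Definition eqv_row (z : L) (k : nat) (l : 'I_2) : 'rV[L]_2 :=
  \sum_(g in G) act g (z ^+ k) *: row l (rhoL g^-1%g).

Definition equivariant (r : 'rV[L]_2) := forall h, h \in G -> map_mx (act h) r = r *m rhoL h.

Lemma eqv_rowP z k l : equivariant (eqv_row z k l).
Proof.
move=> h hG; rewrite /eqv_row mulmx_suml raddf_sum /=.
rewrite [RHS](reindex_inj (mulgI h)) /=; apply: eq_big => g; first by rewrite groupMl.
move=> gG; rewrite map_mxZ actM // -scalemxAl; congr (_ *: _).
rewrite -row_mul -rhoLM ?groupV ?groupM // invMg mulgKV.
by apply/rowP => i; rewrite !mxE actC.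
Qed.

Lemma equivariant_comb r r' f : f \in L0 -> equivariant r -> equivariant r' ->
  equivariant (r + f *: r').
Proof.
move=> /L0P fL0 er er' h hG; rewrite map_mxD map_mxZ er // er' // fL0 //.
by rewrite mulmxDl -scalemxAl.
Qed.

Definition detr (r r' : 'rV[L]_2) := r 0 0 * r' 0 1 - r 0 1 * r' 0 0.

(** A column killed by all the averages is killed by sum_g P(g(z)) rho(g^-1) for every
    polynomial P; taking for P the polynomial that vanishes on the orbit of z except
    at z shows that it is zero.  So the averages span L^2. *)
Lemma eqv_independent : exists r r', [/\ equivariant r, equivariant r' & detr r r' != 0].
Proof.
have [z fz] := free_orbit_exists.
have rE (k : nat) l (y : 'cV[L]_2) : (eqv_row z k l *m y) 0 0 =
    \sum_(g in G) act g z ^+ k * (rhoL g^-1%g *m y) l 0.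
  rewrite /eqv_row mulmx_suml summxE; apply: eq_bigr => g _.
  by rewrite -scalemxAl mxE rmorphXn -row_mul mxE.
have key (y : 'cV[L]_2) : (forall k l, (eqv_row z k l *m y) 0 0 = 0) -> y = 0.
  move=> hy.
  have hP (P : {poly L}) l : \sum_(g in G) P.[act g z] * (rhoL g^-1%g *m y) l 0 = 0.
    under eq_bigr do rewrite horner_coef mulr_suml.
    rewrite exchange_big big1 //= => i _.
    under eq_bigr do rewrite -mulrA.
    by rewrite -mulr_sumr -rE hy mulr0.
  apply/colP => l; rewrite mxE; have := hP (orbit_but G act z 1%g) l.
  rewrite (bigD1 1%g) ?group1 //= big1 => [|g /andP[gG gn]].
    rewrite addr0 invg1 /rhoL rho1 map_mx1 mul1mx => /eqP.
    rewrite mulf_eq0; have := orbit_butE act1 actM fz (group1 G) (group1 G).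
    by rewrite eqxx => -> /= /eqP.
  have /eqP -> : (orbit_but G act z 1%g).[act g z] == 0 by rewrite (orbit_butE act1 actM).
  by rewrite mul0r.
have [k [l [i rk]]] : exists k l i, eqv_row z k l 0 i != 0.
  case: (excluded_middle_informative (exists k l i, eqv_row z k l 0 i != 0)) => // ne.
  have : (\col_i 1 : 'cV[L]_2) = 0.
    apply: key => k l; rewrite mxE big1 // => i _.
    by case: (eqVneq (eqv_row z k l 0 i) 0) => [->|h]; [rewrite mul0r|case: ne; exists k, l, i].
  by move/colP/(_ 0)/eqP; rewrite !mxE oner_eq0.
set r := eqv_row z k l in rk.
case: (excluded_middle_informative (exists k' l', detr r (eqv_row z k' l') != 0)) => [[k' [l' d]]|ne].
  by exists r, (eqv_row z k' l'); split=> //; apply: eqv_rowP.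
have y0 : (\col_i (if i == 0 then r 0 1 else - r 0 0) : 'cV[L]_2) = 0.
  apply: key => k' l'.
  have l01 : lift 0 0 = 1 :> 'I_2 by apply/val_inj.
  have : detr r (eqv_row z k' l') = 0.
    by apply/eqP/negPn/negP => h; apply: ne; exists k', l'.
  rewrite mxE !big_ord_recl big_ord0 !mxE l01 /= /detr => e.
  by apply/eqP; rewrite addr0 -oppr_eq0; apply/eqP; rewrite -e; ring.
case/negP: rk; have := congr1 (fun M : 'cV_2 => M 0 0) y0; have := congr1 (fun M : 'cV_2 => M 1 0) y0.
rewrite !mxE /= => /eqP; rewrite oppr_eq0 => /eqP r0 r1.
by case: (unliftP 0 i) => [i'|] ->; [rewrite ord1; have -> : lift 0 0 = 1 :> 'I_2 by apply/val_inj|]; apply/eqP.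
Qed.

Lemma row01 (r : 'rV[L]_2) (A : 'M[L]_2) :
  (r *m A) 0 0 = r 0 0 * A 0 0 + r 0 1 * A 1 0 /\
  (r *m A) 0 1 = r 0 0 * A 0 1 + r 0 1 * A 1 1.
Proof.
have l01 : lift 0 0 = 1 :> 'I_2 by apply/val_inj.
by rewrite !mxE !big_ord_recl !big_ord0 !addr0 l01.
Qed.

(** The ratio u0/u1 of the entries of an equivariant row u transforms by the Moebius
    transformation of rho(g), and it is fixed by g when the quadratic form
    u0 (u rho(g))_1 - u1 (u rho(g))_0 vanishes.  On the pencil u = r + f s this form is
    a quadratic polynomial in f, nonzero since rho(g) is not scalar; a fixed element f
    that is no root of these polynomials for g <> 1 makes the orbit free. *)
Lemma equivariant_point : exists z, free_orbit G act z /\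
  forall g, g \in G -> exists a b c e, iota c * z + iota e != 0 /\
    act g z = (iota a * z + iota b) / (iota c * z + iota e).
Proof.
have [r [s [er es d0]]] := eqv_independent.
set r0 := r 0 0; set r1 := r 0 1; set s0 := s 0 0; set s1 := s 0 1.
pose Q g (u v u' v' : L) := rhoL g 0 1 * u * u' + (rhoL g 1 1 - rhoL g 0 0) * u * v' - rhoL g 1 0 * v * v'.
pose D g : {poly L} := Q g s0 s1 s0 s1 *: 'X^2 +
  (Q g r0 r1 s0 s1 + Q g s0 s1 r0 r1) *: 'X + (Q g r0 r1 r0 r1)%:P.
pose del := r0 * s1 - r1 * s0.
have del0 : del != 0 by [].
have D0 g : g \in G -> g != 1%g -> D g != 0.
  move=> gG gn; apply/eqP => Dg0; case: (rho_ns gG gn).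
  have e0 : Q g r0 r1 r0 r1 = 0.
    by move/polyP/(_ 0%N): Dg0; rewrite !coefD !coefZ coefXn coefX coefC coef0 /= !mulr0 !add0r.
  have e1 : Q g r0 r1 s0 s1 + Q g s0 s1 r0 r1 = 0.
    by move/polyP/(_ 1%N): Dg0; rewrite !coefD !coefZ coefXn coefX coefC coef0 /= !mulr0 mulr1 add0r addr0.
  have e2 : Q g s0 s1 s0 s1 = 0.
    by move/polyP/(_ 2%N): Dg0; rewrite !coefD !coefZ coefXn coefX coefC coef0 /= !mulr0 mulr1 !addr0.
  (* the three coefficients are those of the form in the basis r, s: change basis back *)
  have dd : del ^+ 2 != 0 by rewrite expf_neq0.
  have b0 : rhoL g 0 1 = 0.
    apply: (mulfI dd); rewrite mulr0.
    transitivity (s1 ^+ 2 * Q g r0 r1 r0 r1 - s1 * r1 * (Q g r0 r1 s0 s1 + Q g s0 s1 r0 r1)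
      + r1 ^+ 2 * Q g s0 s1 s0 s1); first by rewrite /Q /del; ring.
    by rewrite e0 e1 e2 !mulr0 subr0 addr0.
  have c0 : rhoL g 1 0 = 0.
    apply: (mulfI dd); rewrite mulr0.
    transitivity (- (r0 ^+ 2 * Q g s0 s1 s0 s1 - r0 * s0 * (Q g r0 r1 s0 s1 + Q g s0 s1 r0 r1)
      + s0 ^+ 2 * Q g r0 r1 r0 r1)); first by rewrite /Q /del; ring.
    by rewrite e0 e1 e2 !mulr0 subr0 addr0 oppr0.
  have a0 : rhoL g 1 1 - rhoL g 0 0 = 0.
    apply: (mulfI dd); rewrite mulr0.
    transitivity ((s1 * r0 + r1 * s0) * (Q g r0 r1 s0 s1 + Q g s0 s1 r0 r1)
       - 2 * (s1 * s0) * Q g r0 r1 r0 r1 - 2 * (r1 * r0) * Q g s0 s1 s0 s1).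
      by rewrite /Q /del; ring.
    by rewrite e0 e1 e2 !mulr0 !subr0.
  move: a0 b0 c0; rewrite /rhoL !mxE -rmorphB => /eqP; rewrite fmorph_eq0 subr_eq0 => /eqP a0.
  move=> /eqP; rewrite fmorph_eq0 => /eqP b0 /eqP; rewrite fmorph_eq0 => /eqP c0.
  by exists (rho g 0 0); apply: mx2P; rewrite !mxE /= ?mulr1n ?mulr0n.
pose U1 : {poly L} := s1 *: 'X + r1%:P.
have U10 : U1 != 0.
  apply/eqP => U0; move: del0; rewrite /del.
  have -> : r1 = 0 by move/polyP/(_ 0%N): U0; rewrite coefD coefZ coefX coefC coef0 /= mulr0 add0r.
  have -> : s1 = 0 by move/polyP/(_ 1%N): U0; rewrite coefD coefZ coefX coefC coef0 /= mulr1 addr0.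
  by rewrite mulr0 mul0r subrr eqxx.
have T0 : U1 * \prod_(g in G | g != 1%g) D g != 0.
  by rewrite mulf_neq0 //; apply/prodf_neq0 => g /andP[gG gn]; apply: D0.
have [f fL0] := fixed_avoid T0; rewrite hornerM horner_prod mulf_eq0 negb_or => /andP[].
rewrite /U1 !hornerE => u10 /prodf_neq0 Df.
pose u := r + f *: s; have eu : equivariant u by apply: equivariant_comb.
have u0E : u 0 0 = r0 + f * s0 by rewrite !mxE.
have u1E : u 0 1 = r1 + f * s1 by rewrite !mxE.
have u1n : u 0 1 != 0 by rewrite u1E addrC mulrC.
have actu g : g \in G -> act g (u 0 0) = u 0 0 * rhoL g 0 0 + u 0 1 * rhoL g 1 0 /\
    act g (u 0 1) = u 0 0 * rhoL g 0 1 + u 0 1 * rhoL g 1 1.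
  move=> gG; have [h1 h2] := row01 u (rhoL g); rewrite -h1 -h2 -eu //.
  by rewrite !mxE.
exists (u 0 0 / u 0 1); split=> [g gG gn|g gG].
  have [a0 a1] := actu g gG.
  have w1 : u 0 0 * rhoL g 0 1 + u 0 1 * rhoL g 1 1 != 0 by rewrite -a1 fmorph_eq0.
  rewrite fmorph_div a0 a1 eqr_div //.
  have := Df g; rewrite gG gn => /(_ isT); apply: contra => /eqP e.
  have -> : (D g).[f] = u 0 0 * (u 0 0 * rhoL g 0 1 + u 0 1 * rhoL g 1 1) -
     (u 0 0 * rhoL g 0 0 + u 0 1 * rhoL g 1 0) * u 0 1.
    by rewrite /D hornerD hornerD !hornerZ hornerXn hornerX hornerC u0E u1E /Q; ring.
  by rewrite e subrr.
have [a0 a1] := actu g gG.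
have w1 : u 0 0 * rhoL g 0 1 + u 0 1 * rhoL g 1 1 != 0 by rewrite -a1 fmorph_eq0.
exists (rho g 0 0), (rho g 1 0), (rho g 0 1), (rho g 1 1).
have rE i k : rhoL g i k = iota (rho g i k) by rewrite mxE.
rewrite -!rE.
have e1 : rhoL g 0 1 * (u 0 0 / u 0 1) + rhoL g 1 1 = (u 0 0 * rhoL g 0 1 + u 0 1 * rhoL g 1 1) / u 0 1.
  by field; exact: u1n.
have e2 : rhoL g 0 0 * (u 0 0 / u 0 1) + rhoL g 1 0 = (u 0 0 * rhoL g 0 0 + u 0 1 * rhoL g 1 0) / u 0 1.
  by field; exact: u1n.
split; first by rewrite e1 mulf_neq0 ?invr_eq0.
by rewrite e1 e2 fmorph_div a0 a1; field; rewrite w1 u1n.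
Qed.

(** With z as above, E = K(z) is G-stable and E0 its field of invariants.  It has
    transcendence degree one: at most because E has, and at least because E is
    algebraic over E0, while z is not algebraic over K. *)
Theorem equivariant_defined_over : exists2 E0, defined_over iota L0 E0 & has_trdeg iota E0 1.
Proof.
have [z [fz mob]] := equivariant_point.
pose E := simple_ext iota z.
have hE : divring_closed E by apply: simple_ext_div.
have [E1 EB Ediv] := hE.
have E_act g x : g \in G -> x \in E -> act g x \in E.
  move=> gG /simple_extP [P [Q [Q0 ->]]].
  have [a [b [c [e [w0 zE]]]]] := mob g gG.
  pose SE : divringClosed L := HB.pack E (GRing.isDivringClosed.Build L E hE).
  have SC d : iota d \in SE by apply: simple_extC.
  have Sz : z \in SE by apply: simple_ext_id.
  have Sgz : act g z \in SE.
    by rewrite zE; apply: rpred_div; apply: rpredD => //; apply: rpredM.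
  have Sev (r : {poly K}) : act g (ev iota z r) \in SE.
    have -> : act g (ev iota z r) = (map_poly iota r).[act g z].
      rewrite evE -horner_map -map_poly_comp; congr (_.[_]).
      by apply: eq_map_poly => d; rewrite /= actC.
    by apply: rpred_horner => //; apply/polyOverP => i; rewrite coef_map; apply: SC.
  by rewrite fmorph_div; apply: (rpred_div (Sev P) (Sev Q)).
have dE := artin_defined_over act1 actM actC L0P hE E_act fz (simple_ext_id iota z) (simple_extC iota z).
pose E0 : {pred L} := [pred x | (x \in E) && (x \in L0)].
exists E0; first exact: dE.
have tz : transc iota z by apply: (moved_transc g1G); apply: fz.
have [t tE tt] : exists2 t, t \in E0 & transc iota t.
  case: (excluded_middle_informative (exists2 t, t \in E0 & transc iota t)) => // nt.
  have [_ [E' [hE' _ [d [dE' _]] full]]] := dE.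
  have h0 y : y \in E0 -> algebraicOver iota y.
    move=> yE; case: (excluded_middle_informative (algebraicOver iota y)) => // ny.
    by case: nt; exists y.
  have [e eE /negP] := act_moved L0P g1G full (fz g1 g1G g1n); case.
  have [c ->] := Kcl (ext_degree_algebraic hE' h0 dE' eE).
  by rewrite actC.
apply: (has_trdeg1_intro tE tt) => a b; rewrite !inE => /andP[aE _] /andP[bE _].
exact: simple_ext_dependent aE bE.
Qed.
End Equivariant.
End Upper.

(** * Dihedral groups and their plane representations *)

Section DihedralStructure.
Local Open Scope group_scope.

(** This bounds the order of the group of the presentation from below, for n = 1 by the
    group of order two, with s trivial. *)
Lemma dihedral_model n : (0 < n)%N -> exists (rT : finGroupType) (H : {group rT}),
  #|H| = n.*2 /\ H \homg Grp (s : t : s ^+ n, t ^+ 2, t * s * t^-1 = s^-1).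
Proof.
case: n => [|[|q]] // _.
  exists _, <[Zp1 : 'I_2]>%G; split; first by rewrite -orderE order_Zp1.
  apply/existsP; exists (1, Zp1) => /=.
  rewrite !xpair_eqE /= cycle1 joing1G ?expg1 mulg1 mulgV invg1 !eqxx /= ?andbT.
  by [].
exists _, [group of 'D_(q.+2.*2)]; split; first exact: card_dihedral.
have /existsP[[x y] /=] := isoGrp_hom (Grp_dihedral (isT : (1 < q.+2)%N)).
rewrite !xpair_eqE => /and4P[G1 x1 y2 xy].
apply/existsP; exists (x, y); rewrite /= !xpair_eqE G1 x1 y2 /=.
have yV : y^-1 = y by apply/eqP; rewrite eq_invg_mul -(expgS y 1).
by rewrite -(eqP xy) conjgE yV mulgA.
Qed.

(** The images of s and t give at most 2n products s^i t^j, and the model shows that there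
    are 2n elements; so no two of these products agree. *)
Lemma dihedral_structure n (gT : finGroupType) (G : {group gT}) : (0 < n)%N -> is_dihedral n G ->
  exists s t, [/\ s \in G, t \in G, #[s] = n, t \notin <[s]> &
   [/\ t ^+ 2 = 1, t * s * t^-1 = s^-1 &
     forall g, g \in G -> exists i j, (j < 2)%N /\ g = s ^+ i * t ^+ j]].
Proof.
move=> n0 dG; have /existsP[[s t] /=] := isoGrp_hom dG.
rewrite !xpair_eqE => /and4P[/eqP GE /eqP sn /eqP t2 /eqP ts].
have nts : <[t]> \subset 'N(<[s]>).
  rewrite cycle_subG; apply/normP.
  rewrite -cycleJ conjgE.
  have tV : t^-1 = t by apply/eqP; rewrite eq_invg_mul -(expgS t 1) t2.
  have -> : t^-1 * (s * t) = t * s * t^-1 by rewrite tV mulgA.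
  by rewrite ts cycleV.
have GM : <[s]> * <[t]> = G by rewrite -norm_joinEr // GE.
have sG : s \in G by rewrite -GM -{1}[s]mulg1 mem_mulg ?group1 ?cycle_id.
have tG : t \in G by rewrite -GM -{1}[t]mul1g mem_mulg ?group1 ?cycle_id.
have [rT [H [oH homH]]] := dihedral_model n0.
have oG : (n.*2 <= #|G|)%N.
  rewrite -oH; apply: dvdn_leq; first exact: cardG_gt0.
  by apply: card_homg; rewrite dG.
have os : (#[s] <= n)%N by apply: dvdn_leq => //; rewrite order_dvdn sn.
have ot : (#[t] <= 2)%N by apply: dvdn_leq => //; rewrite order_dvdn t2.
have st : (#|G| * #|<[s]> :&: <[t]>| = #[s] * #[t])%N by rewrite -GM mul_cardG.
have os' : #[s] = n.
  apply/eqP; rewrite eqn_leq os /=.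
  rewrite -(leq_pmul2r (isT : (0 < 2)%N)) muln2; apply: leq_trans oG _.
  apply: leq_trans (leq_pmulr _ (cardG_gt0 (<[s]> :&: <[t]>)%G)) _.
  by rewrite /= st leq_mul.
exists s, t; split=> //.
  apply/negP => ts'; have tss : <[t]> \subset <[s]> by rewrite cycle_subG.
  move: oG; rewrite -GM mulGSid // -orderE os' -addnn -{3}[n]addn0 leq_add2l.
  by rewrite leqNgt n0.
split=> // g; rewrite -GM => /mulsgP [_ _ /cycleP[i ->] /cycleP[k ->] ->].
exists i, (k %% 2)%N; split; first by rewrite ltn_pmod.
by rewrite -(expg_mod k t2).
Qed.
End DihedralStructure.

(** Every element has a unique expression s^i t^j with i modulo n and j < 2, so matrices
    that satisfy the relations define a representation. *)
Section DihedralRepresentation.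
Variables (K : fieldType) (gT : finGroupType) (G : {group gT}) (n : nat) (s t : gT).
Hypotheses (n0 : (0 < n)%N) (os : #[s]%g = n) (tns : t \notin <[s]>%g).
Hypotheses (t2 : (t ^+ 2 = 1)%g) (ts : (t * s * t^-1 = s^-1)%g).
Hypothesis gen : forall g, g \in G -> exists i j, (j < 2)%N /\ g = (s ^+ i * t ^+ j)%g.
Variables (S T : 'M[K]_2).
Hypotheses (Sn : S ^+ n = 1) (T2 : T ^+ 2 = 1) (TS : T * S = S ^+ n.-1 * T).
Hypothesis ns : forall i j, (j < 2)%N -> scalar2 (S ^+ i * T ^+ j) -> (n %| i)%N /\ j = 0%N.

Let tsE : (t * s = s ^+ n.-1 * t)%g.
Proof.
have -> : (s ^+ n.-1 = s^-1)%g.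
  by apply/eqP; rewrite eq_sym eq_invg_mul -expgS prednK // -os expg_order.
by rewrite -ts mulgKV.
Qed.

Let tsX k : (t * s ^+ k = s ^+ (n.-1 * k) * t)%g.
Proof.
elim: k => [|k IH]; first by rewrite muln0 !expg0 mulg1 mul1g.
by rewrite expgS mulgA tsE -mulgA IH mulgA -expgD mulnS.
Qed.

Let TSX k : T * S ^+ k = S ^+ (n.-1 * k) * T.
Proof.
elim: k => [|k IH]; first by rewrite muln0 !expr0 mulr1 mul1r.
by rewrite exprS mulrA TS -mulrA IH mulrA -exprD mulnS.
Qed.

Let word_eq i j k l : (j < 2)%N -> (l < 2)%N -> (s ^+ i * t ^+ j = s ^+ k * t ^+ l)%g ->
  S ^+ i * T ^+ j = S ^+ k * T ^+ l.
Proof.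
move=> j2 l2 e.
have jl : j = l.
  have e2 : (t ^+ j * t ^- l = s ^- i * s ^+ k)%g.
    by apply: (mulgI (s ^+ i)%g); rewrite mulgA e mulgK mulKVg.
  have inS : (t ^+ j * t ^- l)%g \in <[s]>%g.
    by rewrite e2 groupM ?groupV ?mem_cycle.
  case: j l j2 l2 {e e2} inS => [|[|//]] [|[|//]] // _ _.
    by rewrite expg0 mul1g groupV expg1 (negPf tns).
  by rewrite expg0 invg1 mulg1 expg1 (negPf tns).
rewrite jl in e *; congr (_ * _); move/mulIg/eqP: e.
rewrite eq_expg_mod_order os => /eqP e.
by rewrite -(expr_mod i Sn) -(expr_mod k Sn) e.
Qed.

Let w_ex g : exists M : 'M[K]_2, g \in G -> exists i j, [/\ (j < 2)%N, g = (s ^+ i * t ^+ j)%g &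
  M = S ^+ i * T ^+ j].
Proof.
case: (boolP (g \in G)) => [/gen [i [j [j2 ->]]]|]; last by exists 0.
by exists (S ^+ i * T ^+ j) => _; exists i, j.
Qed.

Lemma dihedral_rep : exists rho : gT -> 'M[K]_2,
  [/\ forall g h, g \in G -> h \in G -> rho (g * h)%g = rho g *m rho h, rho 1%g = 1%:M &
      forall g, g \in G -> g != 1%g -> ~ scalar2 (rho g)].
Proof.
pose rho g := sval (constructive_indefinite_description _ (w_ex g)).
have rP g : g \in G -> exists i j, [/\ (j < 2)%N, g = (s ^+ i * t ^+ j)%g & rho g = S ^+ i * T ^+ j].
  exact: svalP (constructive_indefinite_description _ (w_ex g)).
have rE i j : (j < 2)%N -> (s ^+ i * t ^+ j)%g \in G -> rho (s ^+ i * t ^+ j)%g = S ^+ i * T ^+ j.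
  move=> j2 /rP [k [l [l2 e ->]]]; exact: esym (word_eq j2 l2 e).
exists rho; split.
- move=> g h gG hG; have ghG := groupM gG hG.
  have [i [j [j2 gE ->]]] := rP g gG; have [k [l [l2 hE ->]]] := rP h hG.
  have [i' [j' [j'2 e1 e2]]] : exists i' j', [/\ (j' < 2)%N, (g * h = s ^+ i' * t ^+ j')%g &
      S ^+ i * T ^+ j * (S ^+ k * T ^+ l) = S ^+ i' * T ^+ j'].
    rewrite gE hE; case: j j2 {gE} => [|[|//]] _.
      exists (i + k)%N, l; split=> //; first by rewrite expg0 mulg1 mulgA expgD.
      by rewrite expr0 mulr1 mulrA exprD.
    exists (i + n.-1 * k)%N, (l.+1 %% 2)%N; rewrite ltn_pmod //; split=> //.
      by rewrite expg1 -mulgA [(t * _)%g]mulgA tsX (expg_mod _ t2) expgD expgS !mulgA.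
    by rewrite expr1 -mulrA [T * _]mulrA TSX (expr_mod _ T2) exprD exprS !mulrA.
  by rewrite -[RHS]/(_ * _) e2 e1 rE // -e1.
- have := rE 0%N 0%N isT; rewrite !expg0 mulg1 !expr0 mulr1 => -> //; exact: group1.
move=> g gG gn; have [i [j [j2 gE ->]]] := rP g gG => /(ns j2) [ni j0].
case/eqP: gn; rewrite gE j0 expg0 mulg1; apply/eqP.
by rewrite -order_dvdn os.
Qed.
End DihedralRepresentation.

Section DihedralMatrices.
Variable K : fieldType.

(** The matrix of X^2 - c X + 1: its eigenvalues are z and 1/z when c = z + 1/z. *)
Definition companion (c : K) : 'M[K]_2 :=
  \matrix_(i, k) (if i == 0 then (if k == 0 then 0 else -1) else (if k == 0 then 1 else c)).
(** An involution that conjugates the companion matrix to its inverse. *)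
Definition flip (c : K) : 'M[K]_2 :=
  \matrix_(i, k) (if i == 0 then (if k == 0 then 1 else c) else (if k == 0 then 0 else -1)).

Lemma flip_sq c : flip c ^+ 2 = 1.
Proof.
rewrite expr2 -[LHS]/(_ *m _); apply: mx2P; rewrite mulmx2 !mxE /= ?mulr1n ?mulr0n; ring.
Qed.

Lemma flip_companion c : flip c * companion c * (flip c * companion c) = 1.
Proof.
rewrite -[LHS]/((_ *m _) *m (_ *m _)); apply: mx2P; rewrite !mulmx2 !mxE /= ?mulr1n ?mulr0n; ring.
Qed.

Lemma companion_nonscalar c : ~ scalar2 (companion c).
Proof.
by move=> [d /matrixP/(_ 1 0)]; rewrite !mxE /= mulr0n => /eqP; rewrite oner_eq0.
Qed.

Lemma companion_tr c : tr2 (companion c) = c /\ det2 (companion c) = 1.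
Proof. by rewrite /tr2 /det2 !mxE /=; split; ring. Qed.
End DihedralMatrices.

Section DihedralWitnesses.
Variable K : fieldType.

Lemma flip_unit (c : K) : flip c \is a GRing.unit.
Proof. by apply/unitrP; exists (flip c); rewrite -expr2 flip_sq. Qed.

Lemma companion_unit (c : K) : companion c \is a GRing.unit.
Proof.
rewrite -[companion c](mulKr (flip_unit c)) unitrMl ?unitrV ?flip_unit //.
by apply/unitrP; exists (flip c * companion c); rewrite flip_companion.
Qed.

(** Powers of the companion matrix are governed by the Lucas sequence.  If S^i T were
    scalar, for S the companion matrix and T the flip, T would commute with S, giving
    S^2 = 1 and n | 2. *)
Lemma companion_flip (c : K) n : (1 < n)%N -> (forall k, lucas c 1 k = 0 <-> (n %| k)%N) ->
  lucas c 1 n.-1 = -1 -> ~~ (n %| 2)%N ->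
  [/\ companion c ^+ n = 1, flip c * companion c = companion c ^+ n.-1 * flip c &
   forall i k, (k < 2)%N -> scalar2 (companion c ^+ i * flip c ^+ k) -> (n %| i)%N /\ k = 0%N].
Proof.
move=> n1 h l1 n2; have [tE dE] := companion_tr c.
have scP k : scalar2 (companion c ^+ k) <-> (n %| k)%N.
  by rewrite -h -{2}tE -dE; apply: mx2_exp_scalar; exact: companion_nonscalar.
have Sn : companion c ^+ n = 1.
  case: n n1 h l1 n2 scP => // n' n1 h l1 n2 _.
  by rewrite mx2_exp tE dE l1 (h _).2 // scale0r sub0r mul1r raddfN opprK.
have TS : flip c * companion c = companion c ^+ n.-1 * flip c.
  apply: (mulIr (flip_unit c)); rewrite -[RHS]mulrA -expr2 flip_sq mulr1.
  apply: (mulIr (companion_unit c)); rewrite -mulrA flip_companion -exprSr prednK //.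
  exact: ltnW.
split=> // i [|[|//]] _; first by rewrite expr0 mulr1 => /scP.
rewrite expr1 => -[d e]; case/negP: n2; apply/scP; exists 1.
have cS : GRing.comm (companion c ^+ i * flip c) (companion c).
  by rewrite e; apply: esym; exact: mul2_scalar.
have cT : GRing.comm (companion c) (flip c).
  apply: (mulrI (unitrX i (companion_unit c))).
  have := cS; rewrite /GRing.comm -mulrA => ->.
  by rewrite mulrA -exprS exprSr mulrA.
have := flip_companion c; rewrite -{2}cT mulrA -[_ * _ * companion c]mulrA -!mulrA.
rewrite [companion c * _]mulrA -expr2 [_ ^+ 2 * _](_ : _ = flip c * companion c ^+ 2); last first.
  by apply: esym; apply: commrX; exact: esym.
by rewrite mulrA -expr2 flip_sq mul1r.
Qed.

(** Here the Lucas sequence is (z^k - z^-k) / (z - z^-1), and z^2k = 1 means n | k as n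
    is odd. *)
Lemma lucas_prim_root (L : fieldType) (j : {rmorphism K -> L}) (z : L) c n :
  n.-primitive_root z -> j c = z + z^-1 -> (2 < n)%N -> odd n ->
  (forall k, lucas c 1 k = 0 <-> (n %| k)%N) /\ lucas c 1 n.-1 = -1.
Proof.
move=> pz cE n2 on; have z0 : z != 0 by rewrite (prim_root_eq0 pz); case: (n) n2.
have cop : coprime n 2 by rewrite coprimen2.
have jd : j 1 = z * z^-1 by rewrite rmorph1 divff.
have zz : z - z^-1 != 0.
  rewrite subr_eq0; apply/eqP => e; have : z ^+ 2 == 1 by rewrite expr2 {2}e divff.
  by rewrite -(prim_order_dvd pz) => /(dvdn_leq (isT : (0 < 2)%N)); rewrite leqNgt n2.
have lP := fun k => lucas_roots k cE jd.
split=> [k|].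
  have -> : lucas c 1 k = 0 <-> z ^+ k - z^-1 ^+ k == 0.
    rewrite -lP mulf_eq0 (negPf zz) orbF fmorph_eq0; exact: (rwP eqP).
  rewrite subr_eq0 -(inj_eq (mulIf (expf_neq0 k z0))) -exprMn -exprMn mulVf // expr1n -expr2 -exprM.
  by rewrite -(prim_order_dvd pz) Gauss_dvdr.
apply: (fmorph_inj j); apply: (mulIf zz); rewrite lP rmorphN rmorph1 mulN1r opprB.
have zn : z ^+ n.-1 = z^-1.
  apply: (mulIf z0); rewrite -exprSr prednK ?(prim_expr_order pz) ?mulVf //; exact: ltnW (ltnW n2).
by rewrite exprVn zn invrK.
Qed.

(** For a double root 1 the Lucas sequence is k, so the companion matrix is unipotent
    and not the identity. *)
Lemma lucas_pchar p : p \in [pchar K] ->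
  (forall k, lucas (2 : K) 1 k = 0 <-> (p %| k)%N) /\ lucas (2 : K) 1 p.-1 = -1.
Proof.
move=> pK; have lE k : lucas (2 : K) 1 k = k%:R.
  case: k => [//|k]; have := lucas_double (j := idfun) (t := 2) (d := 1) (u := 1 : K) k.
  by rewrite expr1n !mulr1 /=; apply; rewrite -?natrD.
split=> [k|]; first by rewrite lE (dvdn_pcharf pK); exact: (rwP eqP).
rewrite lE; apply/eqP; rewrite eq_sym eqr_oppLR -subr_eq0 opprK addrC natr1 prednK.
  by rewrite (pcharf0 pK).
exact/prime_gt0/(pcharf_prime pK).
Qed.

Definition unipotent (a : K) : 'M[K]_2 :=
  \matrix_(i, k) (if i == k then 1 else if i == 0 then a else 0).

Lemma unipotentM a b : unipotent a * unipotent b = unipotent (a + b).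
Proof.
by rewrite -[LHS]/(_ *m _); apply: mx2P; rewrite mulmx2 !mxE /= ?mulr1n ?mulr0n; ring.
Qed.

Lemma unipotent0 : unipotent 0 = 1.
Proof. by apply: mx2P; rewrite !mxE. Qed.

Lemma unipotent_nonscalar a : scalar2 (unipotent a) -> a = 0.
Proof. by move=> [d /matrixP/(_ 0 1)]; rewrite !mxE. Qed.

End DihedralWitnesses.

(** * Essential dimension one for linear actions *)

(** A plane representation that stays faithful in PGL_2; this is what the construction
    of fields of definition of transcendence degree one uses. *)
Definition scalar_free_rep (K : fieldType) (gT : finGroupType) (G : {group gT}) : Prop :=
  exists rho : gT -> 'M[K]_2,
  [/\ forall g h, g \in G -> h \in G -> rho (g * h)%g = rho g *m rho h, rho 1%g = 1%:M &
      forall g, g \in G -> g != 1%g -> ~ scalar2 (rho g)].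

Section DihedralPlane.
Variables (K : fieldType) (n : nat) (gT : finGroupType) (G : {group gT}).
Hypotheses (n0 : (0 < n)%N) (dG : is_dihedral n G).

Lemma scalar_free_rep_lucas (c : K) : odd n -> (1 < n)%N ->
  (forall k, lucas c 1 k = 0 <-> (n %| k)%N) -> lucas c 1 n.-1 = -1 -> scalar_free_rep K G.
Proof.
move=> on n1 h l1; have [s [t [_ _ os tns [t2 ts gen]]]] := dihedral_structure n0 dG.
have n2 : ~~ (n %| 2)%N.
  by apply/negP => /(dvdn_leq (isT : (0 < 2)%N)) n2; case: (n) on n1 n2 => [|[|[|]]].
have [Sn TS ns] := companion_flip n1 h l1 n2.
exact: (dihedral_rep n0 os tns t2 ts gen Sn (flip_sq c) TS ns).
Qed.

Lemma scalar_free_rep_zeta (Kbar : closedFieldType) (j : {rmorphism K -> Kbar}) :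
  odd n -> zeta_sum_in j n -> scalar_free_rep K G.
Proof.
move=> on [z pz [c cE]]; case: (ltnP 2 n) => n2.
  have [h l1] := lucas_prim_root pz cE n2 on.
  by apply: scalar_free_rep_lucas h l1 => //; exact: ltnW.
have n1 : n = 1%N by case: (n) on n2 => [|[|[|]]].
have [s [t [_ _ os tns [t2 ts gen]]]] := dihedral_structure n0 dG.
apply: (dihedral_rep (S := 1) (T := flip 1) n0 os tns t2 ts gen).
- exact: expr1n.
- exact: flip_sq.
- by rewrite expr1n mul1r mulr1.
move=> i [|[|//]] _; first by rewrite n1 dvd1n.
rewrite expr1n mul1r expr1 => -[d /matrixP/(_ 0 1)/eqP].
by rewrite !mxE /= mulr0n oner_eq0.
Qed.

Lemma scalar_free_rep_pchar : odd n -> n \in [pchar K] -> scalar_free_rep K G.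
Proof.
move=> on nK; have [h l1] := lucas_pchar nK.
exact: scalar_free_rep_lucas on (prime_gt1 (pcharf_prime nK)) h l1.
Qed.

(** The additive group of K acts by unipotent matrices, and in characteristic two 0, 1, a
    and 1 + a form a Klein four-group in it. *)
Lemma scalar_free_rep_klein (a : K) : n = 2%N -> 2%N \in [pchar K] -> a != 0 -> a != 1 ->
  scalar_free_rep K G.
Proof.
move=> n2 K2 a0 a1; have [s [t [_ _ os tns [t2 ts gen]]]] := dihedral_structure n0 dG.
have sq (b : K) : unipotent b ^+ 2 = 1 by rewrite expr2 unipotentM (addrr_pchar2 K2) unipotent0.
apply: (dihedral_rep (S := unipotent 1) (T := unipotent a) n0 os tns t2 ts gen).
- by rewrite n2 sq.
- exact: sq.
- by rewrite n2 expr1 !unipotentM addrC.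
move=> i k k2; have -> : unipotent 1 ^+ i = unipotent (i%:R : K).
  elim: i => [|i IH]; first by rewrite unipotent0 expr0.
  by rewrite exprS IH unipotentM -mulrS.
have -> : unipotent a ^+ k = unipotent (a *+ k).
  by case: k k2 => [|[|]] // _; rewrite unipotent0.
rewrite unipotentM => /unipotent_nonscalar e; rewrite n2 (dvdn_pcharf K2).
case: k k2 e => [|[|//]] _; first by rewrite addr0 => /eqP.
rewrite mulr1n => e; exfalso; move: e.
have -> : i%:R = (odd i)%:R :> K.
  by rewrite -{1}(odd_double_half i) natrD -muln2 natrM (pcharf0 K2) mulr0 addr0.
case: (odd i) => /eqP; last by rewrite add0r (negPf a0).
by rewrite addr_eq0 (oppr_pchar2 K2) eq_sym (negPf a1).
Qed.
End DihedralPlane.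

Section GroupAction.
Variables (K : fieldType) (gT : finGroupType) (G : {group gT}) (m : nat).
Variables (V : mx_representation K G m) (fV : mx_faithful V).
Local Notation iC := (ratfunC K m).

Lemma ratfun_act_faithful g : g \in G -> g != 1%g -> exists x, ratfun_act V g x != x.
Proof.
move=> gG gn; case: (excluded_middle_informative (exists x, ratfun_act V g x != x)) => // nx.
case/negP: gn; rewrite -in_set1; apply: (subsetP fV); rewrite inE gG mul1mx /=.
apply/eqP/matrixP => i k.
have : ratfun_act V g (tofrac 'X_k) = tofrac 'X_k.
  by apply/eqP/negPn/negP => h; apply: nx; exists (tofrac 'X_k).
rewrite ratfun_actE // ratfun_subst_tofrac ?repr_mx_unit // => /tofrac_inj.
rewrite lin_substX => /(congr1 (fun p : {mpoly K[m]} => p@_U_(i))%MM).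
rewrite mcoeffX raddf_sum /= (bigD1 i) //= mcoeffZ mcoeffX eqxx mulr1.
rewrite big1 => [|l li]; last first.
  by rewrite mcoeffZ mcoeffX; case: eqP => [/mnmP/(_ i)|]; rewrite ?mulr0 // !mnm1E eqxx (negPf li).
rewrite addr0 => ->; rewrite !mxE.
case: (i =P k) => [->|/eqP ik]; first by rewrite eqxx.
by case: eqP => // /mnmP/(_ i); rewrite !mnm1E eqxx eq_sym (negPf ik).
Qed.

Let L0P x : x \in ratfun_fixed V <-> forall g, g \in G -> ratfun_act V g x = x.
Proof. by split=> /ratfun_fixedP. Qed.

Let actC g c : g \in G -> ratfun_act V g (iC c) = iC c.
Proof. by move=> _; exact: ratfun_actC. Qed.

Variable t : gT.
Hypotheses (tG : t \in G) (t1 : t != 1%g).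

(** Transcendence degree zero being impossible, a field of definition of transcendence
    degree one is automatically minimal. *)
Lemma is_essdim1 : is_essdim_group V 1 <->
  exists2 E0, defined_over iC (ratfun_fixed V) E0 & has_trdeg iC E0 1.
Proof.
split=> [[h _] //|h]; split=> // E0 [|e] dE tE //; exfalso.
have [x tx] := ratfun_act_faithful tG t1.
exact: (defined_over_trdeg_gt0 L0P (@ratfun_alg_closed K m) actC tG tx dE tE).
Qed.

Lemma essdim1_scalar_free_rep : scalar_free_rep K G -> is_essdim_group V 1.
Proof.
move=> [rho [rhoM rho1 rho_ns]]; apply/is_essdim1.
apply: (equivariant_defined_over (ratfun_act1 V) (@ratfun_actM _ _ _ _ V) actC
  (@ratfun_alg_closed K m) L0P ratfun_act_faithful tG t1 rhoM rho1 rho_ns).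
Qed.

Lemma essdim1_transc : is_essdim_group V 1 -> exists t, [/\ transc iC t, forall g, g \in G -> ratfun_act V g t = t &
  forall g, g \in G -> g != 1%g -> exists2 e, alg_over iC t e & ratfun_act V g e != e].
Proof.
move=> /is_essdim1 [E0 dE tE]; have [x [tx /L0P xL0 h]] := essdim1_moved L0P dE tE.
exists x; split=> // g gG gn; have [y gy] := ratfun_act_faithful gG gn.
exact: h gG gy.
Qed.

Lemma essdim1_mobius : is_essdim_group V 1 -> mobius_action K G.
Proof.
move=> /essdim1_transc [x [tx fx moved]].
exact: (mobius_model (ratfun_act1 V) (@ratfun_actM _ _ _ _ V) (ratfun_actC V) tx fx moved).
Qed.

Lemma essdim1_no_klein g h : (2%:R : K) != 0 -> is_essdim_group V 1 -> g \in G -> h \in G ->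
  (g * g = 1)%g -> (h * h = 1)%g -> (g * h = h * g)%g ->
  g != 1%g -> h != 1%g -> (g * h != 1)%g -> False.
Proof.
move=> c2 /essdim1_transc [x [tx fx moved]] gG hG gg hh gh g1 h1 gh1.
have ghG : (g * h)%g \in G by exact: groupM.
have mv k : k \in G -> k != 1%g -> exists2 e, alg_over iC x e & ratfun_subst (V k) e != e.
  by move=> kG /(moved k kG) [e Qe ke]; exists e; [exact: Qe|rewrite -(ratfun_actE V e kG); exact: ke].
apply: (no_klein_trdeg1 c2 (A := V g) (B := V h) _ _ _ tx).
- by rewrite -repr_mxM // gg repr_mx1.
- by rewrite -repr_mxM // hh repr_mx1.
- by rewrite -!repr_mxM // gh.
- rewrite -(ratfun_actE V x gG); exact: fx.
- rewrite -(ratfun_actE V x hG); exact: fx.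
- exact: mv gG g1.
- exact: mv hG h1.
rewrite -(repr_mxM V gG hG); exact: mv ghG gh1.
Qed.
End GroupAction.

(** * The dihedral criterion *)

(** In characteristic two a third element a of K yields the fourth one a + 1. *)
Lemma card_ge4P (K : fieldType) : 2%N \in [pchar K] ->
  (exists s : 4.-tuple K, uniq s) <-> (exists a : K, a != 0 /\ a != 1).
Proof.
move=> K2; split=> [[s us]|[a [a0 a1]]].
  have /hasP [a _] : has (predC (mem [:: 0; 1 : K])) s.
    rewrite -[has _ _]negbK -all_predC; apply/negP => /allP h.
    suff : (size s <= 2)%N by rewrite size_tuple.
    apply: (uniq_leq_size (s2 := [:: 0; 1 : K]) us) => x /h /=; by rewrite negbK.
  by rewrite /= !inE negb_or => /andP[a0 a1]; exists a.
exists [tuple 0; 1; a; a + 1]; rewrite /= !inE !negb_or.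
have a2 : a + 1 != 0 by rewrite addr_eq0 (oppr_pchar2 K2).
rewrite [0 == 1]eq_sym ![_ == a]eq_sym ![_ == a + 1]eq_sym oner_eq0 a0 a1 a2.
by rewrite -subr_eq0 addrK a0 -subr_eq0 addrAC subrr add0r oner_eq0.
Qed.

Theorem theorem5p8 (n : nat) (n_gt0 : (0 < n)%N)
    (gT : finGroupType) (Dn : {group gT}) (dihedral_Dn : is_dihedral n Dn)
    (K : fieldType)
    (Kbar : closedFieldType) (j : {rmorphism K -> Kbar})
    (algebraic_Kbar : forall x : Kbar, algebraicOver j x)
    (m : nat) (V : mx_representation K Dn m) (faithful_V : mx_faithful V) :
  (2%N \notin [pchar K] ->
     (is_essdim_group V 1 <->
        odd n /\
        ((char_ndvd K n -> zeta_sum_in j n) /\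
         (forall p : nat, p \in [pchar K] -> (p %| n)%N -> n = p)))) /\
  (2%N \in [pchar K] ->
     (odd n -> (is_essdim_group V 1 <-> zeta_sum_in j n)) /\
     (~~ odd n ->
        (is_essdim_group V 1 <->
           n = 2%N /\ exists s : 4.-tuple K, uniq s))).
Proof.
have [s [t [sG tG os tns [t2 ts gen]]]] := dihedral_structure n_gt0 dihedral_Dn.
have t1 : t != 1%g by apply: contraNneq tns => ->; exact: group1.
have rep := essdim1_scalar_free_rep faithful_V tG t1.
have mob := essdim1_mobius faithful_V tG t1.
have noklein := essdim1_no_klein faithful_V tG t1.
have tt : (t * t = 1)%g by rewrite -[RHS]t2.
have tV : (t^-1 = t)%g by apply/eqP; rewrite eq_invg_mul tt.
split=> [K2|K2]; last split=> [on|en].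
- split=> [ed1|[on [hz hp]]].
    have on : odd n.
      apply/negPn/negP => en.
      (* s^(n/2) is central, so with t it generates a Klein four-group *)
      have nE : n = (n./2 * 2)%N by rewrite muln2 -[LHS]odd_double_half (negPf en).
      have n20 : (0 < n./2)%N by move: n_gt0; rewrite {1}nE; case: (n./2).
      pose g := (s ^+ n./2)%g; have gG : g \in Dn by apply: groupX.
      have gg : (g * g = 1)%g by rewrite -expgD addnn -muln2 -nE -os expg_order.
      have g1 : g != 1%g.
        apply/negP; rewrite -order_dvdn os => /(dvdn_leq n20).
        by rewrite leqNgt {2}nE muln2 -addnn -{1}[n./2]addn0 ltn_add2l n20.
      have gt : (g * t = t * g)%g.
        apply: (mulIg t^-1)%g; rewrite mulgK /g -[RHS]/(t * s ^+ n./2 * t^-1)%g.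
        have cj x : (t * x * t^-1 = x ^ t^-1)%g by rewrite conjgE invgK mulgA.
        rewrite cj conjXg -cj.
        by rewrite ts expgVn; apply/eqP; rewrite eq_sym eq_invg_mul; apply/eqP.
      apply: (noklein g t) => //.
      apply/negP => e; case/negP: tns; move: e.
      by rewrite -eq_invg_mul => /eqP <-; rewrite groupV mem_cycle.
    split=> //; split=> [ch|p pK pn].
      by have := mobius_action_zeta (mob ed1) j sG; rewrite os => /(_ ch).
    by have := mobius_action_pchar (mob ed1) sG pK; rewrite os => /(_ pn).
  apply: rep.
  case: (excluded_middle_informative (exists2 p, p \in [pchar K] & (p %| n)%N)) => [[p pK pn]|np].
    have np := hp p pK pn; rewrite -np in pK.
    exact: scalar_free_rep_pchar n_gt0 dihedral_Dn on pK.
  apply: scalar_free_rep_zeta n_gt0 dihedral_Dn _ _ on (hz _).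
  by move=> p pK; apply/negP => pn; apply: np; exists p.
- split=> [ed1|z]; last by apply: rep; exact: scalar_free_rep_zeta n_gt0 dihedral_Dn _ _ on z.
  have ch : char_ndvd K #[s]%g.
    by move=> p; rewrite (pcharf_eq K2) inE => /eqP ->; rewrite os dvdn2 on.
  by have := mobius_action_zeta (mob ed1) j sG ch; rewrite os.
- split=> [ed1|[n2 /(card_ge4P K2) [a [a0 a1]]]]; last first.
    by apply: rep; exact (scalar_free_rep_klein n_gt0 dihedral_Dn n2 K2 a0 a1).
  have n2 : n = 2%N.
    by have := mobius_action_pchar (mob ed1) sG K2; rewrite os dvdn2 => /(_ en).
  split=> //; apply/(card_ge4P K2).
  case: (excluded_middle_informative (exists a : K, a != 0 /\ a != 1)) => // na; exfalso.
  have K01 (c : K) : c = 0 \/ c = 1.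
    case: (eqVneq c 0) => [->|c0]; [by left|right].
    by apply/eqP/negPn/negP => c1; apply: na; exists c.
  (* now K has two elements and s, t generate a Klein four-group *)
  have ss : (s * s = 1)%g by rewrite -(expgS s 1) -n2 -os expg_order.
  have s1 : s != 1%g by rewrite -order_eq1 os n2.
  have st : (s * t = t * s)%g.
    by apply: (mulIg t^-1)%g; rewrite mulgK ts; apply/eqP; rewrite eq_sym eq_invg_mul; apply/eqP.
  apply: (mobius_action_klein (mob ed1) K01 sG tG ss tt _ s1 t1).
    by rewrite {2}st mulgA -[(s * t * t)%g]mulgA tt mulg1.
  apply/negP => /eqP e; case/negP: tns.
  have -> : t = (s^-1)%g by apply/eqP; rewrite eq_sym eq_invg_mul e.
  by rewrite groupV cycle_id.
Qed.
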